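(* Assume that $\alpha(x):=\max\{i>0: p_i\ge 1/x\}=x^{\theta}L(x)$ for some $\theta\in(0,1)$ and some function $L$ slowly varying at infinity. Let $m\ge 1$, let $k_1,\dots,k_m\ge 1$ be integers and let $A_1,\dots,A_m$ be Borel subsets of $[0,1]$. For $t>0$ set $$Y^{\Pi,*}_{t,A,k}:=\frac{R^{\Pi,*}_{tA,k}-\mathbb{E}R^{\Pi,*}_{tA,k}}{\sqrt{M(t)}}.$$ Then, as $t\to\infty$, the random vector $\bigl(Y^{\Pi,*}_{t,A_1,k_1},\dots,Y^{\Pi,*}_{t,A_m,k_m}\bigr)$ converges weakly to a centered Gaussian vector $\bigl(Y^*_{A_1,k_1},\dots,Y^*_{A_m,k_m}\bigr)$ whose covariances are $\mathrm{cov}(Y^*_{A_i,k_i},Y^*_{A_j,k_j})=K^*(A_i,k_i,A_j,k_j)$, where $$K^*(A,k,B,l):=\frac{1}{\Gamma(1-\theta)}\int_0^\infty \mathrm{cov}\bigl(\mathbf{1}(\Pi(uA)<k),\,\mathbf{1}(\Pi(uB)<l)\bigr)\,d(-u^{-\theta}).$$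
   Context: $\mathbb{Z}_+=\{1,2,\dots\}$. $X_1,X_2,\dots$ are i.i.d. $\mathbb{Z}_+$-valued random variables with $p_i:=\mathbb{P}(X_1=i)>0$ and $p_i\ge p_{i+1}$ for all $i\ge1$ ($X_j$ is the label of the urn hit by ball $j$). $\Pi$ is a Poisson process of intensity $1$ on $[0,\infty)$, independent of $(X_j)$, with arrival times $0<T_1<T_2<\cdots$. For Borel $B\subseteq[0,\infty)$: $\Pi(B)$ is the number of $j$ with $T_j\in B$; $\Pi_i(B)$ is the number of $j$ with $T_j\in B$ and $X_j=i$; $R^{\Pi,*}_{B,k}$ is the number of urns $i\ge1$ with $\Pi_i(B)\ge k$. $tA=\{ta:a\in A\}$. $M(t):=\mathbb{E}R^{\Pi,*}_{[0,t],1}=\sum_{i\ge1}(1-e^{-tp_i})$. The measure $d(-u^{-\theta})$ is $\theta u^{-\theta-1}\,du$. *)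

(* Defs.v *)
From HB Require Import structures.
From mathcomp Require Import all_boot all_order all_algebra.
From mathcomp Require Import all_classical all_reals all_analysis.
From mathcomp Require Import measurable_realfun.

Set Implicit Arguments.
Unset Strict Implicit.
Unset Printing Implicit Defensive.

Import Order.TTheory GRing.Theory Num.Theory.
Import numFieldNormedType.Exports.

Local Open Scope classical_set_scope.
Local Open Scope ring_scope.

(** * Independence *)

Definition mutually_independent (R : realType) (d d' : measure_display)
    (W : measurableType d) (V : measurableType d') (P : probability W R)
    (I : choiceType) (Z : I -> W -> V) : Prop :=
  forall (J : seq I) (C : I -> set V), uniq J ->
    (forall i, measurable (C i)) ->
    (P (\bigcap_(i in [set` J]) (Z i @^-1` C i)) =
     \prod_(i <- J) P (Z i @^-1` C i))%E.

Definition sigma_family (d d' : measure_display) (W : measurableType d)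
    (V : measurableType d') (I : Type) (Z : I -> W -> V) : set (set W) :=
  <<s \bigcup_i g_sigma_algebra_preimage (Z i) >>.

Definition independent_families (R : realType) (d d1 d2 : measure_display)
    (W : measurableType d) (V1 : measurableType d1) (V2 : measurableType d2)
    (P : probability W R) (I1 I2 : Type)
    (Z1 : I1 -> W -> V1) (Z2 : I2 -> W -> V2) : Prop :=
  forall E F : set W, sigma_family Z1 E -> sigma_family Z2 F ->
    (P (E `&` F) = P E * P F)%E.

(** * The Poissonized urn scheme

    Balls are numbered from 0: [X j] and [T j] are the label and the arrival
    time of ball [j.+1]. Counts take their values in the extended reals, being
    infinite when infinitely many indices qualify. *)

Definition PiB (R : realType) (W : Type) (T : nat -> W -> R)
    (B : set R) (w : W) : \bar R :=
  counting [set j | B (T j w)].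

Definition PiBi (R : realType) (W : Type) (X : nat -> W -> nat)
    (T : nat -> W -> R) (i : nat) (B : set R) (w : W) : \bar R :=
  counting [set j | B (T j w) /\ X j w = i].

Definition urns (R : realType) (W : Type) (X : nat -> W -> nat)
    (T : nat -> W -> R) (B : set R) (k : nat) (w : W) : \bar R :=
  counting [set i | (0 < i)%N /\ (k%:R%:E <= PiBi X T i B w)%E].

(* The Poisson probabilities are written out because [poisson_pmf 0 n] is 1 for
   every [n]. Sets of infinite measure need no clause: that they a.s. contain
   infinitely many points follows from the finite case. *)
Definition unit_poisson_process (R : realType) (d : measure_display)
    (W : measurableType d) (P : probability W R) (T : nat -> W -> R) : Prop :=
  [/\ {ae P, forall w, 0 < T 0%N w /\ forall j, T j w < T j.+1 w},
      (forall B : set R, measurable B -> B `<=` `[0, +oo[ ->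
        (lebesgue_measure B < +oo)%E -> forall n : nat,
        let a := fine (lebesgue_measure B) in
        P [set w | PiB T B w = n%:R%:E] = (expR (- a) * a ^+ n / n`!%:R)%:E) &
      forall (n : nat) (B : 'I_n -> set R),
        (forall i, measurable (B i)) -> (forall i, B i `<=` `[0, +oo[) ->
        trivIset setT B ->
        mutually_independent P (fun i => PiB T (B i) : W -> \bar R)].

Definition dilate (R : realType) (t : R) (A : set R) : set R :=
  [set t * a | a in A].

Definition meanM (R : realType) (d : measure_display) (W : measurableType d)
    (P : probability W R) (X : nat -> W -> nat) (T : nat -> W -> R) (t : R) : R :=
  let N := fun w => fine (urns X T `[0, t] 1 w) in
  fine ('E_P[N])%E.

Definition Ystar (R : realType) (d : measure_display) (W : measurableType d)
    (P : probability W R) (X : nat -> W -> nat) (T : nat -> W -> R)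
    (t : R) (A : set R) (k : nat) (w : W) : R :=
  let N := fun w => fine (urns X T (dilate t A) k w) in
  (N w - fine ('E_P[N])%E) / Num.sqrt (meanM P X T t).

(** * Regular variation *)

(* For [x < (p 1)^-1] the set is empty and the value is the junk 0. *)
Definition alpha (R : realType) (p : nat -> R) (x : R) : nat :=
  let S := [set i | (0 < i)%N /\ x^-1 <= p i] in
  xget 0%N [set i | S i /\ forall j, S j -> (j <= i)%N].

Definition slowly_varying (R : realType) (L : R -> R) : Prop :=
  (exists a : R, measurable_fun `[a, +oo[ L /\ forall x, a <= x -> 0 < L x) /\
  (forall c : R, 0 < c -> (L (c * x) / L x) @[x --> +oo] --> (1 : R)).

(** * The limiting covariance *)

Definition Gamma (R : realType) (s : R) : R :=
  (\int[lebesgue_measure]_(x in `]0, +oo[) (x `^ (s - 1) * expR (- x)))%R.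

Definition Kstar (R : realType) (d : measure_display) (W : measurableType d)
    (P : probability W R) (T : nat -> W -> R) (theta : R)
    (A : set R) (k : nat) (B : set R) (l : nat) : R :=
  let few u C n : W -> R := \1_[set w | (PiB T (dilate u C) w < n%:R%:E)%E] in
  (Gamma (1 - theta))^-1 *
  (\int[lebesgue_measure]_(u in `]0, +oo[)
     (fine (covariance P (few u A k) (few u B l)) *
      (theta * u `^ (- theta - 1))))%R.

(** * Gaussian vectors and weak convergence *)

(* Gaussian law of mean [mu] and standard deviation [s >= 0], a point mass when
   [s = 0]. *)
Definition gaussian_law (R : realType) (mu s : R) (C : set R) : \bar R :=
  if s == 0 then (\d_mu C : \bar R) else normal_prob mu s C.

Definition gaussian_vector (R : realType) (d : measure_display)
    (W : measurableType d) (P : probability W R) (m : nat)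
    (Z : 'I_m -> W -> R) : Prop :=
  forall c : 'I_m -> R, exists mu s : R, 0 <= s /\
    forall C : set R, measurable C ->
      P [set w | C (\sum_i c i * Z i w)] = gaussian_law mu s C.

(* Weak convergence as [t --> +oo] of random vectors of [R^m], the limit
   possibly living on another probability space. *)
Definition weakly_converges (R : realType) (d d' : measure_display)
    (W : measurableType d) (P : probability W R)
    (W' : measurableType d') (P' : probability W' R) (m : nat)
    (Z : R -> 'I_m -> W -> R) (Z' : 'I_m -> W' -> R) : Prop :=
  forall f : 'rV[R]_m -> R, continuous f ->
    (exists b : R, forall v, `|f v| <= b) ->
    ('E_P[fun w => f (\row_i Z t i w)])%E @[t --> +oo] -->
    ('E_P'[fun w => f (\row_i Z' i w)])%E.

(* Main.v *)
Require Import Defs.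
From HB Require Import structures.
From mathcomp Require Import all_boot all_order all_algebra.
From mathcomp Require Import all_classical all_reals all_analysis.
From mathcomp Require Import measurable_realfun ring lra zify.

(** Cut the points of [Pi] in [tA_1, ..., tA_m] along the atoms of these sets and along the
    labels of the first [n] urns: by thinning the counts are independent Poisson variables, so
    the indicators of [Pi_i(tA_j) >= k_j] are independent in [i], with the law attached to a
    unit Poisson process on [p_i t A_j]. A Lindeberg argument bounds the distance of
    [E cos (phi + sum_j c_j Y_j)] to [cos phi * exp (- V(t) / 2)], where [V(t)] is the variance
    of [sum_j c_j Y_j], by [V(t)] times the size [O (M(t)^(-1/2))] of one summand.

    Means and variances are sums [sum_i f (t p_i)] with [f 0 = 0], [f] bounded and [f']
    exponentially small. Since [sum_i f (t p_i)] is the integral of [f' u * alpha (t / u)],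
    regular variation of [alpha] and Potter's bound give
    [sum_i f (t p_i) ~ alpha t * int f' u * u^(- theta) du = alpha t * int f u d(- u^(- theta))];
    for [f u = 1 - exp (- u)] this is [M(t) ~ Gamma (1 - theta) alpha t].

    Convergence of all the [E cos (phi + sum_j c_j Y_j)] and bounded first moments yield weak
    convergence, because a bounded continuous function is, on a cube, a uniform limit of
    equally bounded trigonometric polynomials: substitute [sin (e x)] in Bernstein polynomials. *)

Import Order.TTheory GRing.Theory Num.Theory.
Import numFieldNormedType.Exports.

Local Open Scope classical_set_scope.
Local Open Scope ring_scope.

(** * Approximation by trigonometric polynomials *)

(** Characteristic functions are replaced by integrals of [cos (phi + ...)] with a free phase. The
    phase supplies the sines, closes the test functions under products, and carries the induction
    over the summands: the value of the last summand enters as a shift of the phase. The same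
    integrals serve again to identify the laws required by [gaussian_vector] and to read off
    moments.

    Infinitely many urns and balls are never handled at once: each identity is proved for finitely
    many and passed to the limit at fixed [t], before [t] moves.

    Regular variation controls only the counting function [alpha], not a single [p i]; writing [f]
    as the integral of [f'] turns a sum over urns into an integral involving [alpha] alone. Potter's
    exponent must stay below 1 for the majorant to be integrable at 0.

    Positive semidefiniteness of [Kstar], needed before a limit vector can be built, is not
    computed: it is inherited from the prelimit variances. *)

Section Bernstein.
Context {R : realType}.
Implicit Types (u : R) (n k : nat).

Definition bernstein n k u : R := 'C(n, k)%:R * u ^+ k * (1 - u) ^+ (n - k).

Lemma bernstein_ge0 n k u : 0 <= u <= 1 -> 0 <= bernstein n k u.
Proof.
move=> /andP[u0 u1]; rewrite /bernstein !mulr_ge0 ?exprn_ge0 ?subr_ge0//.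
Qed.

Lemma bernstein_sum n u : \sum_(k < n.+1) bernstein n k u = 1.
Proof.
rewrite -[RHS](expr1n _ n) -[in RHS](subrK u 1) exprDn.
by apply: eq_bigr => k _; rewrite /bernstein -mulr_natl; ring.
Qed.

(** Absorption [(k + 1) C(n + 1, k + 1) = (n + 1) C(n, k)]: each use trades a factor [k] in a moment
    for a lower degree, so the first two moments reduce to [bernstein_sum]. *)
Lemma bernstein_absorb n k u : k.+1%:R * bernstein n.+1 k.+1 u = n.+1%:R * u * bernstein n k u.
Proof.
rewrite /bernstein subSS exprS !mulrA -natrM -mul_bin_diag natrM; ring.
Qed.

Lemma bernstein_mean n u : \sum_(k < n.+1) k%:R * bernstein n k u = n%:R * u.
Proof.
case: n => [|n]; first by rewrite big_ord1 !mul0r.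
rewrite big_ord_recl mul0r add0r.
under eq_bigr => k _ do rewrite /= /bump /= add1n bernstein_absorb.
by rewrite -mulr_sumr bernstein_sum mulr1.
Qed.

Lemma bernstein_moment2 n u :
  \sum_(k < n.+1) k%:R ^+ 2 * bernstein n k u = n%:R * u * (n.-1%:R * u + 1).
Proof.
case: n => [|n]; first by rewrite big_ord1 expr0n/= !mul0r.
rewrite big_ord_recl expr0n mul0r add0r.
under eq_bigr => k _.
  rewrite /= /bump /= add1n expr2 -mulrA bernstein_absorb.
  rewrite (_ : _ * _ = n.+1%:R * u * (k%:R * bernstein n k u + bernstein n k u)); last first.
    by rewrite -natr1; ring.
  over.
by rewrite -mulr_sumr big_split/= bernstein_mean bernstein_sum.
Qed.

(** The exact value is the binomial variance [u (1 - u) / n]; the cruder bound is all that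
    Chebyshev's inequality needs. *)
Lemma bernstein_variance n u : (0 < n)%N -> 0 <= u <= 1 ->
  \sum_(k < n.+1) (k%:R / n%:R - u) ^+ 2 * bernstein n k u <= n%:R^-1.
Proof.
case: n => // n _ /andP[u0 u1].
have n0 : n.+1%:R != 0 :> R by rewrite pnatr_eq0.
under eq_bigr => k _.
  rewrite (_ : _ * _ = n.+1%:R ^- 2 * (k%:R ^+ 2 * bernstein n.+1 k u) -
     2 * u / n.+1%:R * (k%:R * bernstein n.+1 k u) + u ^+ 2 * bernstein n.+1 k u); last first.
    by field; rewrite addrC natr1.
  over.
rewrite big_split/= sumrB -!mulr_sumr bernstein_moment2 bernstein_mean bernstein_sum /=.
rewrite -subr_ge0 (_ : _ - _ = (1 - u + u ^+ 2) / n.+1%:R); last first.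
  by rewrite -natr1; field; rewrite natr1.
by rewrite divr_ge0//; nra.
Qed.

End Bernstein.

(** * Taylor bounds for sine, cosine and exponential *)

Section ElementaryInequalities.
Context {R : realType}.
Implicit Types x : R.

(** The Taylor bounds below form a ladder: each difference vanishes at 0 and has the preceding
    difference as derivative, so this monotonicity is applied at every rung. *)
Lemma nondecreasing_from0 (f f' : R -> R) : (forall x, is_derive x (1 : R) f (f' x)) ->
  (forall x, 0 <= x -> 0 <= f' x) -> forall x, 0 <= x -> f 0 <= f x.
Proof.
move=> df f'0 x; rewrite le_eqVlt => /predU1P[<-//|x0].
have cf y : {for y, continuous f}.
  by apply: differentiable_continuous; exact/derivable1_diffP/(@ex_derive _ _ _ _ _ _ _ (df y)).
have [c] := MVT_segment (ltW x0) (fun y _ => df y) (continuous_subspaceT cf).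
rewrite in_itv/= => /andP[c0 cx] E.
by rewrite -subr_ge0 E mulr_ge0// ?f'0// subr_ge0 ltW.
Qed.

Lemma sin_le_id x : 0 <= x -> sin x <= x.
Proof.
move=> x0; rewrite -subr_ge0.
have := nondecreasing_from0 (fun x => x - sin x) (fun x => 1 - cos x) _ _ _ x0.
rewrite sin0 subr0; apply=> y _.
by rewrite subr_ge0 cos_le1.
Qed.

Lemma cos_ge_taylor2 x : 1 - x ^+ 2 / 2 <= cos x.
Proof.
wlog x0 : x / 0 <= x => [H|].
  by have [/H//|/ltW] := leP 0 x; rewrite -oppr_ge0 => /H; rewrite cosN sqrrN.
rewrite -subr_ge0.
have := nondecreasing_from0 (fun x => cos x - (1 - x ^+ 2 / 2)) (fun x => x - sin x) _ _ _ x0.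
rewrite cos0 expr0n/= mul0r subr0 subrr; apply=> y.
  by apply: is_derive_eq; rewrite /GRing.scale/= !mulr1; field.
by rewrite subr_ge0; exact: sin_le_id.
Qed.

Lemma sin_ge_taylor3 x : 0 <= x -> x - x ^+ 3 / 6 <= sin x.
Proof.
move=> x0; rewrite -subr_ge0.
have := nondecreasing_from0 (fun x => sin x - (x - x ^+ 3 / 6)) (fun x => cos x - (1 - x ^+ 2 / 2)) _ _ _ x0.
rewrite sin0 expr0n/= mul0r !subr0; apply=> y.
  by apply: is_derive_eq; rewrite /GRing.scale/= !mulr1; field.
by rewrite subr_ge0 cos_ge_taylor2.
Qed.

Lemma cos_le_taylor4 x : cos x <= 1 - x ^+ 2 / 2 + x ^+ 4 / 24.
Proof.
wlog x0 : x / 0 <= x => [H|].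
  have [/H//|/ltW] := leP 0 x; rewrite -oppr_ge0 => /H.
  by rewrite cosN sqrrN (_ : (- x) ^+ 4 = x ^+ 4) //; ring.
rewrite -subr_ge0.
have := nondecreasing_from0 (fun x => 1 - x ^+ 2 / 2 + x ^+ 4 / 24 - cos x)
  (fun x => sin x - (x - x ^+ 3 / 6)) _ _ _ x0.
rewrite cos0 !expr0n/= !mul0r addr0 subr0 subrr; apply=> y.
  by apply: is_derive_eq; rewrite /GRing.scale/= !mulr1; field.
by rewrite subr_ge0; exact: sin_ge_taylor3.
Qed.

Lemma cos_taylor x : `|cos x - (1 - x ^+ 2 / 2)| <= x ^+ 4 / 24.
Proof.
by have := cos_le_taylor4 x; have := cos_ge_taylor2 x; rewrite ler_norml; lra.
Qed.

Lemma sin_taylor x : `|sin x - x| <= `|x| ^+ 3 / 6.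
Proof.
wlog x0 : x / 0 <= x => [H|].
  have [/H//|/ltW] := leP 0 x; rewrite -oppr_ge0 => /H.
  by rewrite sinN -opprD !normrN.
rewrite (ger0_norm x0).
by have := sin_ge_taylor3 x x0; have := sin_le_id x x0; rewrite ler_norml; lra.
Qed.

Lemma abs_sin_le x : `|sin x| <= `|x|.
Proof.
wlog x0 : x / 0 <= x => [H|].
  have [/H//|/ltW] := leP 0 x; rewrite -oppr_ge0 => /H.
  by rewrite sinN !normrN.
rewrite (ger0_norm x0) ler_norml sin_le_id// andbT.
have [x1|x1] := leP x 1; last by have := sin_geN1 x; lra.
have := sin_ge_taylor3 x x0.
suff : x ^+ 3 <= x by lra.
by rewrite exprSr -[leRHS]mul1r ler_wpM2r// expr_le1.
Qed.

Lemma expRN_taylor x : 0 <= x -> `|expR (- x) - (1 - x)| <= x ^+ 2 / 2.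
Proof.
move=> x0; rewrite ler_norml; have := expR_ge1Dx (- x) => e1.
suff : expR (- x) <= 1 - x + x ^+ 2 / 2 by have := sqr_ge0 x; lra.
rewrite -subr_ge0.
have := nondecreasing_from0 (fun x => 1 - x + x ^+ 2 / 2 - expR (- x))
  (fun x => expR (- x) - (1 - x)) _ _ _ x0.
rewrite oppr0 expR0 expr0n/= mul0r !addr0 subrr; apply=> y.
  by apply: is_derive_eq; rewrite /GRing.scale/= !mulr1; field.
by move=> _; rewrite subr_ge0 expR_ge1Dx.
Qed.

End ElementaryInequalities.

(** * Trigonometric polynomials and their algebra *)

Section TrigApproximation.
Context {R : realType} {m : nat}.
Implicit Types (f g : 'rV[R]_m -> R) (c : 'I_m -> R) (x y : 'rV[R]_m).

(** Cosines with a phase suffice as generators: zero frequency gives constants, a quarter turn gives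
    sines, and the product-to-sum formula keeps products inside the class. Because it is generated
    inductively, convergence of expectations has to be checked on single cosines only. *)
Inductive trig : ('rV[R]_m -> R) -> Prop :=
| trig_cos c phi : trig (fun x => cos (phi + \sum_i c i * x ord0 i))
| trig_add f g : trig f -> trig g -> trig (fun x => f x + g x)
| trig_scale a f : trig f -> trig (fun x => a * f x).

Lemma trig_eq f g : trig f -> f =1 g -> trig g.
Proof. by move=> tf /funext <-. Qed.

Lemma trig_cst a : trig (fun=> a).
Proof.
apply: (trig_eq _ _ (trig_scale a _ (trig_cos (fun=> 0) 0))) => x.
by rewrite big1 => [|i _]; rewrite ?mul0r// addr0 cos0 mulr1.
Qed.

Lemma trig_mul f g : trig f -> trig g -> trig (fun x => f x * g x).
Proof.
move=> tf; elim: tf g => {f} [c phi|f1 f2 _ IH1 _ IH2|a f _ IH] g tg.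
- elim: tg => {g} [d psi|g1 g2 _ IH1 _ IH2|a g _ IH].
  + have := trig_add _ _ (trig_cos (fun i => c i + d i) (phi + psi))
                         (trig_cos (fun i => c i - d i) (phi - psi)).
    move=> /(trig_scale 2^-1) /trig_eq; apply => x.
    under eq_bigr do rewrite mulrDl.
    under [X in cos (phi - psi + X)]eq_bigr do rewrite mulrBl.
    rewrite big_split sumrB/=.
    set a := \sum_i _; set b := \sum_i _.
    rewrite (_ : phi + psi + (a + b) = (phi + a) + (psi + b)); last by ring.
    rewrite (_ : phi - psi + (a - b) = (phi + a) - (psi + b)); last by ring.
    by rewrite cosD cosB; field.
  + by apply: (trig_eq _ _ (trig_add _ _ IH1 IH2)) => x; rewrite mulrDr.
  + by apply: (trig_eq _ _ (trig_scale a _ IH)) => x; rewrite mulrCA.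
- apply: (trig_eq _ _ (trig_add _ _ (IH1 _ tg) (IH2 _ tg))) => x.
  by rewrite mulrDl.
- by apply: (trig_eq _ _ (trig_scale a _ (IH _ tg))) => x; rewrite mulrA.
Qed.

Lemma trig_sum (I : Type) (s : seq I) (F : I -> 'rV[R]_m -> R) :
  (forall i, trig (F i)) -> trig (fun x => \sum_(i <- s) F i x).
Proof.
move=> tF; elim: s => [|i s IH].
  by apply: (trig_eq _ _ (trig_cst 0)) => x; rewrite big_nil.
by apply: (trig_eq _ _ (trig_add _ _ (tF i) IH)) => x; rewrite big_cons.
Qed.

Lemma trig_prod (I : Type) (s : seq I) (F : I -> 'rV[R]_m -> R) :
  (forall i, trig (F i)) -> trig (fun x => \prod_(i <- s) F i x).
Proof.
move=> tF; elim: s => [|i s IH].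
  by apply: (trig_eq _ _ (trig_cst 1)) => x; rewrite big_nil.
by apply: (trig_eq _ _ (trig_mul _ _ (tF i) IH)) => x; rewrite big_cons.
Qed.

Lemma trig_exp f n : trig f -> trig (fun x => f x ^+ n).
Proof.
move=> tf; elim: n => [|n IH]; first exact: trig_cst.
by apply: (trig_eq _ _ (trig_mul _ _ tf IH)) => x; rewrite exprS.
Qed.

Lemma trig_sin e j : trig (fun x => sin (e * x ord0 j)).
Proof.
apply: (trig_eq _ _ (trig_cos (fun i => if i == j then e else 0) (- (pi / 2)))).
move=> x; rewrite addrC (bigD1 j)//= eqxx big1 => [|i /negbTE ->]; rewrite ?mul0r//.
by rewrite addr0 cosBpihalf.
Qed.

Lemma trig_bernstein (n k : nat) f : trig f -> trig (fun x => bernstein n k (f x)).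
Proof.
move=> tf; rewrite /bernstein; apply: trig_mul.
  by apply: trig_scale; exact: trig_exp.
apply: trig_exp; apply: trig_add; first exact: trig_cst.
by apply: (trig_eq _ _ (trig_scale (-1) _ tf)) => x; rewrite mulN1r.
Qed.

(** Heine-Cantor through near-coverings: half of the local radius is reserved for the distance from
    the centre to [x], the other half for the step from [x] to [y], which may leave [K]. *)
Lemma compact_unif_cont (K : set 'rV[R]_m) f (e : R) :
  compact K -> continuous f -> 0 < e ->
  exists2 r, 0 < r & forall x y, K x -> (forall i, `|x ord0 i - y ord0 i| < r) ->
    `|f x - f y| < e.
Proof.
move=> cK cf e0.
have /compact_near_coveringP /(_ R (0^'+)
  (fun r x => forall y, (forall i, `|x ord0 i - y ord0 i| < r) -> `|f x - f y| < e)) := cK.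
case.
- move=> x Kx.
  have e20 : 0 < e / 2 by rewrite divr_gt0.
  have /cvgrPdist_lt /(_ _ e20) /nbhs_ballP [r /= r0 xr] := cf x.
  have r20 : 0 < r / 2 by rewrite divr_gt0.
  exists (ball x (r / 2), [set s | 0 < s < r / 2]) => /=.
    split; first exact: nbhsx_ballx.
    by near=> s => /=; apply/andP; split; near: s;
      [exact: nbhs_right_gt|exact: nbhs_right_lt].
  move=> [x' s] /= [xx' /andP[s0 sr]] y x'y.
  have fx' : `|f x - f x'| < e / 2.
    by apply: xr; apply: le_ball xx'; rewrite ler_pdivrMr//; lra.
  have fy : `|f x - f y| < e / 2.
    apply: xr; split=> // i j; have := xx'.2 i j; rewrite !ord1 /= => h1.
    have h2 := x'y j; rewrite /ball/= in h1 *.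
    by apply: le_lt_trans (ler_distD (x' ord0 j) _ _) _; lra.
  apply: le_lt_trans (ler_distD (f x) _ _) _.
  by rewrite [`|f x' - _|]distrC; lra.
- move=> r /= r0 H.
  exists (r / 2); first by rewrite divr_gt0.
  move=> x y Kx xy; apply: (H (r / 2)) => //=.
  - by rewrite sub0r normrN gtr0_norm ?divr_gt0// ltr_pdivrMr//; lra.
  - by rewrite divr_gt0.
Unshelve. all: by end_near. Qed.

Lemma clip_continuous (r : R) : continuous (fun u : R => Num.max (- r) (Num.min u r)).
Proof.
move=> u; apply/cvgrPdist_lt => e e0.
apply: filterS (nbhsx_ballx u e e0) => v /= uv.
apply: le_lt_trans uv.
have := ler_norm (u - v); have := lerNnormlW (lexx `|u - v|) => n1 n2.
rewrite /Order.max /Order.min.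
rewrite ler_norml.
by case: (ltP u r) => ?; case: (ltP v r) => ?;
  do ![case: ifPn; rewrite -?leNgt => ?]; lra.
Qed.

(** A left inverse of the rescaled sine on [[-L, L]], continuous on the whole line. Through it a
    continuous function on a cube becomes a continuous function of sines, to which polynomial
    approximation applies. *)
Lemma sin_chart (L : R) : 0 < L -> exists (e : R) (psi : R -> R),
  continuous psi /\ forall x : R, `|x| <= L -> psi (sin (e * x)) = x.
Proof.
move=> L0; have p2 : 1 <= pi / 2 :> R by rewrite ler_pdivlMr// mul1r pi_ge2.
(* Any value in []0, pi / 2[] would do: [|e x| <= h] keeps the sine injective, and clipping at
   [sin h < 1] keeps the argument of [asin] in the open interval where it is continuous. *)
pose h : R := 2^-1; have h0 : 0 < h < 1 by rewrite /h; lra.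
have s1 : sin h < 1.
  by rewrite -(@sin_pihalf R) ltr_sin ?in_itv/=; lra.
have s0 : 0 < sin h by apply: sin_gt0_pi; lra.
exists (h / L), (fun u => L / h * asin (Num.max (- sin h) (Num.min u (sin h)))).
split=> [u|x xL].
  apply: cvgM; first exact: cvg_cst.
  apply: (continuous_comp (clip_continuous _ _)).
  apply: continuous_asin; rewrite /Order.max /Order.min.
  by case: (ltP u (sin h)) => ?; case: ifPn; rewrite -?leNgt => ?; lra.
have hL : 0 < h / L by rewrite divr_gt0//; lra.
have xL' : `|h / L * x| <= h.
  by rewrite normrM (gtr0_norm hL) mulrAC ler_pdivrMr// ler_pM2l//; lra.
have /andP[h1 h2] : - h <= h / L * x <= h by rewrite -ler_norml.
have h4 : sin (h / L * x) <= sin h by rewrite leNgt ltr_sin -?leNgt ?in_itv/=; lra.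
have h3 : - sin h <= sin (h / L * x) by rewrite -sinN leNgt ltr_sin -?leNgt ?in_itv/=; lra.
rewrite (min_idPl h4) (max_idPr h3) sinK; last by rewrite in_itv/=; lra.
by field; rewrite gt_eqF//= gt_eqF//; lra.
Qed.

End TrigApproximation.

Section TrigApproximation.
Context {R : realType} {m : nat}.
Implicit Types (f : 'rV[R]_m -> R) (x u : 'rV[R]_m).

Lemma row_continuous (psi : R -> R) : continuous psi ->
  continuous (fun u : 'rV[R]_m => \row_j psi (u ord0 j) : 'rV[R]_m).
Proof.
move=> cpsi u; apply/(@cvg_ballP _ _ _ (nbhs u) (nbhs_filter u)) => e e0.
have nu : nbhs u [set v : 'rV[R]_m | forall j, ball (psi (u ord0 j)) e (psi (v ord0 j))].
  apply: (filter_forall (f := fun (j : 'I_m) (v : 'rV[R]_m) => ball (psi (u ord0 j)) e (psi (v ord0 j))) (nbhs_filter u)) => j.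
  have : (fun v : 'rV[R]_m => psi (v ord0 j)) v @[v --> u] --> psi (u ord0 j).
    apply: (continuous_comp (f := fun v : 'rV[R]_m => v ord0 j)); last exact: cpsi.
    exact: coord_continuous.
  by move=> /(@cvg_ballP _ _ _ (nbhs u) (nbhs_filter u)) /(_ e e0).
apply: (@filterS _ (nbhs u) (nbhs_filter u) _ _ _ nu) => v H; split=> // i j.
by rewrite !mxE; exact: H.
Qed.

Lemma bernstein_prod_sum n (u : 'I_m -> R) :
  \sum_(nu : {ffun 'I_m -> 'I_n.+1}) \prod_j bernstein n (nu j) (u j) = 1.
Proof.
rewrite -(bigA_distr_bigA (fun j (k : 'I_n.+1) => bernstein n k (u j))).
by apply: big1 => j _; rewrite bernstein_sum.
Qed.

Lemma bernstein_prod_variance n (u : 'I_m -> R) j : (0 < n)%N ->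
  (forall j, 0 <= u j <= 1) ->
  \sum_(nu : {ffun 'I_m -> 'I_n.+1})
     ((nu j)%:R / n%:R - u j) ^+ 2 * \prod_i bernstein n (nu i) (u i) <= n%:R^-1.
Proof.
move=> n0 u01.
pose F i (k : 'I_n.+1) := (if i == j then (k%:R / n%:R - u j) ^+ 2 else 1) * bernstein n k (u i).
rewrite (_ : \sum_nu _ = \sum_(nu : {ffun 'I_m -> 'I_n.+1}) \prod_i F i (nu i)).
  rewrite -(bigA_distr_bigA F) (bigD1 j)//= [X in _ * X]big1 ?mulr1.
    by rewrite /F eqxx; exact: bernstein_variance.
  move=> i /negbTE ij; rewrite /F ij.
  by under eq_bigr do rewrite mul1r; rewrite bernstein_sum.
apply: eq_bigr => nu _; rewrite /F [RHS]big_split/=; congr (_ * _).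
by rewrite (bigD1 j)//= eqxx big1 ?mulr1// => i /negbTE ->.
Qed.

(** Bernstein polynomials average values of [f] with nonnegative weights of sum 1, so the
    approximant keeps the bound [b] outside the cube too; this is what later controls the tails of
    expectations. *)
Lemma trig_approx f (b L e : R) : continuous f -> (forall x, `|f x| <= b) ->
  0 < L -> 0 < e -> exists q, [/\ trig q, forall x, `|q x| <= b &
    forall x, (forall i, `|x ord0 i| <= L) -> `|q x - f x| <= e].
Proof.
move=> cf fb L0 e0; have [ep [psi [cpsi psiK]]] := sin_chart L L0.
have b0 : 0 <= b := le_trans (normr_ge0 _) (fb 0).
(* [G] is [f] in the coordinates [u = (1 + sin (ep x)) / 2], which range over [[0, 1]]. *)
pose G u := f (\row_j psi (2 * u ord0 j - 1)).
have cG : continuous G.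
  move=> u; apply: (continuous_comp (f := fun v : 'rV[R]_m => \row_j psi (2 * v ord0 j - 1) : 'rV[R]_m) (g := f)); last exact: cf.
  apply: (row_continuous (fun t => psi (2 * t - 1))) => t.
  apply: (continuous_comp (f := fun t : R => 2 * t - 1) (g := psi)); last exact: cpsi.
  by apply: cvgB; [apply: cvgM; [exact: cvg_cst|exact: cvg_id]|exact: cvg_cst].
pose K : set 'rV[R]_m := [set v | forall i, `[0, 1]%classic (v ord0 i)].
have cK : compact K by apply: (rV_compact (A := fun=> `[0 : R, 1]%classic)) => i; exact: segment_compact.
have e20 : 0 < e / 2 by rewrite divr_gt0.
have [r r0 Gr] := compact_unif_cont K G _ cK cG e20.
(* Chosen so that [n > C] brings the Chebyshev term [2 b m / (r^2 n)] below [e / 2]. *)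
pose C := 4 * b * m%:R / (r ^+ 2 * e).
have C0 : 0 <= C by rewrite divr_ge0 ?mulr_ge0 ?sqr_ge0// ltW.
pose n := (Num.truncn C).+1.
have nC : C < n%:R by rewrite -truncn_le_nat.
have n0 : 0 < n%:R :> R by rewrite ltr0n.
pose s x j : R := (1 + sin (ep * x ord0 j)) / 2.
have s01 x j : 0 <= s x j <= 1.
  by have := sin_le1 (ep * x ord0 j); have := sin_geN1 (ep * x ord0 j); rewrite /s; lra.
pose g (nu : {ffun 'I_m -> 'I_n.+1}) := G (\row_j ((nu j)%:R / n%:R)).
pose w x (nu : {ffun 'I_m -> 'I_n.+1}) := \prod_j bernstein n (nu j) (s x j).
have w0 x nu : 0 <= w x nu by apply: prodr_ge0 => j _; exact: bernstein_ge0.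
have w1 x : \sum_nu w x nu = 1 by exact: bernstein_prod_sum.
exists (fun x => \sum_nu g nu * w x nu); split.
- apply: trig_sum => nu; apply: trig_scale; apply: trig_prod => j.
  apply: trig_bernstein; apply: trig_eq (trig_scale 2^-1 _ (trig_add _ _ (trig_cst 1) (trig_sin ep j))) _.
  by move=> x; rewrite /s mulrC.
- move=> x; apply: le_trans (ler_norm_sum _ _ _) _.
  rewrite -[leRHS]mulr1 -(w1 x) mulr_sumr; apply: ler_sum => nu _.
  by rewrite normrM (ger0_norm (w0 x nu)) ler_wpM2r// fb.
- move=> x xL.
  have xE : f x = G (\row_j s x j).
    congr f; apply/rowP => j; rewrite !mxE /s mulrCA mulfV ?mulr1//.
    by rewrite addrAC subrr add0r psiK.
  rewrite -[f x]mulr1 -(w1 x) mulr_sumr -sumrB.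
  apply: le_trans (ler_norm_sum _ _ _) _.
  (* For each grid point, either all coordinates are within [r] and uniform continuity gives
     [e / 2], or one is off by at least [r], and then [2 b] is at most [2 b / r^2] times the sum of
     squares. *)
  apply: (@le_trans _ _ (\sum_nu (e / 2 * w x nu + 2 * b / r ^+ 2 *
     \sum_j (((nu j)%:R / n%:R - s x j) ^+ 2 * w x nu)))).
    apply: ler_sum => nu _.
    rewrite -mulrBl normrM (ger0_norm (w0 _ _)) -mulr_suml mulrA -mulrDl ler_wpM2r//.
    have S0 : 0 <= \sum_j ((nu j)%:R / n%:R - s x j) ^+ 2.
      by apply: sumr_ge0 => j _; exact: sqr_ge0.
    have [H|] := boolP [forall j, `|(nu j)%:R / n%:R - s x j| < r].
      rewrite -[leLHS]addr0 lerD//; last first.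
        by rewrite !mulr_ge0// invr_ge0 sqr_ge0.
      rewrite xE distrC; apply/ltW/Gr => j.
        by rewrite mxE /= in_itv/=.
      by rewrite !mxE distrC; move/forallP: H.
    rewrite negb_forall => /existsP[j]; rewrite -leNgt => jr.
    rewrite -[leLHS]add0r lerD ?(ltW e20)//.
    have : r ^+ 2 <= \sum_j ((nu j)%:R / n%:R - s x j) ^+ 2.
      rewrite (bigD1 j)//= -[leLHS]addr0 lerD//.
        by rewrite -[leRHS]real_normK ?num_real// ler_sqr ?nnegrE// ltW.
      by apply: sumr_ge0 => i _; exact: sqr_ge0.
    move=> rS; apply: le_trans (ler_normB _ _) _.
    apply: (@le_trans _ _ (2 * b)).
      by have := fb x; have := fb (\row_j psi (2 * (\row_j ((nu j)%:R / n%:R) : 'rV_m) ord0 j - 1)); rewrite /g /G; lra.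
    rewrite mulrAC ler_pdivlMr ?exprn_gt0// ler_wpM2l//; lra.
  rewrite big_split/= -!mulr_sumr w1 exchange_big/=.
  apply: (@le_trans _ _ (e / 2 + 2 * b / r ^+ 2 * (\sum_(j < m) n%:R^-1))).
    rewrite mulr1 lerD2l ler_wpM2l//; first by rewrite divr_ge0 ?sqr_ge0//; lra.
    by apply: ler_sum => j _; exact: bernstein_prod_variance.
  rewrite sumr_const card_ord -mulr_natr.
  suff : 2 * b / r ^+ 2 * (n%:R^-1 * m%:R) <= e / 2 by lra.
  rewrite mulrCA mulrC ler_pdivrMr//.
  have Ce : C * e / 2 <= n%:R * e / 2 by nra.
  rewrite [leLHS](_ : _ = C * e / 2); first by apply: le_trans Ce _; rewrite le_eqVlt; apply/orP; left; apply/eqP; ring.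
  by rewrite /C; field; rewrite !gt_eqF.
Qed.

End TrigApproximation.

Lemma integrable_bigsum {R : realType} {d} {W : measurableType d}
  (mu : {measure set W -> \bar R}) (D : set W) (I : Type) (s : seq I) (f : I -> W -> R) :
  measurable D -> (forall i, mu.-integrable D (EFin \o f i)) ->
  mu.-integrable D (EFin \o (fun w => \sum_(i <- s) f i w)).
Proof.
move=> mD fi; rewrite (_ : _ \o _ = (fun w => \sum_(i <- s) (f i w)%:E)%E).
  by apply: integrable_sum => // i _; exact: fi.
by apply/funext => w /=; rewrite sumEFin.
Qed.

Lemma Rintegral_sum {R : realType} {d} {W : measurableType d}
  (mu : {measure set W -> \bar R}) (D : set W) (I : Type) (s : seq I) (f : I -> W -> R) :
  measurable D -> (forall i, mu.-integrable D (EFin \o f i)) ->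
  \int[mu]_(w in D) (\sum_(i <- s) f i w) = \sum_(i <- s) \int[mu]_(w in D) f i w.
Proof.
move=> mD fi; elim: s => [|i s IH].
  rewrite big_nil (_ : (fun w => _) = cst 0); last by apply/funext => w; rewrite big_nil.
  by rewrite /Rintegral/= integral0.
under [in LHS]eq_Rintegral do rewrite big_cons.
by rewrite RintegralD// ?big_cons ?IH//; exact: integrable_bigsum.
Qed.

(** * Weak convergence from trigonometric test functions *)

Section WeakConvergence.
Context {R : realType} {m : nat}.
Implicit Types (f q : 'rV[R]_m -> R).

Lemma bounded_integrable {d} {W : measurableType d} (P : probability W R)
  (g : W -> R) (b : R) : measurable_fun setT g -> (forall w, `|g w| <= b) ->
  P.-integrable setT (EFin \o g).
Proof.
move=> mg gb; apply: measurable_bounded_integrable => //.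
- by rewrite (le_lt_trans (probability_le1 _ _))// ltry.
- exists b; split; first exact: num_real.
  by move=> x bx w _ /=; exact: le_trans (gb w) (ltW bx).
Qed.

Lemma trig_measurable {d} {W : measurableType d} (Z : 'I_m -> W -> R) q :
  (forall i, measurable_fun setT (Z i)) -> trig q ->
  measurable_fun setT (fun w => q (\row_i Z i w)).
Proof.
move=> mZ; elim=> {q} [c phi|f g _ IHf _ IHg|a f _ IH].
- apply: measurableT_comp; first exact: (continuous_measurable_fun (@continuous_cos R)).
  apply: measurable_funD => //; apply: measurable_sum => i.
  by under eq_fun do rewrite mxE; apply: measurable_funM.
- exact: measurable_funD.
- exact: measurable_funM.
Qed.

Lemma trig_bounded q : trig q -> exists b, forall x, `|q x| <= b.
Proof.
elim=> {q} [c phi|f g _ [b fb] _ [b' gb]|a f _ [b fb]].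
- by exists 1 => x; rewrite ler_norml cos_geN1 cos_le1.
- by exists (b + b') => x; apply: le_trans (ler_normD _ _) _; exact: lerD.
- by exists (`|a| * b) => x; rewrite normrM ler_wpM2l.
Qed.

(** Trigonometric polynomials of the coordinates are measurable, and [f] is their pointwise limit:
    the [n]-th one is within [1 / (n + 1)] of [f] on the cube of half-side [n + 1]. *)
Lemma row_measurable {d} {W : measurableType d} (Z : 'I_m -> W -> R) f (b : R) :
  (forall i, measurable_fun setT (Z i)) -> continuous f -> (forall x, `|f x| <= b) ->
  measurable_fun setT (fun w => f (\row_i Z i w)).
Proof.
move=> mZ cf fb.
have /choice[q qP] : forall n : nat, exists q, [/\ trig q, forall x, `|q x| <= b &
    forall x : 'rV[R]_m, (forall i, `|x ord0 i| <= n.+1%:R) -> `|q x - f x| <= n.+1%:R^-1].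
  by move=> n; apply: trig_approx => //; rewrite ?invr_gt0.
apply: (@measurable_fun_cvg _ _ _ _ (fun n w => q n (\row_i Z i w))).
  by move=> n; apply: trig_measurable => //; case: (qP n).
move=> w _; apply/cvgrPdist_le => e e0; near=> n.
have [_ _ /(_ (\row_i Z i w))] := qP n.
rewrite distrC => H; apply: le_trans (H _) _.
  move=> i; apply: (@le_trans _ _ (\sum_i `|(\row_i Z i w : 'rV_m) ord0 i|)).
    by rewrite (bigD1 i)//= lerDl sumr_ge0.
  near: n; exists (Num.truncn (\sum_i `|(\row_i Z i w : 'rV_m) ord0 i|)) => // n /= Hn.
  by apply: ltW; rewrite -truncn_le_nat.
by apply: ltW; near: n; exact: (near_infty_natSinv_lt (PosNum e0)).
Unshelve. all: by end_near. Qed.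

(** The difference is at most [e] on the cube and at most [2 b] off it, where some [|Z i w|] exceeds
    [L]. The single integrable bound [e + (2 b / L) sum_i |Z i w|] covers both cases: Markov's
    inequality under the integral. *)
Lemma trig_approx_expectation {d} {W : measurableType d} (P : probability W R)
    (Z : 'I_m -> W -> R) f q (b L e C : R) :
  (forall i, measurable_fun setT (Z i)) -> continuous f -> (forall x, `|f x| <= b) ->
  trig q -> (forall x, `|q x| <= b) -> 0 < L -> 0 <= e ->
  (forall x : 'rV[R]_m, (forall i, `|x ord0 i| <= L) -> `|q x - f x| <= e) ->
  (forall i, P.-integrable setT (EFin \o Z i)) -> (forall i, \int[P]_w `|Z i w| <= C) ->
  `| \int[P]_w f (\row_i Z i w) - \int[P]_w q (\row_i Z i w) | <=
    e + 2 * b * m%:R * C / L.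
Proof.
move=> mZ cf fb tq qb L0 e0 qf iZ ZC.
have b0 : 0 <= b := le_trans (normr_ge0 _) (fb 0).
have mf := row_measurable _ _ _ mZ cf fb.
have mq := trig_measurable _ _ mZ tq.
have intf := bounded_integrable P _ _ mf (fun w => fb _).
have intq := bounded_integrable P _ _ mq (fun w => qb _).
have intZ i : P.-integrable setT (EFin \o (fun w => `|Z i w|)).
  exact: integrable_norm (iZ i).
have intS : P.-integrable setT (EFin \o (fun w => \sum_i `|Z i w|)).
  exact: integrable_bigsum.
have intfq : P.-integrable setT
    (EFin \o (fun w => f (\row_i Z i w) - q (\row_i Z i w))).
  exact: (integrableB measurableT intf intq).
have intN := integrable_norm intfq.
rewrite -RintegralB//; apply: le_trans (le_normr_Rintegral measurableT intfq) _.
have intR : P.-integrable setT (EFin \o (fun w => e + 2 * b / L * \sum_i `|Z i w|)).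
  rewrite (_ : _ \o _ = (fun w => e%:E + (2 * b / L)%:E * (\sum_i `|Z i w|)%:E)%E)//.
  apply: integrableD => //; last exact: integrableZl.
  by apply: (bounded_integrable P (cst e) `|e|).
apply: (@le_trans _ _ (\int[P]_w (e + 2 * b / L * \sum_i `|Z i w|))).
  apply: (le_Rintegral measurableT intN intR).
  move=> w _ /=.
  have S0 : 0 <= \sum_i `|Z i w| by exact: sumr_ge0.
  have [H|] := boolP [forall j, `|Z j w| <= L].
    rewrite -[leLHS]addr0 lerD ?mulr_ge0 ?invr_ge0//; last exact: ltW.
    by rewrite distrC; apply: qf => i; rewrite mxE; move/forallP: H.
  rewrite negb_forall => /existsP[j]; rewrite -ltNge => jL.
  have LS : L <= \sum_i `|Z i w|.
    by rewrite (bigD1 j)//= -[leLHS]addr0 lerD ?sumr_ge0// ltW.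
  rewrite -[leLHS]add0r lerD//; apply: le_trans (ler_normB _ _) _.
  apply: (@le_trans _ _ (2 * b)).
    by have := fb (\row_i Z i w); have := qb (\row_i Z i w); lra.
  by rewrite mulrAC ler_pdivlMr// ler_wpM2l//; lra.
rewrite RintegralD//; last 2 first.
  by apply: (bounded_integrable P (cst e) `|e|).
  rewrite (_ : _ \o _ = (fun w => (2 * b / L)%:E * (\sum_i `|Z i w|)%:E)%E)//.
  exact: integrableZl.
rewrite Rintegral_cst//= (_ : fine (P setT) = 1) ?probability_setT// mulr1 lerD2l RintegralZl//.
rewrite Rintegral_sum//.
rewrite (_ : 2 * b * m%:R * C / L = 2 * b / L * (m%:R * C)); last first.
  by field; rewrite gt_eqF.
rewrite ler_wpM2l//; first by apply: divr_ge0; [exact: mulr_ge0|exact: ltW].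
apply: (@le_trans _ _ (\sum_(i < m) C)); first exact: ler_sum.
by rewrite sumr_const card_ord mulr_natl.
Qed.

(** Bounded first moments provide tightness: one cube serves the limit and all large [t] at once,
    and [f] may be exchanged for one trigonometric polynomial. *)
Lemma weak_convergence_of_trig {d d'} {W : measurableType d} {W' : measurableType d'}
    (P : probability W R) (P' : probability W' R)
    (Z : R -> 'I_m -> W -> R) (Y : 'I_m -> W' -> R) (C : R) :
  (forall t i, measurable_fun setT (Z t i)) -> (forall i, measurable_fun setT (Y i)) ->
  (\forall t \near +oo, forall i, P.-integrable setT (EFin \o Z t i) /\
     \int[P]_w `|Z t i w| <= C) ->
  (forall i, P'.-integrable setT (EFin \o Y i)) ->
  (forall c phi, (\int[P]_w cos (phi + \sum_i c i * Z t i w)) @[t --> +oo] -->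
     \int[P']_w cos (phi + \sum_i c i * Y i w)) ->
  weakly_converges P P' Z Y.
Proof.
move=> mZ mY ZC iY H f cf [b fb].
have b0 : 0 <= b := le_trans (normr_ge0 _) (fb 0).
have Efin d0 (V : measurableType d0) (Q : probability V R) (g : V -> R) b' :
    measurable_fun setT g -> (forall w, `|g w| <= b') -> ('E_Q[g])%E = (\int[Q]_w g w)%:E.
  by move=> mg gb; rewrite unlock fineK//; apply: integrable_fin_num => //;
    exact: bounded_integrable mg gb.
rewrite (Efin _ _ P' _ b) => [|| w]; [|exact: row_measurable cf fb|exact: fb].
under eq_fun => t do (rewrite (Efin _ _ P _ b) => [|| w]; [|exact: row_measurable cf fb|exact: fb]).
apply: cvg_EFin; first by near=> t.
have Hq q : trig q -> \int[P]_w q (\row_i Z t i w) @[t --> +oo] --> \int[P']_w q (\row_i Y i w).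
  elim=> {q} [c phi|q1 q2 t1 IH1 t2 IH2|a q tq IH].
  - rewrite (_ : (fun w => _) = (fun w => cos (phi + \sum_i c i * Y i w))); last first.
      by apply/funext => w; under eq_bigr do rewrite mxE.
    under eq_fun => t.
      rewrite (_ : (fun w => _) = (fun w => cos (phi + \sum_i c i * Z t i w))); last first.
        by apply/funext => w; under eq_bigr do rewrite mxE.
    over.
    exact: H.
  - have [b1 q1b] := trig_bounded q1 t1; have [b2 q2b] := trig_bounded q2 t2.
    rewrite RintegralD//; [|exact: bounded_integrable (trig_measurable _ _ _ t1) (fun=> q1b _)
      |exact: bounded_integrable (trig_measurable _ _ _ t2) (fun=> q2b _)].
    under eq_fun => t do (rewrite RintegralD//;
      [|exact: bounded_integrable (trig_measurable _ _ _ t1) (fun=> q1b _)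
      |exact: bounded_integrable (trig_measurable _ _ _ t2) (fun=> q2b _)]).
    exact: cvgD.
  - have [b1 qb] := trig_bounded q tq.
    rewrite RintegralZl//; [|exact: bounded_integrable (trig_measurable _ _ _ tq) (fun=> qb _)].
    under eq_fun => t do (rewrite RintegralZl//;
      [|exact: bounded_integrable (trig_measurable _ _ _ tq) (fun=> qb _)]).
    by apply: cvgM => //; exact: cvg_cst.
apply/cvgrPdist_le => e e0.
pose C' := `|C| + \sum_i \int[P']_w `|Y i w|.
have YC i : \int[P']_w `|Y i w| <= C'.
  rewrite /C' (bigD1 i)//= addrA -[leLHS]addr0 lerD ?sumr_ge0// => [|j _].
    by rewrite lerDr.
  by apply: Rintegral_ge0.
have C'0 : 0 <= C' by rewrite addr_ge0// sumr_ge0// => i _; exact: Rintegral_ge0.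
(* This makes the tail term [2 b m C' / L] at most [e / 8], the summand 1 keeping [L] positive when
   the product is 0. Two comparisons at cost [e / 4] each and one convergence at cost [e / 8] stay
   below [e]. *)
pose L := 1 + 2 * b * m%:R * C' / (e / 8).
have L0 : 0 < L.
  by rewrite -[ltLHS]addr0 ltr_leD// divr_ge0 ?divr_ge0 ?mulr_ge0// ltW.
have e80 : 0 < e / 8 by rewrite divr_gt0.
have [q [tq qb qf]] := trig_approx f b L (e / 8) cf fb L0 e80.
have Lb : 2 * b * m%:R * C' / L <= e / 8.
  rewrite ler_pdivrMr// (_ : 2 * b * m%:R * C' = e / 8 * (L - 1)); first by nra.
  by rewrite /L; field; rewrite gt_eqF.
have hY := trig_approx_expectation P' Y f q b L (e / 8) C' mY cf fb tq qb L0 (ltW e80) qf iY YC.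
have /cvgrPdist_le /(_ _ e80) Hq' := Hq q tq.
near=> t.
have ZCt : forall i, P.-integrable setT (EFin \o Z t i) /\ \int[P]_w `|Z t i w| <= C by near: t.
have hZ := trig_approx_expectation P (Z t) f q b L (e / 8) C' (mZ t) cf fb tq qb L0 (ltW e80) qf
  (fun i => (ZCt i).1).
have {}hZ := hZ (fun i => le_trans (ZCt i).2 _).
have CC' : C <= C'.
  rewrite /C' -[leLHS]addr0 lerD ?ler_norm// sumr_ge0// => i _; exact: Rintegral_ge0.
have {}hZ := hZ CC'.
have hq : `| \int[P']_w q (\row_i Y i w) - \int[P]_w q (\row_i Z t i w)| <= e / 8 by near: t.
rewrite /= in hY hZ hq *.
move: hY hZ hq.
set a1 := Rintegral _ _ _; set a2 := Rintegral _ _ _.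
set a3 := Rintegral _ _ _; set a4 := Rintegral _ _ _.
rewrite !ler_norml => /andP[? ?] /andP[? ?] /andP[? ?]; apply/andP; split; lra.
Unshelve. all: by end_near. Qed.

End WeakConvergence.

Lemma Rdominated_cvg {R : realType} {d} {W : measurableType d}
    (mu : {measure set W -> \bar R}) (D : set W) (f_ : nat -> W -> R) (f g : W -> R) :
  measurable D -> (forall n, measurable_fun D (f_ n)) ->
  (forall w, D w -> f_ n w @[n --> \oo] --> f w) ->
  mu.-integrable D (EFin \o g) -> (forall n w, D w -> `|f_ n w| <= g w) ->
  mu.-integrable D (EFin \o f) /\
  \int[mu]_(w in D) f_ n w @[n --> \oo] --> \int[mu]_(w in D) f w.
Proof.
move=> mD mf ff ig fg.
have mfE n : measurable_fun D (EFin \o f_ n) by exact/measurable_EFinP.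
have intf_ n : mu.-integrable D (EFin \o f_ n).
  apply: (le_integrable mD _ _ ig) => // w Dw /=.
  by rewrite lee_fin (le_trans (fg n w Dw))// ler_norm.
have mf' : measurable_fun D (EFin \o f).
  by apply/measurable_EFinP; apply: measurable_fun_cvg ff.
have ae1 : {ae mu, forall w, D w -> (EFin \o f_ ^~ w) n @[n --> \oo] --> (EFin \o f) w}.
  by apply: aeW => w Dw; apply: cvg_EFin; [exact: nearW|exact: ff].
have ae2 : {ae mu, forall w n, D w -> (`|(EFin \o f_ n) w| <= (EFin \o g) w)%E}.
  by apply: aeW => w n Dw; rewrite lee_fin; exact: fg.
have [intf _ cf] := dominated_convergence mD mfE mf' ae1 ig ae2.
split=> //; rewrite /Rintegral; apply: fine_cvg.
by rewrite fineK//; exact: integrable_fin_num.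
Qed.

Lemma bounded_cvg_expectation {R : realType} {d} {W : measurableType d}
    (P : probability W R) (f_ : nat -> W -> R) (f : W -> R) (b : R) :
  (forall n, measurable_fun setT (f_ n)) -> (forall w, f_ n w @[n --> \oo] --> f w) ->
  (forall n w, `|f_ n w| <= b) ->
  \int[P]_w f_ n w @[n --> \oo] --> \int[P]_w f w.
Proof.
move=> mf ff fb; apply: (Rdominated_cvg P setT f_ f (cst b) _ _ _ _ _).2 => //.
by apply: (bounded_integrable P (cst b) `|b|).
Qed.

Lemma preimage_measurable {d d'} {W : measurableType d} {V : measurableType d'}
  (Z : W -> V) (C : set V) :
  measurable_fun setT Z -> measurable C -> measurable (Z @^-1` C).
Proof. by move=> mZ mC; rewrite -[X in measurable X]setTI; exact: mZ. Qed.

(** Applied to a family constant in [t], [weak_convergence_of_trig] gives equal expectations of all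
    bounded continuous functions. Ramps then yield equal probabilities of half-lines, which form a
    generating pi-system. *)
Lemma law_unique_trig {R : realType} {d d'} {W : measurableType d} {W' : measurableType d'}
    (P : probability W R) (Q : probability W' R) (X : W -> R) (Y : W' -> R) :
  measurable_fun setT X -> measurable_fun setT Y ->
  P.-integrable setT (EFin \o X) -> Q.-integrable setT (EFin \o Y) ->
  (forall s phi, \int[P]_w cos (phi + s * X w) = \int[Q]_w cos (phi + s * Y w)) ->
  forall C : set R, measurable C -> P (X @^-1` C) = Q (Y @^-1` C).
Proof.
move=> mX mY iX iY H.
have weak := @weak_convergence_of_trig R 1 _ _ _ _ P Q (fun _ _ => X) (fun=> Y)
  (\int[P]_w `|X w|) (fun _ _ => mX) (fun=> mY) (nearW _ (fun=> fun=> conj iX (lexx _)))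
  (fun=> iY).
have {}weak : weakly_converges P Q (fun (_ : R) (_ : 'I_1) => X) (fun=> Y).
  apply: weak => c phi; rewrite (_ : \int[Q]_w _ = \int[P]_w cos (phi + \sum_(i < 1) c i * X w)).
    exact: cvg_cst.
  under [in LHS]eq_Rintegral do rewrite big_ord1.
  under [in RHS]eq_Rintegral do rewrite big_ord1.
  by rewrite H.
have weakE (g : R -> R) (b : R) : continuous g -> (forall x, `|g x| <= b) ->
    \int[P]_w g (X w) = \int[Q]_w g (Y w).
  move=> cg gb; have := weak (fun v => g (v ord0 ord0)).
  move=> /(_ _ (ex_intro _ b (fun v => gb _))) ww.
  have {ww}/cvg_lim ww := ww (fun v => continuous_comp (f := fun v : 'rV[R]_1 => v ord0 ord0)
    (@coord_continuous _ _ _ _ _ v) (cg _)).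
  have := ww (@ereal_hausdorff R); rewrite lim_cst//.
  have eE d0 (V : measurableType d0) (S : probability V R) (h : V -> R) :
    ('E_S[h] = \int[S]_w (h w)%:E)%E by rewrite unlock.
  rewrite !eE => h; rewrite /Rintegral; congr fine.
  transitivity (\int[P]_w (g ((\row_(i < 1) X w : 'rV_1) ord0 ord0))%:E)%E.
    by apply: eq_integral => w _; rewrite mxE.
  by rewrite h; apply: eq_integral => w _; rewrite mxE.
(* A ramp: for [n > 0] it is 1 up to [a - 1 / n] and 0 from [a] on, so it tends to the indicator of
   the open half-line. *)
pose g (a : R) (n : nat) (x : R) := (1 + Num.max (- 1) (Num.min (2 * n%:R * (a - x) - 1) 1)) / 2.
have cg a n : continuous (g a n).
  move=> x; apply: cvgM; last exact: cvg_cst.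
  apply: cvgD; first exact: cvg_cst.
  apply: (continuous_comp (f := fun x : R => 2 * n%:R * (a - x) - 1) (g := fun u : R => Num.max (- 1) (Num.min u 1))); last exact: clip_continuous.
  apply: cvgB; last exact: cvg_cst.
  by apply: cvgM; [exact: cvg_cst|apply: cvgB; [exact: cvg_cst|exact: cvg_id]].
have gb a n x : `|g a n x| <= 1.
  have : (- 1 : R) <= Num.max (- 1) (Num.min (2 * n%:R * (a - x) - 1) 1) <= (1 : R).
    by rewrite le_max lexx/= ge_max ge_min lexx orbT andbT; lra.
  by rewrite /g ler_norml; lra.
have gcvg (a x : R) : g a n x @[n --> \oo] --> (\1_(`]-oo, a[%classic) x : R).
  rewrite indicE; have [ax|xa] := leP a x.
    rewrite memNset; last by rewrite /= in_itv/= ltNge ax.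
    rewrite (_ : (fun n => _) = cst 0); first exact: cvg_cst.
    apply/funext => n; rewrite /g.
    have : 2 * n%:R * (a - x) <= 0 by rewrite mulr_ge0_le0 ?mulr_ge0// subr_le0.
    by move=> ?; rewrite min_l ?max_l ?subrr ?mul0r//; lra.
  rewrite mem_set; last by rewrite /= in_itv/=.
  apply: cvg_near_cst; exists (Num.truncn (a - x)^-1).+1 => // n /= nax.
  have : (a - x)^-1 < n%:R.
    by apply: lt_le_trans (truncnS_gt _) _; rewrite ler_nat.
  rewrite -[ltLHS]mul1r ltr_pdivrMr ?subr_gt0// => h.
  by rewrite /g min_r ?max_r//; lra.
pose m1 := distribution P (mfun_Sub (mem_set mX) : {mfun W >-> R}).
pose m2 := distribution Q (mfun_Sub (mem_set mY) : {mfun W' >-> R}).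
suff : forall C : set R, measurable C -> m1 C = m2 C by [].
apply: (@measure_unique _ _ _ (@RGenInftyO.G R) (fun n => `]-oo, n%:R[%classic)).
- exact: RGenInftyO.measurableE.
- move=> _ _ [x ->] [y ->]; exists (Num.min x y).
  by apply/seteqP; split => z /=; rewrite !in_itv/= lt_min; [move=> [-> ->]|move/andP].
- by move=> n; exists n%:R.
- apply/seteqP; split=> // x _; exists (Num.truncn x).+1 => //=.
  by rewrite in_itv/= truncnS_gt.
- move=> _ [a ->]; rewrite /m1 /m2 /distribution /pushforward /=.
  have E d0 (V : measurableType d0) (S : probability V R) (Z : V -> R) : measurable_fun setT Z ->
      (\int[S]_w g a n (Z w)) @[n --> \oo] --> fine (S (Z @^-1` `]-oo, a[%classic)).
    move=> mZ; rewrite (_ : fine _ = \int[S]_w \1_(`]-oo, a[%classic) (Z w)).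
      apply: (bounded_cvg_expectation S _ _ 1) => [n|w|n w].
      + by apply: measurableT_comp => //; exact: continuous_measurable_fun.
      + exact: gcvg.
      + exact: gb.
    rewrite /Rintegral; congr fine.
    have mE : measurable (Z @^-1` `]-oo, a[%classic).
      exact: preimage_measurable.
    by have := integral_indic S measurableT mE; rewrite setIT => <-.
  have e1 := E _ _ P X mX; have e2 := E _ _ Q Y mY.
  have {e2} : (\int[P]_w g a n (X w)) @[n --> \oo] --> fine (Q (Y @^-1` `]-oo, a[%classic)).
    by under eq_fun do rewrite (weakE _ 1)//.
  move=> /(cvg_unique _ e1) => /(_ (@Rhausdorff R)) e12.
  have mP : measurable (X @^-1` `]-oo, a[%classic) by exact: preimage_measurable.
  have mQ : measurable (Y @^-1` `]-oo, a[%classic) by exact: preimage_measurable.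
  by rewrite -[LHS]fineK ?fin_num_measure// -[RHS]fineK ?fin_num_measure// e12.
- by move=> k; apply: le_lt_trans (probability_le1 _ _) _ => //; rewrite ltry.
Qed.

Section LinearIntegrability.
Context {R : realType} {d : measure_display} {W : measurableType d}.
Variable mu : {measure set W -> \bar R}.

Lemma integrable_scale (D : set W) (c : R) (f : W -> R) : measurable D ->
  mu.-integrable D (EFin \o f) -> mu.-integrable D (EFin \o (fun x => c * f x)).
Proof.
move=> mD fi; rewrite (_ : _ \o _ = (fun x => c%:E * (EFin \o f) x)%E) //.
exact: integrableZl.
Qed.

Lemma integrable_add (D : set W) (f g : W -> R) : measurable D ->
  mu.-integrable D (EFin \o f) -> mu.-integrable D (EFin \o g) ->
  mu.-integrable D (EFin \o (fun x => f x + g x)).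
Proof.
move=> mD fi gi; rewrite (_ : _ \o _ = ((EFin \o f) \+ (EFin \o g))%E) //.
exact: integrableD.
Qed.

Lemma integrable_sub (D : set W) (f g : W -> R) : measurable D ->
  mu.-integrable D (EFin \o f) -> mu.-integrable D (EFin \o g) ->
  mu.-integrable D (EFin \o (fun x => f x - g x)).
Proof.
move=> mD fi gi; rewrite (_ : _ \o _ = ((EFin \o f) \- (EFin \o g))%E) //.
exact: integrableB.
Qed.

End LinearIntegrability.

Lemma cvg_bigsum {R : realType} {T : Type} {F : set_system T} {FF : Filter F} {J : finType}
  (f : J -> T -> R) (l : J -> R) :
  (forall j, f j x @[x --> F] --> l j) -> (\sum_j f j x) @[x --> F] --> \sum_j l j.
Proof.
move=> fl; elim: (index_enum J) => [|j s IH].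
  by under eq_fun do rewrite big_nil; rewrite big_nil; exact: cvg_cst.
under eq_fun do rewrite big_cons; rewrite big_cons.
by apply: cvgD => //; exact: fl.
Qed.

Lemma integrable_indic_prob {R : realType} {d} {W : measurableType d} (P : probability W R)
  (E : set W) : measurable E -> P.-integrable setT (EFin \o (\1_E : W -> R)).
Proof.
move=> mE; apply: (bounded_integrable P _ 1); first exact: measurable_indic.
by move=> w; rewrite indicE; case: (_ \in _); rewrite ?normr1 ?normr0.
Qed.

Lemma Rintegral_indic_prob {R : realType} {d} {W : measurableType d} (P : probability W R)
  (E : set W) : measurable E -> \int[P]_w (\1_E w : R) = fine (P E).
Proof. by move=> mE; rewrite /Rintegral integral_indic// setIT. Qed.

Lemma integrable_cst_prob {R : realType} {d} {W : measurableType d} (P : probability W R)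
  (c : R) : P.-integrable setT (EFin \o (fun _ : W => c)).
Proof. exact: (bounded_integrable P _ `|c|). Qed.

(** * Gaussian vectors *)

Lemma Rintegral_FTC {R : realType} (F f : R -> R) (a b : R) : a <= b ->
  (forall x : R, is_derive x (1 : R) F (f x)) -> continuous f ->
  \int[lebesgue_measure]_(x in `[a, b]) f x = F b - F a.
Proof.
rewrite le_eqVlt => /predU1P[->|ab] dF cf.
  by rewrite subrr set_itv1 Rintegral_set1.
have cF x : {for x, continuous F} by apply: differentiable_continuous; exact/derivable1_diffP/(@ex_derive _ _ _ _ _ _ _ (dF x)).
rewrite /Rintegral (continuous_FTC2 ab (F := F))//.
- exact: continuous_subspaceT.
- split.
  + by move=> x _; have [] := dF x.
  + by apply: cvg_at_right_filter; exact: cF.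
  + by apply: cvg_at_left_filter; exact: cF.
- by move=> x _; rewrite derive1E; exact: (@derive_val _ _ _ _ _ _ _ (dF x)).
Qed.

(** * The cosine transform of the normal law *)

Section GaussianCharacteristic.
Context {R : realType} (sigma : R) (sigma_neq0 : sigma != 0).
Local Notation mu := (@lebesgue_measure R).
Let p : R -> R := normal_pdf 0 sigma.

Lemma normal_pdf0E x : p x = normal_peak sigma * expR (- x ^+ 2 / (sigma ^+ 2 *+ 2)).
Proof. by rewrite /p normal_pdfE//= /normal_fun subr0. Qed.

Lemma normal_pdf0_ge0 x : 0 <= p x. Proof. exact: normal_pdf_ge0. Qed.

Lemma is_derive_normal_pdf0 (x : R) : is_derive x (1 : R) p (- x / sigma ^+ 2 * p x).
Proof.
rewrite (_ : p = fun x => normal_peak sigma * expR (- x ^+ 2 / (sigma ^+ 2 *+ 2))); last first.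
  by apply/funext => y; exact: normal_pdf0E.
apply: is_derive_eq.
rewrite /= scaler0 add0r /GRing.scale/= !mulr1.
by field; exact: sigma_neq0.
Qed.

(** Splitting the exponent by [1/2 = 1/8 + 3/8] leaves the density of twice the deviation times
    [exp (- y)], and [|x| <= 2 |sigma| (1 + y) <= 2 |sigma| exp y]. Integrability of [|x| p x] is
    thus reduced to that of a density. *)
Lemma abs_normal_pdf_le x : `|x| * p x <=
  2 * `|sigma| * normal_peak sigma / normal_peak (2 * sigma) * normal_pdf 0 (2 * sigma) x.
Proof.
have s20 : 2 * sigma != 0 by rewrite mulf_neq0.
rewrite normal_pdf0E normal_pdfE//= /normal_fun subr0.
have pk := normal_peak_gt0 s20; have pk0 := normal_peak_gt0 sigma_neq0.
set e8 := expR (- x ^+ 2 / ((2 * sigma) ^+ 2 *+ 2)).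
set y := 3 * x ^+ 2 / (8 * sigma ^+ 2).
have y0 : 0 <= y by apply: divr_ge0; rewrite mulr_ge0 ?sqr_ge0.
have -> : expR (- x ^+ 2 / (sigma ^+ 2 *+ 2)) = e8 * expR (- y).
  rewrite -expRD; congr expR; rewrite /y; field.
  exact: sigma_neq0.
rewrite (_ : _ / _ * _ = 2 * `|sigma| * (normal_peak sigma * e8)); last first.
  by rewrite /e8; field; rewrite gt_eqF.
rewrite (_ : `|x| * _ = `|x| * expR (- y) * (normal_peak sigma * e8)); last by ring.
rewrite ler_wpM2r//; first by rewrite mulr_ge0 ?expR_ge0// ltW.
rewrite expRN ler_pdivrMr ?expR_gt0//.
apply: (@le_trans _ _ (2 * `|sigma| * (1 + y))); last first.
  by rewrite ler_wpM2l ?mulr_ge0// expR_ge1Dx.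
have s0 : 0 < `|sigma| by rewrite normr_gt0.
have -> : y = 3 * `|x| ^+ 2 / (8 * `|sigma| ^+ 2).
  by rewrite /y !real_normK ?num_real.
rewrite -subr_ge0 (_ : _ - _ = 2 * `|sigma| * ((1 - `|x| / (4 * `|sigma|)) ^+ 2 + 5 * `|x| ^+ 2 / (16 * `|sigma| ^+ 2))).
  by rewrite mulr_ge0// addr_ge0 ?sqr_ge0// divr_ge0 ?mulr_ge0 ?sqr_ge0.
by field; rewrite gt_eqF.
Qed.

Lemma integrable_abs_normal_pdf : mu.-integrable setT (EFin \o (fun x => `|x| * p x)).
Proof.
apply: (le_integrable measurableT _ _ (integrableZl measurableT
  (2 * `|sigma| * normal_peak sigma / normal_peak (2 * sigma)) (integrable_normal_pdf 0 (2 * sigma)))).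
  apply/measurable_EFinP; apply: measurable_funM; last exact: measurable_normal_pdf.
  exact: (continuous_measurable_fun (@norm_continuous _ R^o)).
move=> x _ /=; rewrite lee_fin ger0_norm; last by rewrite mulr_ge0 ?normal_pdf0_ge0.
by apply: le_trans (abs_normal_pdf_le x) _; exact: ler_norm.
Qed.

Lemma integrable_bounded_normal_pdf (g : R -> R) : continuous g -> (forall x, `|g x| <= 1) ->
  mu.-integrable setT (EFin \o (fun x => g x * p x)).
Proof.
move=> cg gb; apply: (le_integrable measurableT _ _ (integrable_normal_pdf 0 sigma)).
  apply/measurable_EFinP; apply: measurable_funM; last exact: measurable_normal_pdf.
  exact: continuous_measurable_fun.
move=> x _ /=; rewrite lee_fin normrM -[leRHS]mul1r; exact: ler_pM.
Qed.

Lemma integrable_bounded_id_normal_pdf (g : R -> R) : continuous g -> (forall x, `|g x| <= 1) ->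
  mu.-integrable setT (EFin \o (fun x => g x * (x * p x))).
Proof.
move=> cg gb; apply: (le_integrable measurableT _ _ integrable_abs_normal_pdf).
  apply/measurable_EFinP; apply: measurable_funM; first exact: continuous_measurable_fun.
  by apply: measurable_funM; last exact: measurable_normal_pdf.
move=> x _ /=; rewrite lee_fin !normrM normr_id -[leRHS]mul1r; exact: ler_pM.
Qed.

Lemma continuous_affine_comp (f : R -> R) phi s : continuous f -> continuous (fun x : R => f (phi + s * x)).
Proof.
move=> cf x; apply: (continuous_comp (f := fun x : R => phi + s * x) (g := f)); last exact: cf.
by apply: cvgD; [exact: cvg_cst|apply: cvgM; [exact: cvg_cst|exact: cvg_id]].
Qed.

(** The Radon-Nikodym derivative of [normal_prob] agrees almost everywhere with the density, since
    both have the same integral over every measurable set. *)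
Lemma integral_normal_prob (f : R -> R) : measurable_fun setT f -> (forall x, `|f x| <= 1) ->
  \int[normal_prob 0 sigma]_x f x = \int[mu]_x (f x * p x).
Proof.
move=> mf f1; rewrite /Rintegral; congr fine.
have intf : (normal_prob 0 sigma).-integrable setT (EFin \o f).
  exact: (bounded_integrable (normal_prob 0 sigma) f 1).
have dom := @normal_prob_dominates R 0 sigma.
rewrite -(Radon_Nikodym_change_of_variables dom)//=.
apply: ae_eq_integral => //.
- apply: emeasurable_funM; first exact/measurable_EFinP.
  by apply: (measurable_int mu); exact: Radon_Nikodym_integrable.
- by apply/measurable_EFinP; apply: measurable_funM => //; exact: measurable_normal_pdf.
- under [X in ae_eq _ _ _ X]eq_fun do rewrite EFinM.
  apply: ae_eqe_mul2l => /=.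
  apply: integral_ae_eq => //=.
  + exact: Radon_Nikodym_integrable.
  + by apply/measurable_EFinP; exact: measurable_normal_pdf.
  + by move=> E E01 mE; rewrite -Radon_Nikodym_integral.
Qed.

Let F phi s := \int[mu]_x (cos (phi + s * x) * p x).

(* The integral over the line of [(sigma^2 sin (phi + s x) p x)'] vanishes. *)
Lemma integration_by_parts_normal phi s :
  \int[mu]_x (- sin (phi + s * x) * (x * p x)) = - (sigma ^+ 2 * s) * F phi s.
Proof.
pose h x := sigma ^+ 2 * sin (phi + s * x) * p x.
pose h' x := sigma ^+ 2 * s * (cos (phi + s * x) * p x) + - sin (phi + s * x) * (x * p x).
have dh (x : R) : is_derive x (1 : R) h (h' x).
  have dp := is_derive_normal_pdf0 x.
  have ds : is_derive x (1 : R) (fun x : R => sin (phi + s * x)) (s * cos (phi + s * x)).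
    by apply: is_derive_eq; rewrite /GRing.scale/= ?mulr1 ?mulr0 ?add0r ?addr0; ring.
  apply: is_derive_eq; rewrite /h' /GRing.scale/=; field.
  exact: sigma_neq0.
have i1 : mu.-integrable setT (EFin \o (fun x => sigma ^+ 2 * s * (cos (phi + s * x) * p x))).
  rewrite (_ : _ \o _ = fun x => ((sigma ^+ 2 * s)%:E * (cos (phi + s * x) * p x)%:E)%E)//.
  apply: integrableZl => //; apply: (integrable_bounded_normal_pdf (fun x => cos (phi + s * x))) => [|x].
    exact/continuous_affine_comp/continuous_cos.
  exact: cos_max.
have i2 : mu.-integrable setT (EFin \o (fun x => - sin (phi + s * x) * (x * p x))).
  apply: (integrable_bounded_id_normal_pdf (fun x => - sin (phi + s * x))) => [x|x].
    by apply: cvgN; apply: continuous_affine_comp; exact: continuous_sin.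
  by rewrite normrN sin_max.
have i3 : mu.-integrable setT (EFin \o h') by exact: (integrableD measurableT i1 i2).
have ch' : continuous h'.
  have cp : continuous p by exact: continuous_normal_pdf.
  move=> x; apply: cvgD.
    apply: cvgM; first exact: cvg_cst.
    by apply: cvgM; [exact/continuous_affine_comp/continuous_cos|exact: cp].
  apply: cvgM; first by apply: cvgN; exact/continuous_affine_comp/continuous_sin.
  by apply: cvgM; [exact: cvg_id|exact: cp].
suff H0 : \int[mu]_x h' x = 0.
  move: H0; rewrite /h' RintegralD// RintegralZl//.
    by move/eqP; rewrite addrC addr_eq0 => /eqP ->; rewrite mulNr.
  apply: (integrable_bounded_normal_pdf (fun x => cos (phi + s * x))) => [|x].
    exact/continuous_affine_comp/continuous_cos.
  exact: cos_max.
have lim1 : \int[mu]_x (h' x * \1_(`[- n%:R, n%:R]%classic) x) @[n --> \oo] --> \int[mu]_x h' x.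
  apply: (Rdominated_cvg mu setT _ h' (fun x => `|h' x|) _ _ _ _ _).2 => //.
  - move=> n; apply: measurable_funM; first exact: continuous_measurable_fun.
    exact: measurable_indic.
  - move=> x _; apply: cvg_near_cst; exists (Num.truncn `|x|).+1 => // n /= xn.
    rewrite indicE mem_set ?mulr1//= in_itv/= -ler_norml.
    by apply/ltW/(lt_le_trans (truncnS_gt _)); rewrite ler_nat.
  - exact: integrable_norm.
  - by move=> n x _; rewrite normrM ler_piMr// indicE; case: (_ \in _); rewrite ?normr1 ?normr0.
have lim2 : \int[mu]_x (h' x * \1_(`[- n%:R, n%:R]%classic) x) @[n --> \oo] --> (0 : R).
  rewrite (_ : (fun n => _) = fun n => h n%:R - h (- n%:R)); last first.
    apply/funext => n; rewrite -(Rintegral_FTC h h') ?lerN2//; last by rewrite -subr_ge0 opprK addr_ge0.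
    rewrite [RHS]Rintegral_mkcond; apply: eq_Rintegral => x _.
    by rewrite patchE indicE; case: ifPn => _; rewrite ?mulr1 ?mulr0.
  (* [abs_normal_pdf_le] bounds [n * p n] by a constant, so the boundary terms are [O (1 / n)]. *)
  have pn : (fun n : nat => p n%:R) @ \oo --> (0 : R).
    apply: (@squeeze_cvgr _ _ _ _ (cst 0) (fun n : nat =>
      2 * `|sigma| * normal_peak sigma / normal_peak (2 * sigma) * normal_peak (2 * sigma) * n%:R^-1)).
    + exists 1%N => // n /= n1; apply/andP; split; first exact: normal_pdf0_ge0.
      rewrite ler_pdivlMr ?ltr0n// mulrC -{1}(@ger0_norm _ n%:R)//.
      apply: le_trans (abs_normal_pdf_le _) _; rewrite ler_wpM2l//.
        by rewrite divr_ge0 ?mulr_ge0// ?normal_peak_ge0.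
      by apply: normal_pdf_ub; rewrite mulf_neq0.
    + exact: cvg_cst.
    + rewrite -[X in _ --> X](mulr0 (2 * `|sigma| * normal_peak sigma / normal_peak (2 * sigma) * normal_peak (2 * sigma))).
      by apply: cvgM; [exact: cvg_cst|rewrite -cvg_shiftS; exact: cvg_harmonic].
  have pN n : p (- n%:R) = p n%:R by rewrite !normal_pdf0E sqrrN.
  apply/norm_cvg0P; apply: (@squeeze_cvgr _ _ _ _ (cst 0) (fun n : nat => 2 * sigma ^+ 2 * p n%:R)).
  + apply: nearW => n; rewrite normr_ge0/=; apply: le_trans (ler_normB _ _) _.
    have hb x : `|h x| <= sigma ^+ 2 * p x.
      rewrite /h 2!normrM (ger0_norm (normal_pdf0_ge0 _)) (@ger0_norm _ (sigma ^+ 2)) ?sqr_ge0//.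
      by rewrite ler_wpM2r ?normal_pdf0_ge0// ler_piMr ?sqr_ge0// sin_max.
    by have := hb n%:R; have := hb (- n%:R); rewrite pN; lra.
  + exact: cvg_cst.
  + by rewrite -[X in _ --> X](mulr0 (2 * sigma ^+ 2)); apply: cvgM => //; exact: cvg_cst.
exact: (cvg_unique _ lim1 lim2).
Qed.

(** Differentiation under the integral, dominated by [|x| p x], followed by integration by parts,
    closes into a linear differential equation in [s]. *)
Lemma is_derive_cos_transform phi (s : R) : is_derive s (1 : R) (F phi) (- (sigma ^+ 2 * s) * F phi s).
Proof.
have da (r x : R) : is_derive r (1 : R) (fun r : R => cos (phi + r * x) * p x) (- sin (phi + r * x) * (x * p x)).
  by apply: is_derive_eq; rewrite /GRing.scale/= ?mulr1 ?mulr0; ring.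
have pa r x : partial1of2 (fun r x => cos (phi + r * x) * p x) r x = - sin (phi + r * x) * (x * p x).
  by rewrite partial1of2E; exact: (@derive_val _ _ _ _ _ _ _ (da r x)).
have H0 : `]s - 1, s + 1[%classic s by rewrite /= in_itv/=; lra.
have H1 (r : R) : `]s - 1, s + 1[%classic r -> mu.-integrable setT (EFin \o (fun x => cos (phi + r * x) * p x)).
  move=> _; apply: (integrable_bounded_normal_pdf (fun x => cos (phi + r * x))) => [|x].
    exact/continuous_affine_comp/continuous_cos.
  exact: cos_max.
have H2 (r x : R) : `]s - 1, s + 1[%classic r -> setT x -> derivable (fun r : R => cos (phi + r * x) * p x) r (1 : R).
  by move=> _ _; exact: (@ex_derive _ _ _ _ _ _ _ (da r x)).
have H3 (x : R) : 0 <= `|x| * p x by rewrite mulr_ge0 ?normal_pdf0_ge0.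
have H4 (r x : R) : `]s - 1, s + 1[%classic r -> setT x ->
    `|partial1of2 (fun r x => cos (phi + r * x) * p x) r x| <= `|x| * p x.
  move=> _ _; rewrite pa !normrM normrN (ger0_norm (normal_pdf0_ge0 _)) ler_piMl ?sin_max//; exact: H3.
have := @derivable_under_integral _ _ _ mu (fun r x => cos (phi + r * x) * p x) _ measurableT s _ _ H0 H1 H2 _ H3 integrable_abs_normal_pdf H4.
have := @differentiation_under_integral _ _ _ mu (fun r x => cos (phi + r * x) * p x) _ measurableT s _ _ H0 H1 H2 _ H3 integrable_abs_normal_pdf H4.
rewrite derive1E => D1 D2; apply: DeriveDef; first exact: D2.
rewrite D1 -integration_by_parts_normal; apply: eq_Rintegral => x _; exact: pa.
Qed.

(** With the integrating factor [exp ((sigma s)^2 / 2)] the transform has zero derivative, and its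
    value at [s = 0] is [cos phi]. *)
Lemma normal_prob_cos phi s :
  \int[normal_prob 0 sigma]_x cos (phi + s * x) = cos phi * expR (- (sigma * s) ^+ 2 / 2).
Proof.
rewrite integral_normal_prob => [||x]; last exact: cos_max.
  2: by apply: continuous_measurable_fun; exact/continuous_affine_comp/continuous_cos.
rewrite -/(F phi s).
pose G r := F phi r * expR ((sigma * r) ^+ 2 / 2).
have : G s = G 0.
  apply: is_derive_0_is_cst => r; have dF := is_derive_cos_transform phi r.
  by apply: is_derive_eq; rewrite /GRing.scale/=; field.
rewrite /G mulr0 expr0n/= mul0r expR0 mulr1.
have -> : F phi 0 = cos phi.
  rewrite /F; under eq_Rintegral do rewrite mul0r addr0.
  rewrite RintegralZl//; last exact: integrable_normal_pdf.
  by rewrite /Rintegral integral_normal_pdf mulr1.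
by move=> <-; rewrite mulNr expRN mulfK// gt_eqF// expR_gt0.
Qed.

End GaussianCharacteristic.

(** * Gaussian vectors with prescribed covariance *)

Section GaussianVector.
Context {R : realType}.

Definition qform m (K : 'I_m -> 'I_m -> R) (c : 'I_m -> R) : R :=
  \sum_i \sum_j c i * c j * K i j.

Lemma qformS m (K : 'I_m.+1 -> 'I_m.+1 -> R) c : (forall i j, K i j = K j i) ->
  qform _ K c = c ord0 ^+ 2 * K ord0 ord0 +
    2 * c ord0 * (\sum_j c (lift ord0 j) * K ord0 (lift ord0 j)) +
    qform _ (fun i j => K (lift ord0 i) (lift ord0 j)) (fun i => c (lift ord0 i)).
Proof.
move=> symK; rewrite /qform big_ord_recl big_ord_recl.
under [X in _ + X]eq_bigr do rewrite big_ord_recl.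
rewrite big_split/= addrA; congr (_ + _).
rewrite expr2 -addrA; congr (_ + _).
rewrite -[2]/(1 + 1 : R) mulrDl mul1r mulrDl !mulr_sumr; congr (_ + _).
  by apply: eq_bigr => j _; rewrite mulrA.
by apply: eq_bigr => j _; rewrite symK; ring.
Qed.

(* Cauchy-Schwarz for a form with a zero diagonal entry. *)
Lemma psd_zero_row m (K : 'I_m.+1 -> 'I_m.+1 -> R) : (forall i j, K i j = K j i) ->
  (forall c, 0 <= qform _ K c) -> K ord0 ord0 = 0 -> forall j, K ord0 (lift ord0 j) = 0.
Proof.
move=> symK psdK K00 j; set k := K ord0 (lift ord0 j).
set l := K (lift ord0 j) (lift ord0 j).
have H t : 0 <= 2 * t * k + l.
  pose c i := if i == ord0 then t else if i == lift ord0 j then 1 else 0 : R.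
  have := psdK c; rewrite qformS// K00 mulr0 add0r /c eqxx.
  under eq_bigr do rewrite /= (inj_eq lift_inj).
  rewrite (bigD1 j)//= eqxx mul1r big1 => [|i /negbTE ->]; last by rewrite mul0r.
  rewrite addr0 /qform (bigD1 j)//= [X in _ + (_ + X)]big1 => [|i /negbTE ij]; last first.
    by apply: big1 => i' _; rewrite (inj_eq lift_inj) ij !mul0r.
  rewrite addr0 (bigD1 j)//= !eqxx !mul1r big1 ?addr0// => i /negbTE ij.
  by rewrite (inj_eq lift_inj) ij mulr0 mul0r.
have [//|k0] := eqVneq k 0.
(* This choice of the first coordinate makes the form equal to [-1]. *)
have := H (- (l + 1) / (2 * k)).
rewrite (_ : 2 * _ * k + l = -1); last by field.
by rewrite oppr_ge0 ler10.
Qed.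

Lemma Rintegral_prod {d1 d2} {W1 : measurableType d1} {W2 : measurableType d2}
    (P1 : probability W1 R) (P2 : probability W2 R) (f : W1 * W2 -> R) (b : R) :
  measurable_fun setT f -> (forall w, `|f w| <= b) ->
  \int[(P1 \x P2)%E]_w f w = \int[P1]_w1 \int[P2]_w2 f (w1, w2).
Proof.
move=> mf fb.
have intf : (P1 \x P2)%E.-integrable setT (EFin \o f) := bounded_integrable (P1 \x P2)%E f b mf fb.
rewrite /Rintegral -(integral12_prod_meas1 intf); congr fine.
apply: eq_integral => w1 _; rewrite /fubini_F/= fineK//.
apply: integrable_fin_num => //; apply: (bounded_integrable P2 (fun w2 => f (w1, w2)) b) => //.
exact: measurableT_comp.
Qed.

(* Induction on the dimension: split off the regression on the first coordinate, which
   leaves the Schur complement of [K ord0 ord0]. *)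
Lemma gaussian_vector_cos m (K : 'I_m -> 'I_m -> R) : (forall i j, K i j = K j i) ->
  (forall c, 0 <= qform _ K c) ->
  exists (d' : measure_display) (W' : measurableType d') (P' : probability W' R)
    (Y : 'I_m -> {RV P' >-> R}), forall c phi,
    \int[P']_w cos (phi + \sum_i c i * Y i w) = cos phi * expR (- qform _ K c / 2).
Proof.
elim: m K => [|m IH] K symK psdK.
  exists _, _, (normal_prob (0 : R) 1 : probability _ R), (fun=> cst 0).
  move=> c phi; under eq_Rintegral do rewrite big_ord0 addr0.
  rewrite /qform big_ord0 oppr0 mul0r expR0 mulr1 Rintegral_cst//=.
  by rewrite (_ : fine _ = 1) ?mulr1// probability_setT.
pose a := K ord0 ord0; pose r := Num.sqrt a.
have a0 : 0 <= a.
  have := psdK (fun i => (i == ord0)%:R); rewrite qformS// eqxx expr1n mul1r.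
  rewrite big1 => [|j _]; last by rewrite mul0r.
  rewrite mulr0 addr0 /qform big1 => [|i _]; first by rewrite addr0.
  by apply: big1 => j _; rewrite !mul0r.
have r2 : r ^+ 2 = a by rewrite sqr_sqrtr.
(* Coefficients of the regression on a standard normal variable. For [r = 0] the quotient is 0, and
   [br] still holds because the whole row vanishes by [psd_zero_row]. *)
pose b (j : 'I_m) := K ord0 (lift ord0 j) / r.
have br j : b j * r = K ord0 (lift ord0 j).
  have [r0|r0] := eqVneq r 0; last by rewrite mulfVK.
  by rewrite r0 mulr0 psd_zero_row//; move: r2; rewrite r0 expr0n.
pose K' (i j : 'I_m) := K (lift ord0 i) (lift ord0 j) - b i * b j.
have K'E c : qform _ K c = qform _ K' (fun i => c (lift ord0 i)) +
    (c ord0 * r + \sum_j c (lift ord0 j) * b j) ^+ 2.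
  rewrite qformS//.
  have -> : \sum_j c (lift ord0 j) * K ord0 (lift ord0 j) = (\sum_j c (lift ord0 j) * b j) * r.
    by rewrite mulr_suml; apply: eq_bigr => j _; rewrite -br mulrA.
  have -> : qform _ K' (fun i => c (lift ord0 i)) =
      qform _ (fun i j => K (lift ord0 i) (lift ord0 j)) (fun i => c (lift ord0 i)) -
      (\sum_j c (lift ord0 j) * b j) ^+ 2.
    rewrite expr2 mulr_suml /qform -sumrB; apply: eq_bigr => i _.
    rewrite mulr_sumr -sumrB; apply: eq_bigr => j _; rewrite /K'; ring.
  by rewrite -/a -r2; ring.
have [|c|d' [W' [P' [Y YE]]]] := IH K'.
- by move=> i j; rewrite /K' symK mulrC.
(* The first coordinate is chosen to kill the square in [K'E], so the form of [K'] at [c] is a value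
   of the form of [K]. For [r = 0] every [b j] is 0 and the square vanishes by itself. *)
- pose c' i := if unlift ord0 i is Some j then c j else - (\sum_j c j * b j) / r.
  have cK : (fun i => c' (lift ord0 i)) = c by apply/funext => i; rewrite /c' liftK.
  have E : \sum_j c' (lift ord0 j) * b j = \sum_j c j * b j.
    by apply: eq_bigr => j _; rewrite /c' liftK.
  have := psdK c'; rewrite K'E E cK /c' unlift_none.
  have [r0|r0] := eqVneq r 0; last by rewrite mulfVK// addNr expr0n addr0.
  rewrite (_ : \sum_j _ = 0) ?r0 ?mulr0 ?addr0 ?expr0n ?addr0//.
  by apply: big1 => j _; rewrite /b r0 invr0 !mulr0.
pose N := normal_prob (0 : R) 1 : probability _ R.
(* On the product space the second factor is a standard normal variable independent of [Y]; each
   later coordinate adds its regression on it. *)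
pose Z (i : 'I_m.+1) (w : W' * measurableTypeR R) : R :=
  if unlift ord0 i is Some j then Y j w.1 + b j * w.2 else r * w.2.
have mZ i : measurable_fun setT (Z i).
  rewrite /Z; case: unlift => [j|].
    apply: measurable_funD; first exact: measurableT_comp.
    exact: measurable_funM.
  exact: measurable_funM.
exists _, _, (P' \x N)%E, (fun i => mfun_Sub (mem_set (mZ i)) : {RV (P' \x N)%E >-> R}).
move=> c phi.
rewrite (Rintegral_prod _ _ _ 1); last 2 first.
- apply: measurableT_comp; first exact: continuous_measurable_fun (@continuous_cos R).
  by apply: measurable_funD => //; apply: measurable_sum => i; exact: measurable_funM.
- by move=> w; rewrite ler_norml cos_geN1 cos_le1.
pose be := c ord0 * r + \sum_j c (lift ord0 j) * b j.
transitivity (\int[P']_w (cos (phi + \sum_j c (lift ord0 j) * Y j w) * expR (- be ^+ 2 / 2))).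
  apply: eq_Rintegral => w _.
  rewrite -[be]mul1r -(normal_prob_cos 1 (oner_neq0 _)); apply: eq_Rintegral => x _.
  congr cos; rewrite big_ord_recl -addrA; congr (_ + _).
  rewrite /= /Z unlift_none.
  under eq_bigr do rewrite liftK /= mulrDr.
  rewrite big_split/= addrCA; congr (_ + _).
  rewrite /be mulrDl mulr_suml; congr (_ + _); first by rewrite mulrA.
  by apply: eq_bigr => j _; rewrite mulrA.
rewrite RintegralZr//; last first.
  apply: (bounded_integrable P' _ 1) => [|w]; last by rewrite ler_norml cos_geN1 cos_le1.
  apply: measurableT_comp; first exact: continuous_measurable_fun (@continuous_cos R).
  by apply: measurable_funD => //; apply: measurable_sum => i; exact: measurable_funM.
rewrite YE -mulrA -expRD K'E -/be; congr (_ * expR _); ring.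
Qed.

End GaussianVector.

Lemma cvg_dist_bound {R : realType} {T : Type} {F : set_system T} {FF : Filter F}
    (u e : T -> R) (l : R) :
  (\forall t \near F, `|u t - l| <= e t) -> e t @[t --> F] --> (0 : R) ->
  u t @[t --> F] --> l.
Proof.
move=> ue e0; apply/cvgrPdistC_le => eps eps0.
have /cvgrPdistC_le /(_ _ eps0) e0' := e0.
near=> t; apply: (@le_trans _ _ (e t)); first by near: t.
have : `|e t - 0| <= eps by near: t.
by rewrite subr0; apply: le_trans; exact: ler_norm.
Unshelve. all: by end_near. Qed.

(** * Moments from the cosine transform *)

Section GaussianMoments.
Context {R : realType}.

Lemma expectationE {d} {W : measurableType d} (P : probability W R) (X : W -> R) :
  P.-integrable setT (EFin \o X) -> ('E_P[X] = (\int[P]_w X w)%:E)%E.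
Proof. by move=> iX; rewrite unlock /Rintegral fineK//; exact: integrable_fin_num. Qed.

Lemma integrable_cos_affine {d} {W : measurableType d} (P : probability W R) (Y : W -> R) (a b : R) :
  measurable_fun setT Y -> P.-integrable setT (EFin \o (fun w => cos (a + b * Y w))).
Proof.
move=> mY; apply: (bounded_integrable P _ 1) => [|w]; last by rewrite ler_norml cos_geN1 cos_le1.
apply: measurableT_comp; first exact: continuous_measurable_fun (@continuous_cos R).
by apply: measurable_funD => //; exact: measurable_funM.
Qed.

(* The moments are read off the characteristic function at [s = 1 / n], using
   [2 (1 - cos (s y)) / s^2 --> y^2] and [sin (s y) / s --> y]. *)
Lemma moments_of_cos {d} {W : measurableType d} (P : probability W R) (Y : W -> R) (v : R) :
  measurable_fun setT Y -> 0 <= v ->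
  (forall s phi, \int[P]_w cos (phi + s * Y w) = cos phi * expR (- (s ^+ 2 * v) / 2)) ->
  [/\ P.-integrable setT (EFin \o (fun w => Y w ^+ 2)), \int[P]_w (Y w ^+ 2) = v,
      P.-integrable setT (EFin \o Y) & \int[P]_w Y w = 0].
Proof.
move=> mY v0 H.
pose s (n : nat) : R := n.+1%:R^-1.
have s0 n : 0 < s n by rewrite invr_gt0.
have c0 n : 0 <= 2 / s n ^+ 2 by apply: divr_ge0; rewrite ?ler0n ?sqr_ge0.
have s_to0 : s n @[n --> \oo] --> (0 : R) by exact: cvg_harmonic.
have s2_to0 : s n ^+ 2 @[n --> \oo] --> (0 : R).
  by rewrite -[X in _ --> X](mulr0 (0 : R)); under eq_fun do rewrite expr2; exact: cvgM.
pose g n w := (1 - cos (0 + s n * Y w)) * (2 / s n ^+ 2).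
have mg n : measurable_fun setT (g n).
  apply: measurable_funM => //; apply: measurable_funB => //.
  by have /integrableP[/measurable_EFinP] := integrable_cos_affine P Y 0 (s n) mY.
have g0 n w : 0 <= g n w.
  by rewrite mulr_ge0 ?subr_ge0 ?cos_le1// divr_ge0// sqr_ge0.
have gle n w : g n w <= Y w ^+ 2.
  rewrite /g add0r mulrA ler_pdivrMr ?exprn_gt0//.
  have := cos_ge_taylor2 (s n * Y w); rewrite exprMn; lra.
have gcvg w : g n w @[n --> \oo] --> Y w ^+ 2.
  apply: (cvg_dist_bound _ (fun n => s n ^+ 2 * (Y w ^+ 4 / 12))).
    apply: nearW => n; have := cos_taylor (s n * Y w).
    rewrite (_ : g n w - Y w ^+ 2 = (cos (s n * Y w) - (1 - (s n * Y w) ^+ 2 / 2)) * (- (2 / s n ^+ 2))).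
      rewrite normrM normrN (ger0_norm (c0 n)) => h.
      apply: le_trans (ler_wpM2r (c0 n) h) _.
      by rewrite le_eqVlt; apply/orP; left; apply/eqP; field; rewrite gt_eqF.
    by rewrite /g add0r; field; rewrite gt_eqF.
  by rewrite -[X in _ --> X](mul0r (Y w ^+ 4 / 12)); apply: cvgM => //; exact: cvg_cst.
have intg n : \int[P]_w g n w = (1 - expR (- (s n ^+ 2 * v) / 2)) * (2 / s n ^+ 2).
  rewrite RintegralZr//; last first.
    exact: (integrableB measurableT (bounded_integrable P (cst 1) `|1| (measurable_cst _)
      (fun=> lexx _)) (integrable_cos_affine P Y 0 (s n) mY)).
  congr (_ * _); rewrite RintegralB//; last first.
  - exact: integrable_cos_affine.
  - exact: (bounded_integrable P (cst 1) `|1|).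
  rewrite H cos0 mul1r Rintegral_cst//= (_ : fine _ = 1) ?mulr1//.
  by rewrite probability_setT.
have intg_cvg : \int[P]_w g n w @[n --> \oo] --> v.
  apply: (cvg_dist_bound _ (fun n => s n ^+ 2 * (v ^+ 2 / 4))).
    apply: nearW => n; rewrite intg.
    have x0 : 0 <= s n ^+ 2 * v / 2 by apply: divr_ge0 => //; apply: mulr_ge0 => //; exact: sqr_ge0.
    have := expRN_taylor _ x0.
    rewrite (_ : - (s n ^+ 2 * v) / 2 = - (s n ^+ 2 * v / 2)) ?mulNr// => h.
    rewrite (_ : _ - v = (expR (- (s n ^+ 2 * v / 2)) - (1 - s n ^+ 2 * v / 2)) * (- (2 / s n ^+ 2))).
      rewrite normrM normrN (ger0_norm (c0 n)).
      apply: le_trans (ler_wpM2r (c0 n) h) _.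
      by rewrite le_eqVlt; apply/orP; left; apply/eqP; field; rewrite gt_eqF.
    by field; rewrite gt_eqF.
  by rewrite -[X in _ --> X](mul0r (v ^+ 2 / 4)); apply: cvgM => //; exact: cvg_cst.
have ig n : P.-integrable setT (EFin \o g n).
  have := integrableZr measurableT (2 / s n ^+ 2) (integrableB measurableT
    (bounded_integrable P (cst 1) `|1| (measurable_cst _) (fun=> lexx _)) (integrable_cos_affine P Y 0 (s n) mY)).
  by [].
(* Integrability is not assumed: Fatou's lemma bounds the second moment by the limit [v] of the
   integrals of [g n]. Only then can [Y^2] serve as a dominating function. *)
have iY2 : P.-integrable setT (EFin \o (fun w => Y w ^+ 2)).
  apply/integrableP; split.
    by apply/measurable_EFinP; exact: measurable_funX.
  apply: (@le_lt_trans _ _ v%:E); last exact: ltry.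
  have F := @fatou _ _ _ P setT measurableT (fun n => EFin \o g n)
    (fun n => (measurable_EFinP _ _).2 (mg n)) (fun n w _ => g0 n w).
  apply: (@le_trans _ _ (\int[P]_x limn_einf ((fun n => EFin \o g n)^~ x))%E).
    rewrite le_eqVlt; apply/orP; left; apply/eqP; apply: eq_integral => w _.
    have h : (EFin \o g ^~ w) n @[n --> \oo] --> (Y w ^+ 2)%:E.
      by apply: cvg_EFin; [exact: nearW|exact: gcvg].
    by apply/esym; rewrite /= ger0_norm ?sqr_ge0//; exact: (cvg_limn_einf_sup h).1.
  apply: le_trans F _.
  rewrite (_ : (fun n => _) = fun n => (\int[P]_w g n w)%:E); last first.
    by apply/funext => n; apply/esym/fineK; exact: (integrable_fin_num measurableT (ig n)).
  have h : (\int[P]_w g n w)%:E @[n --> \oo] --> v%:E.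
    by apply: cvg_EFin; [exact: nearW|].
  by rewrite (cvg_limn_einf_sup h).1.
have iY : P.-integrable setT (EFin \o Y).
  apply: (le_integrable measurableT _ _ (integrableD measurableT
    (bounded_integrable P (cst 1) `|1| (measurable_cst _) (fun=> lexx _)) iY2)).
    exact/measurable_EFinP.
  move=> w _; rewrite /= lee_fin [leRHS]ger0_norm ?addr_ge0 ?sqr_ge0//.
  by rewrite -(@real_normK _ (Y w)) ?num_real//; have := sqr_ge0 (`|Y w| - 1); nra.
split=> //.
- have [_ c1] := Rdominated_cvg P setT g _ (fun w => Y w ^+ 2) measurableT mg (fun w _ => gcvg w) iY2
    (fun n w _ => ltac:(by rewrite ger0_norm ?g0 ?gle)).
  exact: (cvg_unique _ c1 intg_cvg).
(* The phase [- pi / 2] turns the cosine into a sine, and the factor [cos (- pi / 2) = 0] in the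
   hypothesis makes all these integrals vanish. *)
- pose h n w := cos (- (pi / 2) + s n * Y w) / s n.
  have hE n w : h n w = sin (s n * Y w) / s n by rewrite /h addrC cosBpihalf.
  have c2 : \int[P]_w h n w @[n --> \oo] --> \int[P]_w Y w.
    apply: (Rdominated_cvg P setT h _ (fun w => `|Y w|) measurableT _ _ _ _).2.
    + move=> n; apply: measurable_funM => //.
      by have /integrableP[/measurable_EFinP] := integrable_cos_affine P Y (- (pi / 2)) (s n) mY.
    + move=> w _; apply: (cvg_dist_bound _ (fun n => s n ^+ 2 * (`|Y w| ^+ 3 / 6))).
        apply: nearW => n; rewrite hE; have := sin_taylor (s n * Y w) => hs.
        rewrite (_ : _ - Y w = (sin (s n * Y w) - s n * Y w) / s n); last by field; rewrite gt_eqF.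
        rewrite normrM (@ger0_norm _ (s n)^-1) ?invr_ge0 ?(ltW (s0 n))//.
        rewrite ler_pdivrMr//; apply: le_trans hs _; rewrite normrM (gtr0_norm (s0 n)).
        by rewrite le_eqVlt; apply/orP; left; apply/eqP; field.
      by rewrite -[X in _ --> X](mul0r (`|Y w| ^+ 3 / 6)); apply: cvgM => //; exact: cvg_cst.
    + exact: integrable_norm.
    + move=> n w _; rewrite hE normrM (@ger0_norm _ (s n)^-1) ?invr_ge0 ?(ltW (s0 n))//.
      rewrite ler_pdivrMr//; apply: le_trans (abs_sin_le _) _.
      by rewrite normrM mulrC (gtr0_norm (s0 n)).
  have c3 : \int[P]_w h n w @[n --> \oo] --> (0 : R).
    rewrite (_ : (fun n => _) = cst 0); first exact: cvg_cst.
    apply/funext => n; rewrite RintegralZr//; last exact: integrable_cos_affine.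
    by rewrite H cosN cos_pihalf !mul0r.
  exact: (cvg_unique _ c2 c3).
Qed.

Lemma qformD m (K : 'I_m -> 'I_m -> R) (c d : 'I_m -> R) : (forall i j, K i j = K j i) ->
  qform _ K (fun i => c i + d i) =
    qform _ K c + qform _ K d + 2 * \sum_i \sum_j c i * d j * K i j.
Proof.
move=> symK; have E : \sum_i \sum_j c i * d j * K i j = \sum_i \sum_j d i * c j * K i j.
  rewrite exchange_big/=; apply: eq_bigr => i _; apply: eq_bigr => j _.
  by rewrite symK; ring.
rewrite mulrDl mul1r {2}E -!big_split/=; apply: eq_bigr => i _.
by rewrite -!big_split/=; apply: eq_bigr => j _; ring.
Qed.

Lemma sum_delta m (i : 'I_m) (F : 'I_m -> R) : \sum_j (j == i)%:R * F j = F i.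
Proof.
by rewrite (bigD1 i)//= eqxx mul1r big1 ?addr0// => j /negbTE ->; rewrite mul0r.
Qed.

Lemma qform_delta m (K : 'I_m -> 'I_m -> R) (k l : 'I_m) :
  \sum_i \sum_j (i == k)%:R * (j == l)%:R * K i j = K k l.
Proof.
under eq_bigr => i _.
  under eq_bigr do rewrite -mulrA.
  rewrite -mulr_sumr sum_delta.
  over.
by rewrite sum_delta.
Qed.

(** Every linear combination has the cosine transform of a centred normal variable of variance
    [qform _ K c]; [law_unique_trig] then gives its law and [moments_of_cos] its moments. *)
Lemma gaussian_vector_exists m (K : 'I_m -> 'I_m -> R) : (forall i j, K i j = K j i) ->
  (forall c, 0 <= qform _ K c) ->
  exists (d' : measure_display) (W' : measurableType d') (P' : probability W' R)
    (Y : 'I_m -> {RV P' >-> R}),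
    [/\ forall c phi, \int[P']_w cos (phi + \sum_i c i * Y i w) =
           cos phi * expR (- qform _ K c / 2),
        gaussian_vector P' (fun i => Y i : W' -> R),
        forall i, P'.-integrable setT (EFin \o Y i),
        forall i, ('E_P'[Y i] = 0)%E &
        forall i j, covariance P' (Y i) (Y j) = (K i j)%:E].
Proof.
move=> symK psdK; have [d' [W' [P' [Y YE]]]] := gaussian_vector_cos m K symK psdK.
exists d', W', P', Y.
pose S c w := \sum_i c i * Y i w.
have mS c : measurable_fun setT (S c).
  by apply: measurable_sum => i; exact: measurable_funM.
have Smom c : [/\ P'.-integrable setT (EFin \o (fun w => S c w ^+ 2)),
    \int[P']_w (S c w ^+ 2) = qform _ K c, P'.-integrable setT (EFin \o S c) &
    \int[P']_w S c w = 0].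
  apply: moments_of_cos => // s phi.
  under eq_Rintegral do rewrite /S mulr_sumr.
  under eq_Rintegral do under eq_bigr do rewrite mulrA.
  rewrite YE; congr (_ * expR (- _ / 2)).
  rewrite /qform mulr_sumr; apply: eq_bigr => i _; rewrite mulr_sumr; apply: eq_bigr => j _.
  ring.
have Sdelta i : S (fun j => (j == i)%:R) = Y i.
  by apply/funext => w; rewrite /S sum_delta.
have iY i : P'.-integrable setT (EFin \o Y i).
  by have [_ _] := Smom (fun j => (j == i)%:R); rewrite Sdelta.
have EY i : ('E_P'[Y i] = 0)%E.
  have [_ _ _] := Smom (fun j => (j == i)%:R); rewrite Sdelta => h.
  by rewrite expectationE// h.
split=> // [c|i j].
- have [iS2 ES2 iS ES] := Smom c.
  have Scos s phi : \int[P']_w cos (phi + s * S c w) = cos phi * expR (- (s ^+ 2 * qform _ K c) / 2).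
    under eq_Rintegral do rewrite /S mulr_sumr.
    under eq_Rintegral do under eq_bigr do rewrite mulrA.
    rewrite YE; congr (_ * expR (- _ / 2)).
    rewrite /qform mulr_sumr; apply: eq_bigr => i _; rewrite mulr_sumr; apply: eq_bigr => j _.
    ring.
  pose s := Num.sqrt (qform _ K c); have s0 : 0 <= s by exact: sqrtr_ge0.
  have s2 : s ^+ 2 = qform _ K c by rewrite sqr_sqrtr.
  (* Zero variance is the point mass at 0, obtained by comparison with the constant variable 0. *)
  exists 0, s; split=> // C mC; rewrite /gaussian_law; case: eqVneq => [sE|sN].
    have := law_unique_trig P' P' (S c) (cst 0) (mS c) (measurable_cst _) iS
      (bounded_integrable P' (cst 0) `|0| (measurable_cst _) (fun=> lexx _)).
    move=> /(_ _ _ mC) ->.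
      rewrite diracE; case: (boolP (_ \in _)) => [/set_mem C0|/negP C0].
        by rewrite (_ : _ @^-1` _ = setT) ?probability_setT//; apply/seteqP; split.
      rewrite (_ : _ @^-1` _ = set0) ?measure0//; apply/seteqP; split=> // w /= Cw.
      by apply: C0; exact: mem_set.
    move=> u phi; rewrite Scos -s2 sE expr0n mulr0 oppr0 mul0r expR0 mulr1.
    under eq_Rintegral do rewrite mulr0 addr0.
    by rewrite Rintegral_cst//= (_ : fine _ = 1) ?mulr1// probability_setT.
  pose N := normal_prob (0 : R) s.
  have Ncos u phi : \int[N]_x cos (phi + u * x) = cos phi * expR (- (u ^+ 2 * qform _ K c) / 2).
    by rewrite normal_prob_cos//; congr (_ * expR (_ / 2)); rewrite exprMn s2 mulrC.
  have mid : measurable_fun setT (fun x : measurableTypeR R => x : R) by exact: measurable_id.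
  have [_ _ iN _] := moments_of_cos N (fun x => x) _ mid (psdK c) Ncos.
  apply: (law_unique_trig P' N (S c) (fun x => x) (mS c) mid iS iN _ C mC) => u phi.
  by rewrite Scos Ncos.
- have [i2 Ei2 _ _] := Smom (fun k => (k == i)%:R); rewrite Sdelta in i2 Ei2.
  have [j2 Ej2 _ _] := Smom (fun k => (k == j)%:R); rewrite Sdelta in j2 Ej2.
  have ij : P'.-integrable setT (EFin \o (fun w => Y i w * Y j w)).
    apply: (le_integrable measurableT _ _ (integrableD measurableT i2 j2)).
      by apply/measurable_EFinP; exact: measurable_funM.
    move=> w _; rewrite /= lee_fin [leRHS]ger0_norm ?addr_ge0 ?sqr_ge0// ler_norml.
    by have := sqr_ge0 (Y i w - Y j w); have := sqr_ge0 (Y i w + Y j w); nra.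
  have -> : covariance P' (Y i) (Y j) = (\int[P']_w (Y i w * Y j w))%:E.
    rewrite unlock !EY /= (_ : _ * _ = fun w => Y i w * Y j w) ?expectationE//.
    apply/funext => w.
    by change ((Y i w - 0) * (Y j w - 0) = Y i w * Y j w); rewrite !subr0.
  congr EFin.
  (* Polarization: the second moment of [Y i + Y j], expanded on both sides, isolates the mixed
     moment. *)
  have [_ E2 _ _] := Smom (fun k => (k == i)%:R + (k == j)%:R).
  have SE w : S (fun k => (k == i)%:R + (k == j)%:R) w = Y i w + Y j w.
    by rewrite /S; under eq_bigr do rewrite mulrDl; rewrite big_split/= !sum_delta.
  move: E2; under eq_Rintegral do rewrite SE sqrrD -mulr_natl addrAC.
  rewrite RintegralD//; last 2 first.
    exact: (integrableD measurableT i2 j2).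
    exact: (integrableZl measurableT 2%:R ij).
  rewrite RintegralD// RintegralZl// Ei2 Ej2 qformD//.
  have two0 : 2 != 0 :> R by rewrite pnatr_eq0.
  move=> /addrI /(mulfI two0) ->.
  exact: qform_delta.
Qed.

End GaussianMoments.

(** * Thinning and the independence of the urns *)

Section FiniteValued.
Context {R : realType} {d : measure_display} {W : measurableType d}.
Variable P : probability W R.

Definition pr (A : set W) : R := fine (P A).

Lemma prE A : measurable A -> P A = (pr A)%:E.
Proof. by move=> mA; rewrite /pr fineK// fin_num_measure. Qed.

Lemma pr_ge0 A : 0 <= pr A. Proof. exact: fine_ge0. Qed.

Lemma pr_le1 A : measurable A -> pr A <= 1.
Proof. by move=> mA; rewrite -lee_fin -prE// probability_le1. Qed.

Lemma prT : pr setT = 1. Proof. by rewrite /pr probability_setT. Qed.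

Lemma pr0 : pr set0 = 0. Proof. by rewrite /pr measure0. Qed.

Lemma measurable_finite_valued {F : finType} (f : W -> F) (Q : pred F) :
  (forall x, measurable [set w | f w = x]) -> measurable [set w | Q (f w)].
Proof.
move=> mf; rewrite (_ : [set w | Q (f w)] = \bigcup_(x in [set x | Q x]) [set w | f w = x]).
  by apply: fin_bigcup_measurable => // x _; exact: mf.
by apply/seteqP; split=> [w Qw|w [x Qx /= ->//]]; exists (f w).
Qed.

Lemma pr_partition {F : finType} (f : W -> F) (Q : pred F) (D : set W) :
  (forall x, measurable [set w | f w = x]) -> measurable D ->
  pr (D `&` [set w | Q (f w)]) = \sum_(x | Q x) pr (D `&` [set w | f w = x]).
Proof.
move=> mf mD.
have mDf x : measurable (D `&` [set w | f w = x]) by apply: measurableI => //; exact: mf.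
have -> : D `&` [set w | Q (f w)] = \bigcup_(x in [set x | Q x]) (D `&` [set w | f w = x]).
  apply/seteqP; split=> [w [Dw Qw]|w [x Qx [Dw /= fwx]]]; first by exists (f w).
  by split=> //=; rewrite fwx.
rewrite /pr measure_fin_bigcup//=; last first.
  by move=> x y _ _ [w [[_ /= <-] [_ /= <-]]].
have finQ : finite_set [set x | Q x] by exact: finite_finset.
rewrite fsbig_finite//= -[RHS]big_filter.
rewrite (perm_big (seq.filter Q (index_enum F))); last first.
  apply: uniq_perm; [exact: finmap.fset_uniq|by rewrite filter_uniq// index_enum_uniq|move=> x].
  rewrite mem_filter mem_index_enum andbT in_fset_set//.
  by apply/idP/idP => [/set_mem|Qx]; last exact: mem_set.
elim: (seq.filter Q (index_enum F)) => [|x s IH]; first by rewrite !big_nil.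
rewrite !big_cons fineD ?IH// ?fin_num_measure//.
by apply/sum_fin_numP => y _ _; exact: fin_num_measure.
Qed.

Lemma pr_partitionT {F : finType} (f : W -> F) (Q : pred F) :
  (forall x, measurable [set w | f w = x]) ->
  pr [set w | Q (f w)] = \sum_(x | Q x) pr [set w | f w = x].
Proof.
move=> mf; rewrite -[X in pr X]setTI (pr_partition f Q setT mf measurableT).
by apply: eq_bigr => x _; rewrite setTI.
Qed.

Lemma pr_cvg (A : nat -> set W) : (forall n, measurable (A n)) ->
  (forall n m, (n <= m)%N -> A n `<=` A m) -> pr (A n) @[n --> \oo] --> pr (\bigcup_n A n).
Proof.
move=> mA hA; have mU : measurable (\bigcup_n A n) by exact: bigcup_measurable.
have hA' : {homo A : n m / (n <= m)%N >-> (n <= m)%O}.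
  by move=> n m nm; apply/subsetPset; exact: hA.
have h := @nondecreasing_cvg_mu _ _ _ P A mA mU hA'.
by apply: fine_cvg; rewrite fineK// fin_num_measure.
Qed.

End FiniteValued.

(* Labels are a finite image [lab (X j)] of the urn indices; [c j = Some a] means that
   ball [j] falls in the cell [a], [c j = None] that it falls in no cell. *)
Section Multinomial.
Context {R : realType} {I U : finType}.
Variable pt : U -> R.

Definition ncell (H : nat) (c : nat -> option I) (a : I) : nat :=
  (\sum_(j < H) (c j == Some a))%N.

Definition ncount (H : nat) (c : nat -> option I) (x : nat -> U) (a : I) (u : U) : nat :=
  (\sum_(j < H) ((c j == Some a) && (x j == u)))%N.

Definition multinomial_weight (N : nat) (mu : U -> nat) : R :=
  if N == (\sum_u mu u)%N then N`!%:R * \prod_u (pt u ^+ mu u / (mu u)`!%:R) else 0.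

(** The subtraction is truncated, so a ball of label [u] is really removed only when [mu u > 0]; the
    uses are guarded accordingly. *)
Definition drop_one (mu : U -> nat) (u : U) : U -> nat := fun v => (mu v - (v == u))%N.

Lemma sum_drop_one (mu : U -> nat) u : (0 < mu u)%N ->
  (\sum_v mu v = (\sum_v drop_one mu u v).+1)%N.
Proof.
move=> mu0; rewrite (bigD1 u)//= [in RHS](bigD1 u)//= /drop_one eqxx.
rewrite -addSn subn1 prednK//; congr (_ + _)%N.
by apply: eq_bigr => v /negbTE ->; rewrite subn0.
Qed.

Lemma multinomial_weight0 (mu : U -> nat) : multinomial_weight 0 mu = [forall u, mu u == 0%N]%:R.
Proof.
rewrite /multinomial_weight; case: (boolP [forall u, _]) => [/forallP mu0|].
  rewrite big1 => [|u _]; last exact/eqP.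
  rewrite eqxx fact0 mul1r big1// => u _.
  by rewrite (eqP (mu0 u)) expr0 fact0 divr1.
rewrite negb_forall => /existsP[u muu]; case: eqP => // /esym/eqP.
by rewrite (bigD1 u)//= addn_eq0 (negbTE muu).
Qed.

(* Writing [w mu = prod_u pt u ^ mu u / mu u!], one has [pt u * w (mu - e_u) = mu u * w mu],
   so summing over [u] multiplies [w] by the total number of balls. *)
Lemma multinomial_weightS N (mu : U -> nat) :
  multinomial_weight N.+1 mu = \sum_(u | (0 < mu u)%N) pt u * multinomial_weight N (drop_one mu u).
Proof.
rewrite {1}/multinomial_weight; case: eqP => [E|NE]; last first.
  rewrite big1// => u mu0; rewrite /multinomial_weight ifF ?mulr0//; apply/eqP => E.
  by apply: NE; rewrite (sum_drop_one _ _ mu0) E.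
transitivity (\sum_(u | (0 < mu u)%N) (N`!%:R * (mu u)%:R * \prod_v (pt v ^+ mu v / (mu v)`!%:R))).
  rewrite -mulr_suml -mulr_sumr -natr_sum; congr (_ * _).
  rewrite -natrM factS mulnC E; congr (_ * _)%:R.
  rewrite [LHS](bigID (fun u => 0 < mu u)%N)/= [X in (_ + X)%N]big1 ?addn0// => u.
  by rewrite -eqn0Ngt => /eqP.
apply: eq_bigr => u mu0; rewrite /multinomial_weight ifT; last first.
  by apply/eqP/succn_inj; rewrite E (sum_drop_one _ _ mu0).
rewrite [RHS]mulrCA -mulrA; congr (_ * _).
rewrite (bigD1 u)//= [in RHS](bigD1 u)//= !mulrA; congr (_ * _); last first.
  by apply: eq_bigr => v /negbTE vu; rewrite /drop_one vu subn0.
rewrite /drop_one eqxx subn1; case: (mu u) mu0 => //= k _.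
rewrite factS natrM exprS; field.
by rewrite pnatr_eq0 -lt0n fact_gt0 addrC natr1 pnatr_eq0.
Qed.

End Multinomial.

(** * Independent labels and the multinomial law *)

Section IndependentLabels.
Context {R : realType} {d : measure_display} {W : measurableType d}.
Variables (P : probability W R) (I U : finType) (pt : U -> R).
Variables (L : nat -> W -> U).
Hypothesis mL : forall j u, measurable [set w | L j w = u].
Hypothesis joint : forall H (x : nat -> U),
  pr P [set w | forall j, (j < H)%N -> L j w = x j] = \prod_(j < H) pt (x j).

Lemma measurable_prefix H (x : nat -> U) :
  measurable [set w | forall j, (j < H)%N -> L j w = x j].
Proof.
rewrite (_ : [set _ | _] = \bigcap_(j in `I_H) [set w | L j w = x j]) //.
by apply: fin_bigcap_measurable => // j _; exact: mL.
Qed.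

(** An event on the first [H] labels is a finite disjoint union of prefixes, and on each prefix
    [joint] splits off the factor of ball [H]. *)
Lemma joint_last H (Q : {ffun 'I_H -> U} -> bool) u :
  pr P [set w | Q [ffun j : 'I_H => L j w] /\ L H w = u] =
  pt u * pr P [set w | Q [ffun j : 'I_H => L j w]].
Proof.
pose f w := [ffun j : 'I_H => L j w].
have fE (x : {ffun 'I_H -> U}) (x0 : U) : [set w | f w = x] =
    [set w | forall j, (j < H)%N -> L j w = nth x0 [seq x i | i <- enum 'I_H] j].
  apply/seteqP; split=> w /=.
    move=> <- j jH; rewrite (nth_map (Ordinal jH)) ?size_enum_ord//.
    by rewrite /f ffunE nth_enum_ord.
  move=> h; apply/ffunP => j; rewrite /f ffunE h//.
  by rewrite (nth_map j) ?size_enum_ord// nth_ord_enum.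
have mf x : measurable [set w | f w = x] by rewrite (fE x u); exact: measurable_prefix.
rewrite (_ : [set w | _ /\ _] = [set w | L H w = u] `&` [set w | Q (f w)]); last first.
  by apply/seteqP; split=> w [].
rewrite (pr_partition P f Q)// (pr_partitionT P f Q)// mulr_sumr; apply: eq_bigr => x _.
(* The default value of [nth] is taken to be [u], so the sequence read at position [H] supplies the
   label of the last ball. *)
have -> : [set w | L H w = u] `&` [set w | f w = x] =
    [set w | forall j, (j < H.+1)%N -> L j w = nth u [seq x i | i <- enum 'I_H] j].
  rewrite (fE x u); apply/seteqP; split=> w /=.
    move=> [LH h] j; rewrite ltnS leq_eqVlt => /predU1P[->|]; last exact: h.
    by rewrite nth_default// size_map size_enum_ord.
  move=> h; split; last by move=> j jH; apply: h; exact: ltnW.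
  by rewrite h// nth_default// size_map size_enum_ord.
rewrite joint (fE x u) joint big_ord_recr/= mulrC; congr (_ * _).
by rewrite nth_default// size_map size_enum_ord.
Qed.

Lemma ncount_prefix H (c : nat -> option I) (x y : nat -> U) :
  (forall j, (j < H)%N -> x j = y j) -> ncount H c x = ncount H c y.
Proof.
move=> xy; apply/funext => a; apply/funext => u; apply: eq_bigr => j _.
by rewrite xy.
Qed.

(** For a fixed assignment of balls to cells, the labels in distinct cells are independent and
    multinomial. If the last ball lies in cell [b] and has label [u], the first [H] balls must
    realise [nu] with one [u] removed from [b]; [multinomial_weightS] sums over [u]. *)
Lemma pr_ncount H (c : nat -> option I) (nu : I -> U -> nat) :
  pr P [set w | forall a u, ncount H c (L^~ w) a u = nu a u] =
  \prod_a multinomial_weight pt (ncell H c a) (nu a).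
Proof.
elim: H nu => [|H IH] nu.
  under eq_bigr do rewrite /ncell big_ord0 multinomial_weight0.
  case: (boolP [forall a, forall u, nu a u == 0%N]) => [/forallP nu0|nu0].
    rewrite big1 => [|a _]; last by rewrite nu0.
    rewrite (_ : [set w | _] = setT) ?prT//; apply/seteqP; split=> // w _ a u /=.
    by rewrite /ncount big_ord0; have /forallP/(_ u)/eqP := nu0 a.
  move: nu0; rewrite negb_forall => /existsP[a nua].
  rewrite (bigD1 a)//= (negbTE nua) mul0r.
  rewrite (_ : [set w | _] = set0) ?pr0//; apply/seteqP; split=> // w /= h.
  by case/negP: nua; apply/forallP => u; rewrite -h /ncount big_ord0.
case cH : (c H) => [b|]; last first.
  rewrite (_ : [set w | _] = [set w | forall a u, ncount H c (L^~ w) a u = nu a u]).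
    rewrite IH; apply: eq_bigr => a _; congr multinomial_weight.
    by rewrite /ncell big_ord_recr/= cH addn0.
  apply/seteqP; split=> w h a u; have := h a u;
    by rewrite /ncount big_ord_recr/= cH addn0.
pose nu' u a := if a == b then drop_one (nu a) u else nu a.
pose f w := [ffun j : 'I_H => L j w].
pose ext (x : {ffun 'I_H -> U}) (u : U) j := if insub j is Some i then x i else u.
pose Q u (x : {ffun 'I_H -> U}) :=
  [forall a, forall v, ncount H c (ext x u) a v == nu' u a v].
have extE w u : ncount H c (ext (f w) u) = ncount H c (L^~ w).
  by apply: ncount_prefix => j jH; rewrite /ext insubT /f ffunE.
have QE u : [set w | Q u (f w)] = [set w | forall a v, ncount H c (L^~ w) a v = nu' u a v].
  apply/seteqP; split=> w /=; rewrite /Q extE.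
    by move=> /forallP h a v; have /forallP/(_ v)/eqP := h a.
  by move=> h; apply/forallP => a; apply/forallP => v; rewrite h.
have step w a v : ncount H.+1 c (L^~ w) a v =
    (ncount H c (L^~ w) a v + ((a == b) && (v == L H w)))%N.
  rewrite /ncount big_ord_recr/= cH; congr (_ + nat_of_bool (_ && _))%N.
    by rewrite (inj_eq Some_inj) eq_sym.
  by rewrite eq_sym.
(* Without the guard, truncated subtraction would treat [nu b u = 0] as attainable with a last ball
   of label [u]. *)
pose Q' u (x : {ffun 'I_H -> U}) := (0 < nu b u)%N && Q u x.
rewrite (_ : [set w | _] = [set w | (fun u => Q' u (f w) : bool) (L H w)]); last first.
  apply/seteqP; split=> w /=.
    move=> h; have hb := h b (L H w); rewrite step !eqxx addn1 in hb.
    apply/andP; split; first by rewrite -hb.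
    have : [set w | Q (L H w) (f w)] w; last by [].
    rewrite /= -/(is_true _); have -> : (is_true (Q (L H w) (f w))) = [set w' | Q (L H w) (f w')] w by [].
    rewrite QE /= => a v; rewrite /nu'; have := h a v; rewrite step /drop_one.
    by case: (a == b) => /= <-; rewrite ?addn0// addnK.
  move=> /andP[nb hQ] a v.
  have : [set w' | Q (L H w) (f w')] w by [].
  rewrite QE /= => /(_ a v); rewrite step => ->; rewrite /nu'.
  case: eqP => [->|_]; last by rewrite addn0.
  by rewrite /drop_one andTb; case: eqP => [->|_]; rewrite ?subn0 ?addn0// subnK.
have mfx x : measurable [set w | f w = x].
  have [v0 _|U0] := pickP (@predT U).
    rewrite (_ : [set w | _] = [set w | forall j, (j < H)%N -> L j w = ext x v0 j]).
      exact: measurable_prefix.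
    apply/seteqP; split=> w /=.
      by move=> <- j jH; rewrite /ext insubT /f ffunE.
    by move=> h; apply/ffunP => j; rewrite /f ffunE h// /ext valK.
  rewrite (_ : [set w | _] = set0) //; apply/seteqP; split=> // w _.
  by have := U0 (L 0%N w).
transitivity (\sum_u pr P [set w | Q' u (f w) /\ L H w = u]).
  have := pr_partition P (L H) predT [set w | Q' (L H w) (f w)] (mL H).
  rewrite (_ : _ `&` _ = [set w | Q' (L H w) (f w)]); last by apply/seteqP; split=> // w [].
  move=> ->; last first.
    rewrite (_ : [set w | _] = \bigcup_(u in [set: U]) ([set w | Q' u (f w)] `&` [set w | L H w = u])).
      apply: fin_bigcup_measurable => // u _; apply: measurableI => //.
      exact: (measurable_finite_valued f (Q' u)).
    by apply/seteqP; split=> [w h|w [u _ [h /= Lw]]]; [exists (L H w)|rewrite /= Lw].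
  apply: eq_bigr => u _; congr pr.
  by apply/seteqP; split=> w [/= h1 h2]; split=> //; rewrite ?h2// -?h2//; move: h1; rewrite h2.
transitivity (\sum_u pt u * pr P [set w | Q' u (f w)]).
  by apply: eq_bigr => u _; exact: (joint_last H (Q' u) u).
rewrite (bigID (fun u => 0 < nu b u)%N)/= [X in _ + X]big1 ?addr0; last first.
  move=> u /negbTE nu0; rewrite (_ : [set w | _] = set0) ?pr0 ?mulr0//.
  by apply/seteqP; split=> // w /=; rewrite /Q' nu0.
transitivity (\sum_(u | (0 < nu b u)%N) pt u * \prod_a multinomial_weight pt (ncell H c a) (nu' u a)).
  apply: eq_bigr => u nu0; congr (_ * _); rewrite -IH -QE; congr pr.
  by apply/seteqP; split=> w; rewrite /= /Q' nu0.
rewrite (bigD1 b)//= (_ : ncell H.+1 c b = (ncell H c b).+1); last first.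
  by rewrite /ncell big_ord_recr/= cH eqxx addn1.
rewrite [X in _ = X * _]multinomial_weightS. rewrite mulr_suml; apply: eq_bigr => u nu0.
rewrite (bigD1 b)//= {1}/nu' eqxx mulrA; congr (_ * _).
apply: eq_bigr => a ab; rewrite /nu' (negbTE ab); congr multinomial_weight.
by rewrite /ncell big_ord_recr/= cH (inj_eq Some_inj) eq_sym (negbTE ab) addn0.
Qed.

End IndependentLabels.

(** * Counting measure on sets of ball indices *)

Section CountingNat.
Context {R : realType}.
Implicit Types S : set nat.

Lemma counting_lt S H : (forall j, S j -> (j < H)%N) ->
  counting S = ((\sum_(j < H) `[< S j >])%N%:R%:E : \bar R).
Proof.
move=> SH; rewrite counting_dirac (@nneseries_split _ _ 0 H)//=.
rewrite [X in (_ + X)%E]eseries0 ?adde0.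
  rewrite add0n big_mkord natr_sum -sumEFin; apply: eq_bigr => j _.
  by rewrite diracE; congr (_%:R%:E)%E.
move=> i Hi _; rewrite diracE memNset// => Si.
by have := SH _ Si; rewrite ltnNge; rewrite add0n in Hi; rewrite Hi.
Qed.

Lemma counting_natE S n : counting S = (n%:R%:E : \bar R) ->
  exists H, forall j, S j -> (j < H)%N.
Proof.
rewrite /counting; case: asboolP => // finS _.
exists (\max_(j <- finmap.enum_fset (fset_set S)) j).+1 => j Sj.
by rewrite ltnS (@leq_bigmax_seq _ _ xpredT id)// in_fset_set// mem_set.
Qed.

Lemma measurable_counting {d} {W : measurableType d} (A : nat -> set W) :
  (forall j, measurable (A j)) ->
  measurable_fun setT (fun w => counting [set j | A j w] : \bar R).
Proof.
move=> mA; rewrite (_ : (fun w => _) = (fun w => \sum_(j <oo) (\1_(A j) w)%:E)%E).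
  apply: ge0_emeasurable_sum => [j w _ _|j _]; first by rewrite lee_fin.
  by apply/measurable_EFinP; exact: measurable_indic.
apply/funext => w; rewrite counting_dirac; apply: eq_eseriesr => j _.
by rewrite diracE indicE; congr (_%:R%:E)%E; apply/idP/idP => /set_mem/mem_set.
Qed.

End CountingNat.

(** * Thinning a point sequence by independent labels *)

Section Thinning.
Context {R : realType} {d : measure_display} {W : measurableType d}.
Variables (P : probability W R) (I U : finType) (pt : U -> R).
Variables (X : nat -> W -> nat) (T : nat -> W -> R) (lab : nat -> U) (B : I -> set R).
Hypothesis mX : forall j, measurable_fun setT (X j).
Hypothesis mT : forall j, measurable_fun setT (T j).
Hypothesis TX : independent_families P T X.
Let L j w := lab (X j w).
Hypothesis joint : forall H (x : nat -> U),
  pr P [set w | forall j, (j < H)%N -> L j w = x j] = \prod_(j < H) pt (x j).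
Hypothesis mB : forall a, measurable (B a).
Hypothesis tB : trivIset setT B.

Definition cell (tau : R) : option I := [pick a | `[< B a tau >]].

Lemma cellP tau a : (cell tau == Some a) = `[< B a tau >].
Proof.
rewrite /cell; case: pickP => [b /asboolP Bb|noB]; last by rewrite noB.
apply/eqP/asboolP => [[<-//]|Ba]; congr Some.
by apply: tB => //; exists tau.
Qed.

Lemma cellN tau : cell tau = None <-> forall a, ~ B a tau.
Proof.
split=> [h a Ba|h]; first by have /asboolP := Ba; rewrite -cellP h.
by rewrite /cell; case: pickP => // a /asboolP /h.
Qed.

Lemma measurable_cell o : measurable [set tau | cell tau = o].
Proof.
case: o => [a|].
  rewrite (_ : [set _ | _] = B a) //; apply/seteqP; split=> tau /=.
    by move/eqP; rewrite cellP => /asboolP.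
  by move=> Ba; apply/eqP; rewrite cellP; exact/asboolP.
rewrite (_ : [set _ | _] = ~` \bigcup_a B a).
  by apply: measurableC; apply: fin_bigcup_measurable.
apply/seteqP; split=> tau /=; first by move/cellN => h [a _]; exact: h.
by move=> h; apply/cellN => a Ba; apply: h; exists a.
Qed.

Definition lcount (u : U) (a : I) (w : W) : \bar R :=
  counting [set j | B a (T j w) /\ L j w = u].

Lemma measurable_label j u : measurable [set w | L j w = u].
Proof. by apply: (preimage_measurable (X j) [set x | lab x = u]). Qed.

Lemma measurable_lcount u a : measurable_fun setT (lcount u a).
Proof.
apply: measurable_counting => j; apply: measurableI; last exact: measurable_label.
exact: preimage_measurable.
Qed.

Lemma measurable_PiB (A : set R) : measurable A -> measurable_fun setT (PiB T A : W -> \bar R).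
Proof. by move=> mA; apply: measurable_counting => j; exact: preimage_measurable. Qed.

(** On this event only the first [H] balls matter, so all cell counts become finite sums. The events
    increase with [H] and exhaust every event that prescribes finite counts in all cells. *)
Definition empty_from H := [set w | forall j, (H <= j)%N -> cell (T j w) = None].

Lemma empty_from_le H H' : (H <= H')%N -> empty_from H `<=` empty_from H'.
Proof. by move=> HH w h j H'j; apply: h; exact: leq_trans H'j. Qed.

Lemma lcount_empty_from H u a w : empty_from H w ->
  lcount u a w = (ncount H (fun j => cell (T j w)) (L^~ w) a u)%:R%:E.
Proof.
move=> h; rewrite /lcount (counting_lt _ H).
  congr (_%:R%:E); apply: eq_bigr => j _; rewrite cellP; congr nat_of_bool.
  by apply/asboolP/andP => [[/asboolP ? /eqP ?]|[/asboolP ? /eqP ?]].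
by move=> j [Ba _]; rewrite ltnNge; apply/negP => /h /cellN /(_ a).
Qed.

Lemma PiB_empty_from H a w : empty_from H w ->
  PiB T (B a) w = (ncell H (fun j => cell (T j w)) a)%:R%:E.
Proof.
move=> h; rewrite /PiB (counting_lt _ H).
  by congr (_%:R%:E); apply: eq_bigr => j _; rewrite cellP.
by move=> j Ba; rewrite ltnNge; apply/negP => /h /cellN /(_ a).
Qed.

Definition lcount_event (nu : I -> U -> nat) :=
  [set w | forall a u, lcount u a w = (nu a u)%:R%:E].

Definition PiB_event (M : I -> nat) := [set w | forall a, PiB T (B a) w = (M a)%:R%:E].

Lemma empty_from_cover (J : finType) (K : J -> set nat) w :
  (forall i, exists H, forall j, K i j -> (j < H)%N) ->
  (forall j a, B a (T j w) -> exists i, K i j) -> exists H, empty_from H w.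
Proof.
move=> /choice[h hP] cov; exists (\max_i h i)%N => j Hj.
apply/cellN => a Ba; have [i Kij] := cov j a Ba.
have := hP i j Kij; rewrite ltnNge => /negP; apply.
by apply: leq_trans Hj; exact: leq_bigmax.
Qed.

Lemma lcount_event_cover nu w : lcount_event nu w -> exists H, empty_from H w.
Proof.
move=> h; apply: (empty_from_cover (I * U)%type
  (fun i => [set j | B i.1 (T j w) /\ L j w = i.2])).
  by move=> [a u]; apply: counting_natE (h a u).
by move=> j a Ba; exists (a, L j w).
Qed.

Lemma PiB_event_cover M w : PiB_event M w -> exists H, empty_from H w.
Proof.
move=> h; apply: (empty_from_cover I (fun a => [set j | B a (T j w)])).
  by move=> a; apply: counting_natE (h a).
by move=> j a Ba; exists a.
Qed.

Lemma measurable_ereal_event {J : finType} (f : J -> W -> \bar R) (v : J -> \bar R) :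
  (forall i, measurable_fun setT (f i)) -> measurable [set w | forall i, f i w = v i].
Proof.
move=> mf; rewrite (_ : [set _ | _] = \bigcap_(i in [set: J]) (f i @^-1` [set v i])).
  apply: fin_bigcap_measurable => // i _.
  by apply: preimage_measurable => //; exact: emeasurable_set1.
by apply/seteqP; split=> w h i; [move=> _; exact: h|exact: h].
Qed.

Lemma measurable_lcount_event nu : measurable (lcount_event nu).
Proof.
have := measurable_ereal_event (fun i : I * U => lcount i.2 i.1) (fun i => (nu i.1 i.2)%:R%:E)
  (fun i => measurable_lcount i.2 i.1).
congr measurable; apply/seteqP; split=> w h; last by move=> [a u]; exact: h.
by move=> a u; exact: (h (a, u)).
Qed.

Lemma measurable_PiB_event M : measurable (PiB_event M).
Proof. by apply: measurable_ereal_event => a; exact: measurable_PiB. Qed.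

Lemma sigma_family_preimage {d'} {V : measurableType d'} (Z : nat -> W -> V) j (C : set V) :
  measurable C -> sigma_family Z (Z j @^-1` C).
Proof.
move=> mC; apply: sub_sigma_algebra; exists j => //; exists C => //.
by rewrite setTI.
Qed.

(** The second component expresses the event through [T] alone, the form in which
    [independent_families] can be applied; [measurable_cells] does the same, and [measurable_ncount]
    does it for [X]. *)
Lemma measurable_empty_from H : measurable (empty_from H) /\ sigma_family T (empty_from H).
Proof.
have -> : empty_from H = \bigcap_(j in [set j | (H <= j)%N]) (T j @^-1` [set tau | cell tau = None]).
  by [].
split; first by apply: bigcap_measurable => [|j _]; [exists H => /=|exact: preimage_measurable (measurable_cell _)].
pose G := \bigcup_i g_sigma_algebra_preimage (T i).
apply: (@bigcap_measurable _ (g_sigma_algebraType G)) => [|j _]; first by exists H => /=.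
exact: (sigma_family_preimage T j _ (measurable_cell _)).
Qed.

Lemma measurable_cells H (c : nat -> option I) :
  measurable [set w | forall j, (j < H)%N -> cell (T j w) = c j] /\
  sigma_family T [set w | forall j, (j < H)%N -> cell (T j w) = c j].
Proof.
have -> : [set w | forall j, (j < H)%N -> cell (T j w) = c j] =
   \bigcap_(j in `I_H) (T j @^-1` [set tau | cell tau = c j]) by [].
split; first by apply: fin_bigcap_measurable => // j _; exact: preimage_measurable (measurable_cell _).
pose G := \bigcup_i g_sigma_algebra_preimage (T i).
apply: (@fin_bigcap_measurable _ (g_sigma_algebraType G)) => // j _.
exact: (sigma_family_preimage T j _ (measurable_cell _)).
Qed.

Lemma measurable_ncount H c (nu : I -> U -> nat) :
  measurable [set w | forall a u, ncount H c (L^~ w) a u = nu a u] /\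
  sigma_family X [set w | forall a u, ncount H c (L^~ w) a u = nu a u].
Proof.
pose f w : {ffun 'I_H -> U} := [ffun j : 'I_H => L j w].
pose ext (u : U) (x : {ffun 'I_H -> U}) j := if insub j is Some i then x i else u.
pose Q (x : {ffun 'I_H -> U}) := [forall a, forall u, ncount H c (ext u x) a u == nu a u].
have -> : [set w | forall a u, ncount H c (L^~ w) a u = nu a u] = [set w | Q (f w)].
  have E w u : ncount H c (ext u (f w)) = ncount H c (L^~ w).
    by apply: ncount_prefix => j jH; rewrite /ext insubT /f ffunE.
  apply/seteqP; split=> w /=.
    by move=> h; apply/forallP => a; apply/forallP => u; rewrite E h.
  by move=> /forallP h a u; have /forallP/(_ u)/eqP := h a; rewrite E.
have fx x : [set w | f w = x] = \bigcap_(j in [set: 'I_H]) (X j @^-1` [set y | lab y = x j]).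
  apply/seteqP; split=> w /=; first by move=> <- j _; rewrite /f ffunE.
  by move=> h; apply/ffunP => j; rewrite /f ffunE; exact: h.
split.
  apply: measurable_finite_valued => x; rewrite fx.
  by apply: fin_bigcap_measurable => // j _; exact: preimage_measurable.
pose G := \bigcup_i g_sigma_algebra_preimage (X i).
apply: (@measurable_finite_valued _ (g_sigma_algebraType G)) => x; rewrite fx.
apply: (@fin_bigcap_measurable _ (g_sigma_algebraType G)) => // j _.
exact: (sigma_family_preimage X j).
Qed.

(* On [empty_from H] only the first [H] balls matter; given their cells, their labels are
   multinomial by independence of [T] and [X]. *)
Lemma pr_lcount_empty_from H nu :
  pr P (empty_from H `&` lcount_event nu) =
  pr P (empty_from H `&` PiB_event (fun a => \sum_u nu a u)%N) *
  \prod_a ((\sum_u nu a u)`!%:R * \prod_u (pt u ^+ nu a u / (nu a u)`!%:R)).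
Proof.
pose f w : {ffun 'I_H -> option I} := [ffun j : 'I_H => cell (T j w)].
pose ext (x : {ffun 'I_H -> option I}) j := if insub j is Some i then x i else None.
have fx x : [set w | f w = x] = [set w | forall j, (j < H)%N -> cell (T j w) = ext x j].
  apply/seteqP; split=> w /=.
    by move=> <- j jH; rewrite /ext insubT /f ffunE.
  by move=> h; apply/ffunP => j; rewrite /f ffunE h// /ext valK.
have mf x : measurable [set w | f w = x] by rewrite fx; exact: (measurable_cells _ _).1.
have [mD sD] := measurable_empty_from H.
have Ef x w : f w = x -> forall j, (j < H)%N -> cell (T j w) = ext x j.
  by move=> h; have : [set w | f w = x] w by []; rewrite fx.
have Enc x w : f w = x -> (ncell H (fun j => cell (T j w)) : I -> nat) = ncell H (ext x).
  by move=> /Ef h; apply/funext => a; apply: eq_bigr => j _; rewrite h.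
have Enu x w : f w = x -> (ncount H (fun j => cell (T j w)) : (nat -> U) -> I -> U -> nat) = ncount H (ext x).
  move=> /Ef h; apply/funext => y; apply/funext => a; apply/funext => u.
  by apply: eq_bigr => j _; rewrite h.
have E1 x : empty_from H `&` lcount_event nu `&` [set w | f w = x] =
    (empty_from H `&` [set w | f w = x]) `&`
    [set w | forall a u, ncount H (ext x) (L^~ w) a u = nu a u].
  apply/seteqP; split=> w [] [Dw h1 h2]; split=> //.
    move=> a u; have := h1 a u; rewrite (lcount_empty_from H)// (Enu _ _ h2).
    by move=> [/eqP]; rewrite eqr_nat => /eqP.
  by split=> // a u; rewrite (lcount_empty_from H)// (Enu _ _ h1) h2.
have E2 x : empty_from H `&` PiB_event (fun a => \sum_u nu a u)%N `&` [set w | f w = x] =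
    if [forall a, ncell H (ext x) a == \sum_u nu a u]%N then empty_from H `&` [set w | f w = x]
    else set0.
  case: ifPn => [/forallP h|/forallPn[a /eqP h]]; apply/seteqP; split=> w //.
  - by move=> [[]].
  - move=> [Dw fw]; do 2 split=> //; move=> a; rewrite (PiB_empty_from H)// (Enc _ _ fw).
    by rewrite (eqP (h a)).
  - move=> [[Dw /(_ a)]]; rewrite (PiB_empty_from H)// => + fw; rewrite (Enc _ _ fw).
    by move=> [/eqP]; rewrite eqr_nat => /eqP.
have mG := measurable_lcount_event nu.
have mN := measurable_PiB_event (fun a => \sum_u nu a u)%N.
have := pr_partition P f predT _ mf (measurableI _ _ mD mG).
rewrite (_ : [set w | predT (f w)] = setT) ?setIT; last by apply/seteqP.
move=> ->.
have := pr_partition P f predT _ mf (measurableI _ _ mD mN).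
rewrite (_ : [set w | predT (f w)] = setT) ?setIT; last by apply/seteqP.
move=> ->; rewrite mulr_suml; apply: eq_bigr => x _.
rewrite E1 E2.
have [mC sC] := measurable_ncount H (ext x) nu.
have sF : sigma_family T (empty_from H `&` [set w | f w = x]).
  pose G := \bigcup_i g_sigma_algebra_preimage (T i).
  apply: (@measurableI _ (g_sigma_algebraType G)) => //.
  by rewrite fx; exact: (measurable_cells _ _).2.
(* Independence of arrival times and labels: with the cells frozen to [ext x], the count condition
   concerns the labels only. *)
have -> : pr P (empty_from H `&` [set w | f w = x] `&`
    [set w | forall a u, ncount H (ext x) (L^~ w) a u = nu a u]) =
    pr P (empty_from H `&` [set w | f w = x]) * \prod_a multinomial_weight pt (ncell H (ext x) a) (nu a).
  rewrite -(pr_ncount P I U pt L measurable_label joint).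
  rewrite {1}/pr TX// fineM// fin_num_measure//.
  by apply: measurableI => //; exact: mf.
case: ifPn => [/forallP h|/forallPn[a /negbTE h]]; last first.
  by rewrite (bigD1 a)//= {1}/multinomial_weight h pr0 !mul0r mulr0.
by congr (_ * _); apply: eq_bigr => a _; rewrite /multinomial_weight (eqP (h a)) eqxx.
Qed.

(** Limit [H --> oo] of [pr_lcount_empty_from], whose multinomial factor does not depend on [H]. *)
Theorem pr_lcount nu :
  pr P (lcount_event nu) =
  pr P (PiB_event (fun a => \sum_u nu a u)%N) *
  \prod_a ((\sum_u nu a u)`!%:R * \prod_u (pt u ^+ nu a u / (nu a u)`!%:R)).
Proof.
have cvgD (E : set W) : measurable E -> (forall w, E w -> exists H, empty_from H w) ->
    pr P (empty_from H `&` E) @[H --> \oo] --> pr P E.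
  move=> mE cov; have mDE H : measurable (empty_from H `&` E).
    by apply: measurableI => //; exact: (measurable_empty_from H).1.
  have := pr_cvg P (fun H => empty_from H `&` E) mDE _.
  rewrite (_ : \bigcup_n _ = E); last first.
    apply/seteqP; split=> [w [H _ []]//|w Ew].
    by have [H DH] := cov w Ew; exists H.
  by apply=> n n' nn w [Dw Ew]; split=> //; exact: empty_from_le nn _ Dw.
have c1 := cvgD _ (measurable_lcount_event nu) (lcount_event_cover nu).
have c2 := cvgD _ (measurable_PiB_event (fun a => \sum_u nu a u)%N)
  (PiB_event_cover (fun a => \sum_u nu a u)%N).
apply: (cvg_unique _ c1) => //.
rewrite (_ : (fun H => pr P (empty_from H `&` lcount_event nu)) = (fun H =>
    pr P (empty_from H `&` PiB_event (fun a => \sum_u nu a u)%N) *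
    \prod_a ((\sum_u nu a u)`!%:R * \prod_u (pt u ^+ nu a u / (nu a u)`!%:R)))).
  by apply: cvgM => //; exact: cvg_cst.
by apply/funext => H; exact: pr_lcount_empty_from.
Qed.

End Thinning.

Lemma cvg_prod {R : realType} {J : finType} (f : J -> nat -> R) (l : J -> R) :
  (forall j, f j n @[n --> \oo] --> l j) ->
  (\prod_j f j n) @[n --> \oo] --> \prod_j l j.
Proof.
move=> fl; elim: (index_enum J) => [|j s IH].
  by under eq_fun do rewrite big_nil; rewrite big_nil; exact: cvg_cst.
under eq_fun do rewrite big_cons; rewrite big_cons.
by apply: cvgM => //; exact: fl.
Qed.

(** * From point probabilities of counts to general events *)

Section CountLimit.
Context {R : realType} {d : measure_display} {W : measurableType d}.
Variables (P : probability W R) (I : finType).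

Definition below (K : nat) (V : set (I -> \bar R)) (x : {ffun I -> 'I_K.+1}) : bool :=
  [forall a, (x a < K)%N] && `[< V (fun a => (x a)%:R%:E) >].

(** The probability that independent counts with weights [q a] are all below [K] and satisfy [V], as
    an explicit finite sum. *)
Definition cell_sum (q : I -> nat -> R) (K : nat) (V : set (I -> \bar R)) : R :=
  \sum_(x : {ffun I -> 'I_K.+1} | below K V x) \prod_a q a (x a).

Lemma cell_sumT q K : cell_sum q K setT = \prod_a \sum_(k < K) q a k.
Proof.
transitivity (\prod_a \sum_(k < K.+1 | (k < K)%N) q a k); last first.
  by apply: eq_bigr => a _; rewrite (big_ord_widen_cond K.+1 xpredT).
rewrite bigA_distr_big_dep; apply: eq_bigl => x; rewrite /below asboolT// andbT.
by apply/forallP/familyP => h a; exact: h.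
Qed.

Section Law.
Variables (U : finType) (C : U -> I -> W -> \bar R) (q : U -> I -> nat -> R).
Hypothesis mC : forall u a, measurable_fun setT (C u a).
Hypothesis law : forall nu : U -> I -> nat,
  pr P [set w | forall u a, C u a w = (nu u a)%:R%:E] = \prod_u \prod_a q u a (nu u a).

Definition counts_below K := [set w | forall u a, exists2 k, (k < K)%N & C u a w = k%:R%:E].

(* The counts are truncated at [K], the value [K] of the truncation standing for all
   counts that are at least [K] or infinite. *)
Lemma count_law_truncated K (V : U -> set (I -> \bar R)) :
  measurable ([set w | forall u, V u (fun a => C u a w)] `&` counts_below K) /\
  pr P ([set w | forall u, V u (fun a => C u a w)] `&` counts_below K) =
  \prod_u cell_sum (q u) K (V u).
Proof.
pose tr w : {ffun U -> {ffun I -> 'I_K.+1}} := [ffun u => [ffun a =>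
  inord (if pselect (exists2 k, (k < K)%N & C u a w = k%:R%:E) is left h
         then sval (cid2 h) else K)]].
have trP w u a k : (k < K)%N -> C u a w = k%:R%:E <-> tr w u a = k :> nat.
  move=> kK; rewrite !ffunE; case: pselect => [h|h].
    case: (cid2 h) => /= j jK Cj; rewrite inordK; last by rewrite ltnS ltnW.
    by rewrite Cj; split=> [[/eqP]|->//]; rewrite eqr_nat => /eqP.
  rewrite inordK//; split=> [Ck|E]; first by exfalso; apply: h; exists k.
  by move: kK; rewrite E ltnn.
have mk u a (k : nat) : measurable [set w | C u a w = k%:R%:E].
  rewrite (_ : [set _ | _] = C u a @^-1` [set k%:R%:E]) //.
  by apply: preimage_measurable => //; exact: emeasurable_set1.
have mK u a (k : 'I_K.+1) : measurable [set w | tr w u a = k].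
  case: (ltnP k K) => [kK|Kk].
    rewrite (_ : [set _ | _] = [set w | C u a w = k%:R%:E]) //.
    by apply/seteqP; split=> w /=; [move=> h; apply/trP => //; rewrite h|
      move=> /(trP _ _ _ _ kK) h; exact/val_inj].
  rewrite (_ : [set _ | _] = ~` \bigcup_(j in `I_K) [set w | C u a w = j%:R%:E]).
    apply: measurableC; apply: fin_bigcup_measurable => // j _; exact: mk.
  apply/seteqP; split=> w /=.
    by move=> h [j /= jK /(trP _ _ _ _ jK)]; rewrite h => E; move: jK; rewrite -E ltnNge Kk.
  move=> h; apply/val_inj => /=; apply/eqP; rewrite eqn_leq; apply/andP; split.
    by apply: leq_trans Kk; rewrite -ltnS.
  rewrite leqNgt; apply/negP => lt; apply: h; exists (tr w u a : nat) => /=.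
    by apply: (leq_trans lt); rewrite -ltnS.
  by apply/trP => //; apply: (leq_trans lt); rewrite -ltnS.
have mtr x : measurable [set w | tr w = x].
  rewrite (_ : [set _ | _] =
     \bigcap_(u in [set: U]) \bigcap_(a in [set: I]) [set w | tr w u a = x u a]).
    by apply: fin_bigcap_measurable => // u _; apply: fin_bigcap_measurable.
  apply/seteqP; split=> w /=; first by move=> <-.
  by move=> h; apply/ffunP => u; apply/ffunP => a; exact: h.
have -> : [set w | forall u, V u (fun a => C u a w)] `&` counts_below K =
    [set w | [forall u, below K (V u) (tr w u)]].
  have eqV w u : [forall a, (tr w u a < K)%N] ->
      (fun a => C u a w) = (fun a => (tr w u a)%:R%:E).
    by move=> /forallP h; apply/funext => a; apply/trP.
  apply/seteqP; split=> w /=.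
    move=> [Ew Fw]; apply/forallP => u.
    have lt a : (tr w u a < K)%N by have [k kK /(trP _ _ _ _ kK) ->] := Fw u a.
    by rewrite /below -eqV ?asboolT ?andbT//; apply/forallP.
  move=> /forallP h; split=> [u|u a]; first by have /andP[/eqV -> /asboolP] := h u.
  have /andP[/forallP/(_ a) lt _] := h u.
  by exists (tr w u a : nat) => //; apply/trP.
split.
  exact: (measurable_finite_valued tr (fun x => [forall u, below K (V u) (x u)])).
rewrite (pr_partitionT P tr (fun x => [forall u, below K (V u) (x u)])); last exact: mtr.
rewrite bigA_distr_big_dep; apply: eq_big => [x|x /forallP hx].
  by apply/forallP/familyP => h u; exact: h.
rewrite -(law (fun u a => x u a)); congr pr; apply/seteqP; split=> w /=.
  move=> E u a; have /andP[/forallP/(_ a) lt _] := hx u.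
  by apply/(trP _ _ _ _ lt); rewrite E.
move=> h; apply/ffunP => u; apply/ffunP => a; apply/val_inj => /=; apply/trP => //.
by have /andP[/forallP/(_ a)] := hx u.
Qed.

(** The truncation error is at most the probability that some count is infinite or at least [K]. It
    tends to 0 because the weights have total mass 1, so almost sure finiteness of the counts comes
    along. *)
Lemma count_law_limit (V : U -> set (I -> \bar R)) :
  (forall u a, \sum_(k < K) q u a k @[K --> \oo] --> (1 : R)) ->
  measurable [set w | forall u, V u (fun a => C u a w)] ->
  (\prod_u cell_sum (q u) K (V u)) @[K --> \oo] -->
  pr P [set w | forall u, V u (fun a => C u a w)].
Proof.
move=> q1 mE; pose E := [set w | forall u, V u (fun a => C u a w)].
have FT K : counts_below K =
    [set w | forall u : U, [set: I -> \bar R] (fun a => C u a w)] `&` counts_below K.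
  by apply/seteqP; split=> [w ?|w [_ ?]//]; split.
have mF K : measurable (counts_below K).
  by rewrite FT; exact: (count_law_truncated K (fun _ => setT)).1.
have F1 : pr P (counts_below K) @[K --> \oo] --> (1 : R).
  rewrite (_ : (fun K => _) = fun K => \prod_u \prod_a \sum_(k < K) q u a k); last first.
    apply/funext => K; rewrite FT (count_law_truncated K (fun _ => setT)).2.
    by apply: eq_bigr => u _; exact: cell_sumT.
  have h u : \prod_a \sum_(k < K) q u a k @[K --> \oo] --> (1 : R).
    by have := cvg_prod (fun a K => \sum_(k < K) q u a k) (fun _ => 1) (q1 u); rewrite big1_eq.
  by have := cvg_prod (fun u K => \prod_a \sum_(k < K) q u a k) (fun _ => 1) h; rewrite big1_eq.
apply: (cvg_dist_bound _ (fun K => 1 - pr P (counts_below K))).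
  near=> K; rewrite -(count_law_truncated K V).2 -/E.
  have mEF : measurable (E `&` counts_below K) by exact: measurableI.
  have mED : measurable (E `\` counts_below K) by exact: measurableD.
  have : pr P E = pr P (E `&` counts_below K) + pr P (E `\` counts_below K).
    rewrite /pr -fineD ?fin_num_measure// -measureU//.
      by rewrite setUIDK.
    by rewrite -subset0 => w [[_ ?] [_]].
  rewrite -/E => ->; rewrite opprD addrA subrr add0r normrN ger0_norm ?pr_ge0//.
  have : pr P (~` counts_below K) = 1 - pr P (counts_below K).
    by rewrite /pr probability_setC// fineB// fin_num_measure.
  have mFC : measurable (~` counts_below K) by apply: measurableC.
  move=> <-; rewrite /pr fine_le ?fin_num_measure//.
  by apply: le_measure; rewrite ?inE// => w [].
by rewrite -(subrr 1); apply: cvgB => //; exact: cvg_cst.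
Unshelve. all: by end_near.
Qed.

End Law.
End CountLimit.

Definition poi {R : realType} (x : R) (k : nat) : R := expR (- x) * x ^+ k / k`!%:R.

Lemma poi_sum {R : realType} (x : R) : \sum_(k < K) poi x k @[K --> \oo] --> (1 : R).
Proof.
have -> : 1 = expR (- x) * expR x by rewrite -expRD addNr expR0.
rewrite (_ : (fun K => _) = (fun K => expR (- x) * series (exp_coeff x) K)).
  apply: cvgM; first exact: cvg_cst.
  exact: is_cvg_series_exp_coeff.
apply/funext => K; rewrite /series/= big_mkord mulr_sumr; apply: eq_bigr => k _.
by rewrite /poi /exp_coeff/= mulrA.
Qed.

(** A Poisson number of balls with multinomial labels amounts to independent Poisson numbers: the
    factorial of the total cancels, and [exp (- x)] factors because [pt] sums to 1. *)
Lemma poi_thin {R : realType} {U : finType} (pt : U -> R) (x : R) (mu : U -> nat) :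
  \sum_u pt u = 1 ->
  poi x (\sum_u mu u)%N * ((\sum_u mu u)`!%:R * \prod_u (pt u ^+ mu u / (mu u)`!%:R)) =
  \prod_u poi (x * pt u) (mu u).
Proof.
move=> pt1; rewrite /poi.
have -> : \prod_u (expR (- (x * pt u)) * (x * pt u) ^+ mu u / (mu u)`!%:R) =
   (\prod_u expR (- (x * pt u))) * (\prod_u x ^+ mu u) * \prod_u (pt u ^+ mu u / (mu u)`!%:R).
  by rewrite -!big_split/=; apply: eq_bigr => u _; rewrite exprMn !mulrA.
have -> : \prod_u expR (- (x * pt u)) = expR (- x).
  rewrite -expR_sum; congr expR; rewrite sumrN -mulr_sumr pt1 mulr1 //.
rewrite -expr_sum mulrA; congr (_ * _).
by rewrite divfK// pnatr_eq0 -lt0n fact_gt0.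
Qed.

(** * Dilations and Lebesgue measure *)

Section Dilation.
Context {R : realType}.
Implicit Types (s t : R) (A : set R).

Lemma dilateP t A x : 0 < t -> dilate t A x <-> A (x / t).
Proof.
move=> t0; split=> [[a Aa <-]|Ax]; first by rewrite mulrC mulKf// gt_eqF.
by exists (x / t) => //; rewrite mulrC divfK// gt_eqF.
Qed.

Lemma dilate_preimage t A : 0 < t -> dilate t A = (fun x => x / t) @^-1` A.
Proof. by move=> t0; apply/seteqP; split=> x /(dilateP _ _ _ t0). Qed.

Lemma dilate_dilate s t A : dilate s (dilate t A) = dilate (s * t) A.
Proof.
apply/seteqP; split=> x; first by move=> [_ [a Aa <-] <-]; exists a => //; rewrite mulrA.
by move=> [a Aa <-]; exists (t * a); [exists a|rewrite mulrA].
Qed.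

Lemma measurable_dilate t A : 0 < t -> measurable A -> measurable (dilate t A).
Proof.
move=> t0 mA; rewrite dilate_preimage//.
by apply: preimage_measurable => //; exact: measurable_funM.
Qed.

Lemma dilate_ge0 t A : 0 < t -> A `<=` `[0, +oo[ -> dilate t A `<=` `[0, +oo[.
Proof.
move=> t0 A0 x /(dilateP _ _ _ t0)/A0; rewrite /= !in_itv/= !andbT.
by rewrite pmulr_lge0// invr_gt0.
Qed.

(** The pushforward under [x / t], scaled by [1 / t], gives half-open intervals their length, so
    uniqueness identifies it with Lebesgue measure. *)
Lemma lebesgue_measure_dilate t A : 0 < t -> measurable A ->
  lebesgue_measure (dilate t A) = (t%:E * lebesgue_measure A)%E.
Proof.
move=> t0 mA; pose f : measurableTypeR R -> measurableTypeR R := fun x => x / t.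
have mf : measurable_fun [set: measurableTypeR R] f by exact: measurable_funM.
have it0 : 0 <= t^-1 by rewrite invr_ge0 ltW.
have -> : lebesgue_measure A = (t^-1%:E * lebesgue_measure (f @^-1` A))%E.
  pose pf : {measure set (measurableTypeR R) -> \bar R} :=
    measure_function_pushforward__canonical__measure_function_Measure lebesgue_measure mf.
  transitivity (mscale (NngNum it0) pf A); last by [].
  refine (@lebesgue_measure_unique R (mscale (NngNum it0) pf) _ A mA).
  move=> _ [[a b]] _ <-.
  change (lebesgue_measure `]a, b] = (t^-1%:E * lebesgue_measure (f @^-1` `]a, b]))%E).
  rewrite (_ : f @^-1` `]a, b]%classic = `]t * a, t * b]%classic).
    rewrite !lebesgue_measure_itv/= !lte_fin ltr_pM2l//; case: ifP => _; last by rewrite mule0.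
    by rewrite -!EFinB -EFinM -mulrBr mulKf// gt_eqF.
  apply/seteqP; split=> x; rewrite /= !in_itv/= ltr_pdivlMr// ler_pdivrMr//;
    by rewrite ![t * _]mulrC.
by rewrite muleA -EFinM divff ?mul1e ?gt_eqF// dilate_preimage.
Qed.

End Dilation.

(** * Thinning of the Poisson process *)

Section PoissonThinning.
Context {R : realType} {d : measure_display} {W : measurableType d}.
Variables (P : probability W R) (T : nat -> W -> R).
Hypothesis mT : forall j, measurable_fun setT (T j).
Hypothesis Tp : unit_poisson_process P T.

Lemma pr_PiB_event (I : finType) (B : I -> set R) (lambda : I -> R) :
  (forall a, measurable (B a)) -> (forall a, B a `<=` `[0, +oo[) -> trivIset setT B ->
  (forall a, lebesgue_measure (B a) = (lambda a)%:E) ->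
  forall M, pr P (PiB_event I T B M) = \prod_a poi (lambda a) (M a).
Proof.
case: Tp => _ law indep mB B0 tB lB M.
pose B' (i : 'I_#|I|) := B (enum_val i).
have tB' : trivIset setT B'.
  by move=> i j _ _ /(tB _ _ Logic.I Logic.I) /enum_val_inj.
have := indep #|I| B' (fun i => mB _) (fun i => B0 _) tB'.
move=> /(_ (enum 'I_#|I|) (fun i => [set (M (enum_val i))%:R%:E]) (enum_uniq _)
  (fun i => emeasurable_set1 _)).
rewrite /pr (_ : \bigcap_(i in _) _ = PiB_event I T B M); last first.
  apply/seteqP; split=> w /= h; last by move=> i _; exact: h.
  by move=> a; have := h (enum_rank a); rewrite /B' enum_rankK; apply; rewrite /= mem_enum.
move=> ->; rewrite (eq_bigr (fun i => (poi (lambda (enum_val i)) (M (enum_val i)))%:E)).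
  rewrite prodEFin/= big_enum/=; rewrite [RHS](reindex (@enum_val I predT))//=.
  exact/onW_bij/enum_val_bij.
move=> i _; rewrite /B'.
have -> : PiB T (B (enum_val i)) @^-1` [set (M (enum_val i))%:R%:E] =
  [set w | PiB T (B (enum_val i)) w = (M (enum_val i))%:R%:E] by [].
by rewrite law// lB//= ltry.
Qed.

Section PointCounts.
Variables (I : finType) (B : I -> set R) (lambda : I -> R).
Hypothesis mB : forall a, measurable (B a).
Hypothesis B0 : forall a, B a `<=` `[0, +oo[.
Hypothesis tB : trivIset setT B.
Hypothesis lB : forall a, lebesgue_measure (B a) = (lambda a)%:E.

(** A single dummy label makes the results on labelled counts apply to unlabelled ones. *)
Let counts (_ : 'I_1) (a : I) : W -> \bar R := PiB T (B a).
Let q (_ : 'I_1) (a : I) := poi (lambda a).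

Let mcounts u a : measurable_fun setT (counts u a).
Proof. exact: measurable_PiB. Qed.

Let law (nu : 'I_1 -> I -> nat) :
  pr P [set w | forall u a, counts u a w = (nu u a)%:R%:E] = \prod_u \prod_a q u a (nu u a).
Proof.
rewrite big_ord1 -(pr_PiB_event I B lambda)//.
by congr pr; apply/seteqP; split=> w h; [exact: (h ord0)|move=> u a; rewrite ord1; exact: h].
Qed.

Let eqV (V : set (I -> \bar R)) : [set w | forall u, V (fun a => counts u a w)] =
  [set w | V (fun a => PiB T (B a) w)].
Proof. by apply/seteqP; split=> w h //; exact: (h ord0). Qed.

(** When [V] itself forces all counts below [K], truncation loses nothing. The exact finite sum of
    products of Poisson weights is what makes such probabilities smooth in the dilation
    parameter. *)
Lemma PiB_law_truncated K (V : set (I -> \bar R)) :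
  (forall w, V (fun a => PiB T (B a) w) ->
    forall a, exists2 k, (k < K)%N & PiB T (B a) w = k%:R%:E) ->
  pr P [set w | V (fun a => PiB T (B a) w)] = cell_sum I (fun a => poi (lambda a)) K V.
Proof.
move=> VK; have := (count_law_truncated P I 'I_1 counts q mcounts law K (fun _ => V)).2.
rewrite big_ord1 => <-; rewrite eqV; congr pr; apply/seteqP; split=> [w Vw|w []//].
by split=> // u a; exact: VK.
Qed.

Lemma PiB_law_limit (V : set (I -> \bar R)) :
  measurable [set w | V (fun a => PiB T (B a) w)] ->
  cell_sum I (fun a => poi (lambda a)) K V @[K --> \oo] -->
  pr P [set w | V (fun a => PiB T (B a) w)].
Proof.
move=> mV; have := count_law_limit P I 'I_1 counts q mcounts law (fun _ => V).
rewrite eqV => /(_ (fun u a => poi_sum (lambda a)) mV).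
by rewrite (_ : (fun K => \prod_(i < 1) _) = fun K => cell_sum I (fun a => poi (lambda a)) K V)//;
  apply/funext => K; rewrite big_ord1.
Qed.

End PointCounts.

Section Labels.
Variables (X : nat -> W -> nat) (I U : finType) (pt : U -> R) (lab : nat -> U) (B : I -> set R).
Hypothesis mX : forall j, measurable_fun setT (X j).
Hypothesis TX : independent_families P T X.
Hypothesis pt0 : forall u, 0 < pt u.
Hypothesis pt1 : \sum_u pt u = 1.
Hypothesis joint : forall H (x : nat -> U),
  pr P [set w | forall j, (j < H)%N -> lab (X j w) = x j] = \prod_(j < H) pt (x j).
Hypothesis mB : forall a, measurable (B a).
Hypothesis B0 : forall a, B a `<=` `[0, +oo[.
Hypothesis tB : trivIset setT B.
Variable lambda : I -> R.
Hypothesis lB : forall a, lebesgue_measure (B a) = (lambda a)%:E.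

(* Each side is the limit, as [K --> oo], of the same product of sums of Poisson weights
   truncated at [K]. *)
Lemma thinned_independence (V : U -> set (I -> \bar R)) :
  measurable [set w | forall u, V u (fun a => lcount I U X T lab B u a w)] ->
  (forall u, measurable [set w | V u (fun a => PiB T (dilate (pt u) (B a)) w)]) ->
  pr P [set w | forall u, V u (fun a => lcount I U X T lab B u a w)] =
  \prod_u pr P [set w | V u (fun a => PiB T (dilate (pt u) (B a)) w)].
Proof.
move=> mE mV; pose q u a := poi (lambda a * pt u).
have q1 u a : \sum_(k < K) q u a k @[K --> \oo] --> (1 : R) by exact: poi_sum.
have c1 : (\prod_u cell_sum I (q u) K (V u)) @[K --> \oo] -->
    pr P [set w | forall u, V u (fun a => lcount I U X T lab B u a w)].
  apply: (count_law_limit P I U (fun u a => lcount I U X T lab B u a)) => //.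
    by move=> u a; exact: measurable_lcount.
  move=> nu; rewrite (_ : [set w | _] = lcount_event I U X T lab B (fun a u => nu u a)).
    rewrite (pr_lcount P I U pt X T lab B)// (pr_PiB_event I B lambda)// -big_split/=.
    rewrite exchange_big/=; apply: eq_bigr => a _.
    by rewrite (poi_thin pt (lambda a) (fun u => nu u a)).
  by apply/seteqP; split=> w h ? ?; exact: h.
apply: (cvg_unique _ c1) => //; apply: cvg_prod => u.
apply: (PiB_law_limit I (fun a => dilate (pt u) (B a)) (fun a => lambda a * pt u)) => //.
- by move=> a; exact: measurable_dilate.
- by move=> a; exact: dilate_ge0.
- move=> a b _ _ [x [/(dilateP _ _ _ (pt0 u)) Ba /(dilateP _ _ _ (pt0 u)) Bb]].
  by apply: tB => //; exists (x / pt u).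
- by move=> a; rewrite lebesgue_measure_dilate// lB mulrC.
Qed.

End Labels.

End PoissonThinning.

Lemma counting_partition {R : realType} {I : finType} (S : I -> set nat) (b : pred I) :
  trivIset setT S ->
  (counting (\bigcup_(a in [set a | b a]) S a) : \bar R) = (\sum_(a | b a) counting (S a))%E.
Proof.
move=> tS; rewrite measure_fin_bigcup//=.
- have finQ : finite_set [set a | b a] by exact: finite_finset.
  rewrite fsbig_finite//= -[RHS]big_filter; apply: perm_big.
  apply: uniq_perm; [exact: finmap.fset_uniq|by rewrite filter_uniq// index_enum_uniq|move=> x].
  rewrite mem_filter mem_index_enum andbT in_fset_set//.
  by apply/idP/idP => [/set_mem|Qx]; last exact: mem_set.
- by apply: sub_trivIset tS.
Qed.

Lemma measurable_thresholds {R : realType} {d} {W : measurableType d} {J : finType}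
    (f : J -> W -> \bar R) (c : J -> \bar R) (Q : pred {ffun J -> bool}) :
  (forall j, measurable_fun setT (f j)) ->
  measurable [set w | Q [ffun j => (c j <= f j w)%E]].
Proof.
move=> mf.
apply: (measurable_finite_valued (fun w => [ffun j => (c j <= f j w)%E]) Q) => x.
rewrite (_ : [set _ | _] = \bigcap_(j in [set: J]) (f j @^-1` [set y | (c j <= y)%E = x j])).
  apply: fin_bigcap_measurable => // j _; apply: preimage_measurable => //.
  have mc : measurable [set y | (c j <= y)%E].
    have -> : [set y | (c j <= y)%E] = `[c j, +oo[%classic.
      by apply/seteqP; split=> y /=; rewrite in_itv/= andbT.
    exact: emeasurable_itv.
  case: (x j) => //.
  have -> : [set y | (c j <= y)%E = false] = ~` [set y | (c j <= y)%E].
    by apply/seteqP; split=> y /=; [move=> ->|move/negP/negbTE].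
  exact: measurableC.
apply/seteqP; split=> w /=; first by move=> <- j _; rewrite /= ffunE.
by move=> h; apply/ffunP => j; rewrite ffunE; exact: h.
Qed.

(** * Independence of the urns *)

Section UrnIndependence.
Context {R : realType} {d : measure_display} {W : measurableType d}.
Variables (P : probability W R) (X : nat -> W -> nat) (T : nat -> W -> R) (p : nat -> R).
Hypothesis mX : forall j, measurable_fun setT (X j).
Hypothesis mT : forall j, measurable_fun setT (T j).
Hypothesis Xindep : mutually_independent P X.
Hypothesis Xlaw : forall j i, (0 < i)%N -> P [set w | X j w = i] = (p i)%:E.
Hypothesis ppos : forall i, (0 < i)%N -> 0 < p i.
Hypothesis Tp : unit_poisson_process P T.
Hypothesis TX : independent_families P T X.

Section Truncate.
Variable n : nat.

(* The label 0 stands for all the urns beyond the first [n]. *)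
Definition urn_label (i : nat) : 'I_n.+1 := if (i <= n)%N then inord i else ord0.

Definition label_prob (u : 'I_n.+1) : R := pr P [set w | urn_label (X 0 w) = u].

Lemma urn_labelE j (u : 'I_n.+1) : u != ord0 ->
  [set w | urn_label (X j w) = u] = [set w | X j w = u].
Proof.
move=> u0; apply/seteqP; split=> w; rewrite /= /urn_label; last first.
  by move=> ->; rewrite leq_ord inord_val.
by case: leqP => [Xn <-|_ E]; [rewrite inordK|rewrite -E eqxx in u0].
Qed.

Lemma measurable_urn_label j u : measurable [set w | urn_label (X j w) = u].
Proof. by apply: (preimage_measurable (X j) [set x | urn_label x = u]). Qed.

(** [Xlaw] gives the nonzero labels directly. Label 0 gathers all remaining values; its probability
    is the complement of the others, so it does not depend on [j] either. *)
Lemma label_law j u : pr P [set w | urn_label (X j w) = u] = label_prob u.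
Proof.
have law u' : u' != ord0 -> pr P [set w | urn_label (X j w) = u'] = label_prob u'.
  move=> u0; rewrite /label_prob !urn_labelE// /pr !Xlaw// lt0n;
  by apply: contra u0 => /eqP E; apply/eqP/val_inj.
have tot j' : \sum_u' pr P [set w | urn_label (X j' w) = u'] = 1.
  rewrite -(pr_partitionT P (fun w => urn_label (X j' w)) predT); last exact: measurable_urn_label.
  by rewrite (_ : [set w | _] = setT) ?prT//; apply/seteqP.
have [->|] := eqVneq u ord0; last exact: law.
have := tot j; rewrite -(tot 0%N) (bigD1 ord0)//= [RHS](bigD1 ord0)//=.
by rewrite [X in _ + X = _](eq_bigr _ law) => /addIr.
Qed.

Lemma label_prob_urn (u : 'I_n.+1) : u != ord0 -> label_prob u = p u.
Proof.
move=> u0; rewrite /label_prob urn_labelE// /pr Xlaw// lt0n.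
by apply: contra u0 => /eqP E; apply/eqP/val_inj.
Qed.

Lemma label_prob_sum : \sum_u label_prob u = 1.
Proof.
rewrite -(pr_partitionT P (fun w => urn_label (X 0 w)) predT); last exact: measurable_urn_label.
by rewrite (_ : [set w | _] = setT) ?prT//; apply/seteqP.
Qed.

(** Label 0 contains urn [n.+1], so its probability is at least [p n.+1]. Positivity matters because
    the thinned process is compared with the unit process on sets dilated by these probabilities. *)
Lemma label_prob_gt0 u : 0 < label_prob u.
Proof.
have [->|u0] := eqVneq u ord0; last first.
  rewrite label_prob_urn// ppos// lt0n.
  by apply: contra u0 => /eqP E; apply/eqP/val_inj.
apply: (@lt_le_trans _ _ (p n.+1)); first exact: ppos.
rewrite -lee_fin -prE; last exact: measurable_urn_label.
rewrite -(Xlaw 0)//; apply: le_measure; rewrite ?inE.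
- by apply: (preimage_measurable (X 0) [set n.+1]).
- exact: measurable_urn_label.
- by move=> w /= ->; rewrite /urn_label ltnn.
Qed.

Lemma label_joint H (x : nat -> 'I_n.+1) :
  pr P [set w | forall j, (j < H)%N -> urn_label (X j w) = x j] = \prod_(j < H) label_prob (x j).
Proof.
rewrite (_ : [set w | _] =
    \bigcap_(j in [set` iota 0 H]) (X j @^-1` [set y | urn_label y = x j])).
  rewrite /pr Xindep ?iota_uniq//.
  rewrite (eq_bigr (fun j => (label_prob (x j))%:E)); last first.
    by move=> j _; rewrite -(label_law j) -prE//; exact: measurable_urn_label.
  by rewrite prodEFin/= -[H in iota 0 H]subn0 big_mkord.
apply/seteqP; split=> w h j; first by rewrite /= mem_iota add0n => /andP[_ /h].
by move=> jH; apply: h; rewrite /= mem_iota.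
Qed.

Section Thresholds.
Variables (J : finType) (A : J -> set R) (c : J -> \bar R).
Hypothesis mA : forall j, measurable (A j).
Hypothesis A01 : forall j, A j `<=` `[0, 1].

(* The cell of the points lying in [A j] exactly for [j \in a]; the cell outside all the [A j],
   of infinite measure, is replaced by the empty set. *)
Definition atom (a : {set J}) : set R :=
  [set x | a != finset.set0 /\ forall j, (j \in a) = `[< A j x >]].

Lemma measurable_atom a : measurable (atom a).
Proof.
rewrite (_ : atom a = [set x | a != finset.set0] `&`
    \bigcap_(j in [set: J]) [set x | (j \in a) = `[< A j x >]]).
  apply: measurableI; first by case: (a != _); [rewrite set_true|rewrite set_false].
  apply: fin_bigcap_measurable => // j _; case: (j \in a).
    rewrite (_ : [set x | _] = A j)//; apply/seteqP; split=> x /=; first by move/esym/asboolP.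
    by move=> Ax; rewrite asboolT.
  rewrite (_ : [set x | _] = ~` A j); first exact: measurableC.
  by apply/seteqP; split=> x /=; [move/esym/asboolPn|move=> Ax; rewrite asboolF].
by apply/seteqP; split=> x [a0 h]; split=> // j; [move=> _; exact: h|exact: h].
Qed.

Lemma atom01 a : atom a `<=` `[0, 1].
Proof. by move=> x [/finset.set0Pn[j ja] /(_ j)]; rewrite ja => /esym/asboolP/A01. Qed.

Lemma trivIset_atom : trivIset setT atom.
Proof.
move=> a b _ _ [x [[_ ha] [_ hb]]].
by apply/finset.setP => j; rewrite ha hb.
Qed.

Lemma set_atoms j : A j = \bigcup_(a in [set a : {set J} | j \in a]) atom a.
Proof.
apply/seteqP; split=> x; last by move=> [a /= ja [_ /(_ j)]]; rewrite ja => /esym/asboolP.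
move=> Ax; exists (finset.finset (fun i => `[< A i x >])); first by rewrite /= finset.in_set asboolT.
split; last by move=> i; rewrite finset.in_set.
by apply/finset.set0Pn; exists j; rewrite finset.in_set asboolT.
Qed.

(** Keeping only the comparisons with the thresholds gives a value in a finite type, still enough to
    determine the contribution of one urn to all the counts. *)
Definition urn_bits (t : R) (i : nat) (w : W) : {ffun J -> bool} :=
  [ffun j => (c j <= PiBi X T i (dilate t (A j)) w)%E].

Definition point_bits (u : R) (w : W) : {ffun J -> bool} :=
  [ffun j => (c j <= PiB T (dilate u (A j)) w)%E].

(** By thinning, urn [i.+1] at time [t] has the law of the unit process on sets dilated by
    [p i.+1 * t]. The [A j] may overlap, so their counts are first written as sums over disjoint
    atoms. *)
Lemma urn_bits_independent (t : R) (Q : 'I_n -> pred {ffun J -> bool}) : 0 < t ->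
  pr P [set w | forall i : 'I_n, Q i (urn_bits t i.+1 w)] =
  \prod_(i < n) pr P [set w | Q i (point_bits (p i.+1 * t) w)].
Proof.
move=> t0.
pose B a := dilate t (atom a).
have mB a : measurable (B a) by apply: measurable_dilate => //; exact: measurable_atom.
have B0 a : B a `<=` `[0, +oo[.
  apply: dilate_ge0 => // x /atom01; rewrite /= !in_itv/= => /andP[-> //].
have tB : trivIset setT B.
  move=> a b _ _ [x [/(dilateP _ _ _ t0) ha /(dilateP _ _ _ t0) hb]].
  by apply: trivIset_atom => //; exists (x / t).
have lB a : lebesgue_measure (B a) = (fine (lebesgue_measure (B a)))%:E.
  rewrite fineK// lebesgue_measure_dilate//; last exact: measurable_atom.
  rewrite fin_numM// ge0_fin_numE//.
  apply: (@le_lt_trans _ _ (lebesgue_measure `[(0 : R), 1])).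
    by apply: le_measure; rewrite ?inE//; [exact: measurable_atom|exact: atom01].
  by rewrite lebesgue_measure_itv/= lte01 sube0 ltry.
(* Label 0 is left unconstrained, so its factor in the product is 1. *)
pose V (u : 'I_n.+1) : set ({set J} -> \bar R) := [set nu |
  if unlift ord0 u is Some i then
    Q i [ffun j => (c j <= \sum_(a : {set J} | j \in a) nu a)%E] else true].
have dilU (s : R) j w : 0 < s -> PiB T (dilate (s * t) (A j)) w =
    (\sum_(a : {set J} | j \in a) PiB T (dilate s (B a)) w)%E.
  move=> s0; rewrite /PiB -counting_partition; last first.
    move=> a b _ _ [k [/(dilateP _ _ _ s0) ha /(dilateP _ _ _ s0) hb]].
    by apply: tB => //; exists (T k w / s).
  congr counting; rewrite /B (set_atoms j); apply/seteqP; split=> k /=.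
    move=> [x [a ja ax] E]; exists a => //=; rewrite dilate_dilate; by exists x.
  move=> [a ja]; rewrite /= dilate_dilate => -[x ax E]; exists x => //; by exists a.
have dilL (i : 'I_n) j w : PiBi X T i.+1 (dilate t (A j)) w =
    (\sum_(a : {set J} | j \in a) lcount _ _ X T urn_label B (lift ord0 i) a w)%E.
  rewrite /PiBi /lcount -counting_partition; last first.
    by move=> a b _ _ [k [[ha _] [hb _]]]; apply: tB => //; exists (T k w).
  have lE k : (urn_label (X k w) = lift ord0 i) = (X k w = i.+1).
    exact: (congr1 (fun S : set W => S w) (urn_labelE k (lift ord0 i) isT)).
  congr counting; rewrite /B [in LHS](set_atoms j); apply/seteqP; split=> k /=.
    by move=> [[x [a ja ax] E] Xk]; exists a => //=; split; [exists x|rewrite lE].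
  move=> [a ja]; rewrite /= lE => -[[x ax E] Xk]; split => //; exists x => //; by exists a.
have VL w (i : 'I_n) : V (lift ord0 i) (fun a => lcount _ _ X T urn_label B (lift ord0 i) a w) =
    Q i (urn_bits t i.+1 w).
  rewrite /V/= liftK.
  congr (Q i _ : Prop); apply/ffunP => j; rewrite !ffunE; congr (_ <= _)%E.
  by rewrite dilL.
have VP w (s : R) (i : 'I_n) : 0 < s -> V (lift ord0 i) (fun a => PiB T (dilate s (B a)) w) =
    Q i (point_bits (s * t) w).
  move=> s0; rewrite /V/= liftK.
  congr (Q i _ : Prop); apply/ffunP => j; rewrite !ffunE; congr (_ <= _)%E.
  by rewrite dilU.
have V0 nu : V ord0 nu = True.
  by rewrite /V/= unlift_none; apply/propext.
have mE : measurable [set w | forall u, V u (fun a => lcount _ _ X T urn_label B u a w)].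
  rewrite (_ : [set _ | _] = \bigcap_(i in [set: 'I_n]) [set w | Q i (urn_bits t i.+1 w)]).
    apply: fin_bigcap_measurable => // i _; apply: measurable_thresholds => j.
    apply: measurable_counting => k; apply: measurableI.
      by apply: preimage_measurable => //; exact: measurable_dilate.
    exact: (preimage_measurable (X k) [set i.+1]).
  apply/seteqP; split=> w h; first by move=> i _; rewrite /= -VL; exact: h.
  move=> u; case: (unliftP ord0 u) => [i ->|->]; last by rewrite V0.
  by rewrite VL; exact: h.
have mV u : measurable [set w | V u (fun a => PiB T (dilate (label_prob u) (B a)) w)].
  case: (unliftP ord0 u) => [i ->|->]; last first.
    by rewrite (_ : [set _ | _] = setT)//; apply/seteqP; split=> // w _; rewrite /= V0.
  rewrite (_ : [set _ | _] = [set w | Q i (point_bits (label_prob (lift ord0 i) * t) w)]).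
    apply: measurable_thresholds => j; apply: measurable_PiB => //.
    by apply: measurable_dilate => //; rewrite mulr_gt0// label_prob_gt0.
  by apply/funext => w /=; rewrite VP// label_prob_gt0.
have := thinned_independence P T mT Tp X {set J} 'I_n.+1 label_prob urn_label B mX TX
  label_prob_gt0 label_prob_sum label_joint mB B0 tB (fun a => fine (lebesgue_measure (B a))) lB
  V mE mV.
rewrite big_ord_recl (_ : [set w | V ord0 _] = setT); last first.
  by apply/seteqP; split=> // w _; rewrite /= V0.
rewrite prT mul1r => E.
transitivity (pr P [set w | forall u, V u (fun a => lcount _ _ X T urn_label B u a w)]).
  congr pr; apply/seteqP; split=> w h; last by move=> i; rewrite -VL; exact: h.
  move=> u; case: (unliftP ord0 u) => [i ->|->]; last by rewrite V0.
  by rewrite VL; exact: h.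
rewrite E; apply: eq_bigr => i _; congr pr; apply/funext => w /=.
by rewrite VP ?label_prob_gt0// label_prob_urn// lift0.
Qed.

End Thresholds.
End Truncate.
End UrnIndependence.

(** * Sums of independent finite-valued variables *)

Section IndependentSums.
Context {R : realType} {d : measure_display} {W : measurableType d}.
Variable P : probability W R.

Lemma Rintegral_finite_valued {S : finType} (f : W -> S) (h : S -> R) :
  (forall s, measurable [set w | f w = s]) ->
  (\int[P]_w h (f w))%R = \sum_s h s * pr P [set w | f w = s].
Proof.
move=> mf.
transitivity (\int[P]_w \sum_s (h s * \1_[set w | f w = s] w))%R.
  apply: eq_Rintegral => w _; rewrite (bigD1 (f w))//= indicE mem_set// mulr1.
  by rewrite big1 ?addr0// => s sf; rewrite indicE memNset ?mulr0//= => /esym/eqP; rewrite (negbTE sf).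
have ii s := integrable_indic_prob P _ (mf s).
rewrite Rintegral_sum//; last by move=> s; exact: integrable_scale.
by apply: eq_bigr => s _; rewrite RintegralZl// Rintegral_indic_prob.
Qed.

Section Sums.
Context {S : finType}.
Variables (xi : nat -> W -> S) (pi : nat -> S -> R).
Hypothesis mxi : forall i s, measurable [set w | xi i w = s].
Hypothesis indep : forall n (x : nat -> S),
  pr P [set w | forall i, (i < n)%N -> xi i w = x i] = \prod_(i < n) pi i (x i).

Let vec n w : {ffun 'I_n -> S} := [ffun i : 'I_n => xi i w].

Let mvec n x : measurable [set w | vec n w = x].
Proof.
rewrite (_ : [set _ | _] = \bigcap_(i in [set: 'I_n]) [set w | xi i w = x i]).
  by apply: fin_bigcap_measurable.
apply/seteqP; split=> w /=; first by move=> <- i _; rewrite /vec ffunE.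
by move=> h; apply/ffunP => i; rewrite /vec ffunE h.
Qed.

Let pr_vec n (x : {ffun 'I_n -> S}) : pr P [set w | vec n w = x] = \prod_(i < n) pi i (x i).
Proof.
(* [x'] needs a default value in [S]; if [S] is empty, only [n = 0] admits a vector. *)
have [s0 _|S0] := pickP (@predT S); last first.
  case: n x => [|n] x; last by have := S0 (x ord0).
  rewrite big_ord0 (_ : [set w | _] = setT) ?prT//; apply/seteqP; split=> // w _ /=.
  by apply/ffunP => -[].
pose x' j := if insub j is Some i then x i else s0.
rewrite (eq_bigr (fun i : 'I_n => pi i (x' i))) -?indep; last first.
  by move=> i _; rewrite /x' valK.
congr pr; apply/seteqP; split=> w /=.
  by move=> E i ni; rewrite /x' insubT -E /vec ffunE.
by move=> h; apply/ffunP => i; rewrite /vec ffunE h// /x' valK.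
Qed.

Let pair_law n (x : {ffun 'I_n -> S} * S) :
  pr P [set w | (vec n w, xi n w) = x] = pi n x.2 * pr P [set w | vec n w = x.1].
Proof.
rewrite pr_vec.
pose x' : {ffun 'I_n.+1 -> S} := [ffun i => if unlift ord_max i is Some j then x.1 j else x.2].
have x'E (i : 'I_n) : x' (widen_ord (leqnSn n) i) = x.1 i.
  by rewrite ffunE (_ : widen_ord _ i = lift ord_max i) ?liftK//; apply/val_inj; rewrite /= /bump leqNgt ltn_ord.
have x'n : x' ord_max = x.2 by rewrite ffunE unlift_none.
have := pr_vec n.+1 x'; rewrite big_ord_recr/= x'n mulrC.
under eq_bigr do rewrite x'E.
move=> <-; congr pr; apply/seteqP; split=> w /=.
  move=> E; apply/ffunP => i; case: (unliftP ord_max i) => [j ->|->].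
    rewrite (_ : lift ord_max j = widen_ord (leqnSn n) j); last first.
      by apply/val_inj; rewrite /= /bump leqNgt ltn_ord.
    by rewrite x'E -E ffunE /= ffunE.
  by rewrite x'n -E ffunE.
move=> h; rewrite [x]surjective_pairing -x'n -h ffunE; congr pair.
apply/ffunP => i; rewrite -x'E -h !ffunE //.
Qed.

Lemma expectation_last n (h : {ffun 'I_n -> S} -> S -> R) :
  (\int[P]_w h (vec n w) (xi n w))%R = \sum_s pi n s * (\int[P]_w h (vec n w) s)%R.
Proof.
have mp x : measurable [set w | (vec n w, xi n w) = x].
  rewrite (_ : [set w | _] = [set w | vec n w = x.1] `&` [set w | xi n w = x.2]).
    exact: measurableI.
  by apply/seteqP; split=> w /= [] => [<-//|-> ->]; case: x.
rewrite (Rintegral_finite_valued (fun w => (vec n w, xi n w)) (fun x => h x.1 x.2))//.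
transitivity (\sum_s \sum_x pi n s * (h x s * pr P [set w | vec n w = x])); last first.
  apply: eq_bigr => s _; rewrite -mulr_sumr; congr (_ * _).
  by rewrite (Rintegral_finite_valued (vec n) (h^~ s) (mvec n)).
rewrite exchange_big pair_bigA /=; apply: eq_bigr => x _.
by rewrite pair_law mulrCA.
Qed.

Variable g : nat -> S -> R.

Definition partial_sum n w := \sum_(i < n) g i (xi i w).

Lemma expectation_partial_sumS (f : R -> R) n :
  (\int[P]_w f (partial_sum n.+1 w))%R =
  \sum_s pi n s * (\int[P]_w f (g n s + partial_sum n w))%R.
Proof.
have := expectation_last n (fun x s => f (g n s + \sum_(i < n) g i (x i))).
move=> E; transitivity (\int[P]_w f (g n (xi n w) + \sum_(i < n) g i (vec n w i)))%R.
  apply: eq_Rintegral => w _; rewrite /partial_sum big_ord_recr/= addrC.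
  by congr (f (_ + _)); apply: eq_bigr => i _; rewrite ffunE.
rewrite E; apply: eq_bigr => s _; congr (_ * _); apply: eq_Rintegral => w _.
by congr (f (_ + _)); apply: eq_bigr => i _; rewrite ffunE.
Qed.

Lemma bounded_partial_sum n : exists C, forall w, `|partial_sum n w| <= C.
Proof.
exists (\sum_(i < n) \sum_s `|g i s|) => w; apply: le_trans (ler_norm_sum _ _ _) _.
by apply: ler_sum => i _; rewrite (bigD1 (xi i w))//= lerDl sumr_ge0.
Qed.

Lemma measurable_partial_sum n : measurable_fun setT (partial_sum n).
Proof.
apply: measurable_sum => i; move=> _ Y mY; rewrite setTI.
have := measurable_finite_valued (xi i) (fun s => `[< Y (g i s) >]) (mxi i).
by congr measurable; apply/seteqP; split=> w /= /asboolP.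
Qed.

Hypothesis pi_ge0 : forall i s, 0 <= pi i s.
Hypothesis pi_sum : forall i, \sum_s pi i s = 1.
Hypothesis centered : forall i, \sum_s pi i s * g i s = 0.

Definition step_var i := \sum_s pi i s * g i s ^+ 2.

Lemma step_var_ge0 i : 0 <= step_var i.
Proof. by apply: sumr_ge0 => s _; rewrite mulr_ge0// sqr_ge0. Qed.

(** The free shift [x] absorbs the value of the last summand in the induction; the cross term
    vanishes by centring. *)
Lemma expectation_partial_sum_sqr n x :
  (\int[P]_w (x + partial_sum n w) ^+ 2)%R = x ^+ 2 + \sum_(i < n) step_var i.
Proof.
elim: n x => [|n IH] x.
  rewrite big_ord0 addr0 /partial_sum.
  under eq_Rintegral do rewrite big_ord0 addr0.
  by rewrite Rintegral_cst// -/(pr P setT) prT mulr1.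
rewrite (expectation_partial_sumS (fun y => (x + y) ^+ 2)).
under eq_bigr do under eq_Rintegral do rewrite addrA.
under eq_bigr do rewrite IH.
rewrite big_ord_recr/= [X in _ = _ + X]addrC addrA.
transitivity (\sum_s ((x ^+ 2 + \sum_(i < n) step_var i) * pi n s +
    (x *+ 2) * (pi n s * g n s) + pi n s * g n s ^+ 2)).
  by apply: eq_bigr => s _; rewrite sqrrD; ring.
by rewrite !big_split/= -!mulr_sumr pi_sum centered mulr1 mulr0 addr0 addrAC.
Qed.

(* Lindeberg's replacement of one summand at a time, with Taylor's formula for the cosine. *)
Lemma expectation_partial_sum_cos delta n x : 0 <= delta <= 1 ->
  (forall i s, `|g i s| <= delta) ->
  `|(\int[P]_w cos (x + partial_sum n w))%R - cos x * expR (- ((\sum_(i < n) step_var i) / 2))|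
  <= delta * \sum_(i < n) step_var i.
Proof.
move=> /andP[delta0 delta1] gd; elim: n x => [|n IH] x.
  rewrite !big_ord0 mulr0 mul0r oppr0 expR0 mulr1 /partial_sum.
  under eq_Rintegral do rewrite big_ord0 addr0.
  by rewrite Rintegral_cst// -/(pr P setT) prT mulr1 subrr normr0.
rewrite (expectation_partial_sumS (fun y => cos (x + y))).
under eq_bigr do under eq_Rintegral do rewrite addrA.
set V := \sum_(i < n) step_var i.
rewrite !big_ord_recr/= -/V mulrDr.
have v0 := step_var_ge0 n.
have vd : step_var n <= delta ^+ 2.
  rewrite /step_var -[leRHS]mul1r -(pi_sum n) mulr_suml; apply: ler_sum => s _.
  apply: ler_wpM2l => //; rewrite -real_normK ?num_real//.
  by apply: lerXn2r; rewrite ?nnegrE.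
have eV1 : expR (- (V / 2)) <= 1.
  rewrite -expR0 ler_expR oppr_le0 divr_ge0// sumr_ge0// => i _; exact: step_var_ge0.
(* A hybrid: the last summand is still random, the first [n] are already replaced by their Gaussian
   factor. The induction hypothesis, with the phase shifted by [g n s], bounds the first
   difference. *)
pose E := \sum_s pi n s * (cos (x + g n s) * expR (- (V / 2))).
rewrite -(subrKA E) (le_trans (ler_normD _ _))// lerD//.
  rewrite /E -sumrB; apply: le_trans (ler_norm_sum _ _ _) _.
  have -> : delta * V = \sum_s pi n s * (delta * V) by rewrite -mulr_suml pi_sum mul1r.
  apply: ler_sum => s _; by rewrite -mulrBr normrM ger0_norm// ler_wpM2l.
rewrite mulrDl opprD expRD [expR _ * expR _]mulrC mulrA.
rewrite /E; under eq_bigr do rewrite mulrA.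
rewrite -mulr_suml -mulrBl normrM.
apply: le_trans (ler_piMr _ _) _ => //; first by rewrite ger0_norm// expR_ge0.
pose rc s := cos (g n s) - (1 - g n s ^+ 2 / 2).
pose rs s := sin (g n s) - g n s.
(* The linear term vanishes by centring and the quadratic one matches the expansion of the
   exponential, so only Taylor remainders are left. *)
have -> : \sum_s pi n s * cos (x + g n s) - cos x * expR (- (step_var n / 2)) =
   \sum_s pi n s * (cos x * rc s - sin x * rs s) -
   cos x * (expR (- (step_var n / 2)) - (1 - step_var n / 2)).
  have -> : \sum_s pi n s * cos (x + g n s) =
      \sum_s pi n s * (cos x * rc s - sin x * rs s) + cos x * (1 - step_var n / 2).
    transitivity (\sum_s (pi n s * (cos x * rc s - sin x * rs s) +
        (cos x * pi n s - sin x * (pi n s * g n s) - cos x / 2 * (pi n s * g n s ^+ 2)))).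
      by apply: eq_bigr => s _; rewrite cosD /rc /rs; field.
    rewrite big_split/=; congr (_ + _); rewrite !sumrB -!mulr_sumr pi_sum centered.
    by rewrite -/(step_var n); field.
  by ring.
have hE : `|expR (- (step_var n / 2)) - (1 - step_var n / 2)| <= delta * step_var n / 8.
  apply: le_trans (expRN_taylor _ _) _; first by rewrite divr_ge0.
  have dd : delta ^+ 2 <= delta by rewrite expr2 ler_piMr.
  have := ler_wpM2r v0 (le_trans vd dd); lra.
have hrc s : `|rc s| <= delta * g n s ^+ 2 / 24.
  apply: le_trans (cos_taylor _) _; rewrite ler_pM2r ?invr_gt0//.
  rewrite (_ : 4 = 2 + 2)%N// exprD ler_wpM2r ?sqr_ge0//.
  rewrite -real_normK ?num_real// expr2; have := gd n s; have := normr_ge0 (g n s); nra.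
have hrs s : `|rs s| <= delta * g n s ^+ 2 / 6.
  apply: le_trans (sin_taylor _) _; rewrite ler_pM2r ?invr_gt0//.
  by rewrite exprS real_normK ?num_real// ler_wpM2r ?sqr_ge0.
have c1 := cos_max x; have s1 := sin_max x.
apply: le_trans (ler_normB _ _) _.
have h1 : `|\sum_s pi n s * (cos x * rc s - sin x * rs s)| <= (delta / 24 + delta / 6) * step_var n.
  apply: le_trans (ler_norm_sum _ _ _) _; rewrite /step_var mulr_sumr; apply: ler_sum => s _.
  rewrite normrM ger0_norm// mulrCA ler_wpM2l//; apply: le_trans (ler_normB _ _) _.
  rewrite !normrM mulrDl; apply: lerD.
    apply: le_trans (_ : `|rc s| <= _); first by rewrite ler_piMl.
    by apply: le_trans (hrc s) _; rewrite mulrAC.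
  apply: le_trans (_ : `|rs s| <= _); first by rewrite ler_piMl.
  by apply: le_trans (hrs s) _; rewrite mulrAC.
have h2 : `|cos x * (expR (- (step_var n / 2)) - (1 - step_var n / 2))| <= delta * step_var n / 8.
  by rewrite normrM; apply: le_trans hE; rewrite ler_piMl.
(* The remainders total [1/24 + 1/6 + 1/8 = 1/3] of [delta * step_var n]. *)
have := mulr_ge0 delta0 v0; lra.
Qed.

End Sums.
End IndependentSums.

(** * Karamata's theorem for sums over the urns *)

Section HalfLine.
Context {R : realType}.
Local Notation mu := (@lebesgue_measure R).
Local Notation pos := (`]0%R, +oo[%classic : set R).

Lemma segs_bounds (n : nat) : 0 < (n.+1%:R^-1 : R) <= n.+1%:R.
Proof.
rewrite invr_gt0 ltr0Sn/=; apply: (@le_trans _ _ 1); last by rewrite ler1n.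
by rewrite invf_le1 ?ltr0Sn// ler1n.
Qed.

Definition segs (n : nat) : set R := `[n.+1%:R^-1, n.+1%:R]%classic.

Lemma segs_le n n' : (n <= n')%N -> segs n `<=` segs n'.
Proof.
move=> nn x; rewrite /segs /= !in_itv/= => /andP[h1 h2]; apply/andP; split.
  by apply: le_trans h1; rewrite lef_pV2 ?posrE ?ltr0Sn// ler_nat ltnS.
by apply: (le_trans h2); rewrite ler_nat ltnS.
Qed.

Lemma segs_pos n : segs n `<=` pos.
Proof.
move=> x; rewrite /segs /= !in_itv/= andbT => /andP[h1 _].
by apply: lt_le_trans h1; case/andP: (segs_bounds n).
Qed.

Lemma bigcup_segs : \bigcup_n segs n = pos.
Proof.
apply/seteqP; split=> [x [n _]|x]; first exact: segs_pos.
rewrite /= in_itv/= andbT => x0.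
exists (maxn (Num.truncn x) (Num.truncn x^-1)) => //; rewrite /segs /= in_itv/=.
have h (y : R) n : 0 < y -> (Num.truncn y <= n)%N -> y <= n.+1%:R.
  move=> y0 yn; apply: le_trans (ltW (truncnS_gt y)) _.
  by rewrite ler_nat ltnS.
rewrite h ?leq_maxl// andbT -[x in _ <= x]invrK lef_pV2 ?posrE ?ltr0Sn ?invr_gt0//.
by apply: h; rewrite ?invr_gt0// leq_maxr.
Qed.

Lemma FTC_pos (F f : R -> R) (a b : R) : 0 < a <= b ->
  (forall x : R, 0 < x -> is_derive x (1 : R) F (f x)) ->
  (forall x : R, 0 < x -> {for x, continuous f}) ->
  mu.-integrable `[a, b] (EFin \o f) /\ \int[mu]_(x in `[a, b]) f x = F b - F a.
Proof.
move=> /andP[a0 ab] dF cf.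
have cfab : {within `[a, b], continuous f}.
  apply: continuous_in_subspaceT => x; rewrite inE/= in_itv/= => /andP[ax _].
  by apply: cf; exact: lt_le_trans ax.
split.
  by apply: continuous_compact_integrable => //; exact: segment_compact.
move: ab; rewrite le_eqVlt => /predU1P[<-|ab].
  by rewrite subrr set_itv1 Rintegral_set1.
have cF x : 0 < x -> {for x, continuous F}.
  move=> x0; apply: differentiable_continuous.
  exact/derivable1_diffP/(@ex_derive _ _ _ _ _ _ _ (dF x x0)).
rewrite /Rintegral (continuous_FTC2 ab (F := F))//.
- split.
  + by move=> x; rewrite in_itv/= => /andP[ax _]; have [] := dF x (lt_trans a0 ax).
  + by apply: cvg_at_right_filter; exact: cF.
  + by apply: cvg_at_left_filter; apply: cF; exact: lt_trans ab.
- move=> x; rewrite in_itv/= => /andP[ax _]; rewrite derive1E.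
  exact: (@derive_val _ _ _ _ _ _ _ (dF x (lt_trans a0 ax))).
Qed.

Lemma measurable_pos (f : R -> R) : (forall x : R, 0 < x -> {for x, continuous f}) ->
  measurable_fun pos f.
Proof.
move=> cf; apply: open_continuous_measurable_fun; first exact: interval_open.
by move=> x; rewrite inE/= in_itv/= andbT => /cf.
Qed.

(** Monotone convergence along the segments [segs]: the integrals are increments of [F], hence at
    most [2 C]. Singularities at both ends are treated alike. *)
Lemma integrable_pos (F f : R -> R) (C : R) :
  (forall x : R, 0 < x -> is_derive x (1 : R) F (f x)) ->
  (forall x : R, 0 < x -> {for x, continuous f}) ->
  (forall x : R, 0 < x -> 0 <= f x) -> (forall x : R, 0 < x -> `|F x| <= C) ->
  mu.-integrable pos (EFin \o f).
Proof.
move=> dF cf f0 FC; have mf := measurable_pos f cf.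
apply/integrableP; split; first exact/measurable_EFinP.
have -> : (\int[mu]_(x in pos) `|(EFin \o f) x|)%E = (\int[mu]_(x in pos) (EFin \o f) x)%E.
  apply: eq_integral => x; rewrite inE/= in_itv/= andbT => x0.
  by rewrite ger0_norm// f0.
have segpos n x : segs n x -> 0 < x by move=> /segs_pos; rewrite /= in_itv/= andbT.
have h : (\int[mu]_(x in segs n) (EFin \o f) x)%E @[n --> \oo] -->
    (\int[mu]_(x in pos) (EFin \o f) x)%E.
  rewrite -bigcup_segs; apply: ge0_nondecreasing_set_cvg_integral => //.
  - by move=> n m nm; apply/subsetPset; exact: segs_le.
  - by move=> n; exact: measurable_itv.
  - move=> n; apply/measurable_EFinP; apply: measurable_funS mf; last exact: segs_pos.
    exact: measurable_itv.
  - by move=> n x /segpos x0; rewrite lee_fin f0.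
apply: (@le_lt_trans _ _ (C + C)%:E); last exact: ltry.
rewrite -(cvg_lim _ h)//; apply: lime_le; first by apply/cvg_ex; eexists; exact: h.
near=> n; have [i E] := FTC_pos F f _ _ (segs_bounds n) dF cf.
have : fine (\int[mu]_(x in segs n) (EFin \o f) x)%E = F n.+1%:R - F n.+1%:R^-1 by exact: E.
have [n0 n1] := andP (segs_bounds n).
have fin : (\int[mu]_(x in segs n) (EFin \o f) x)%E \is a fin_num.
  by apply: integrable_fin_num i; exact: measurable_itv.
move=> E'; rewrite -(fineK fin) E' lee_fin; apply: le_trans (ler_norm _) _; apply: le_trans (ler_normB _ _) _.
by rewrite lerD// FC// (lt_le_trans n0).
Unshelve. all: by end_near.
Qed.

Lemma Rintegral_segs (f : R -> R) : mu.-integrable pos (EFin \o f) ->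
  (\int[mu]_(x in segs n) f x)%R @[n --> \oo] --> (\int[mu]_(x in pos) f x)%R.
Proof.
move=> fi.
have mf : measurable_fun pos f by case/integrableP: fi => /measurable_EFinP.
have mp : measurable pos by exact: measurable_itv.
have ms n : measurable (segs n) by exact: measurable_itv.
have mfs n : measurable_fun pos (f \_ (segs n)).
  by apply/measurable_restrict => //; apply: measurable_funS mf => //; exact: subIsetr.
have cfs (x : R) : pos x -> (f \_ (segs n)) x @[n --> \oo] --> f x.
  move=> px; have [N _ hN] : (\bigcup_n segs n) x by rewrite bigcup_segs.
  apply: cvg_near_cst; near=> n; rewrite /patch mem_set//.
  by apply: (segs_le N) => //; near: n; exact: nbhs_infty_ge.
have dom n (x : R) : pos x -> `|(f \_ (segs n)) x| <= `|f x|.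
  by move=> _; rewrite /patch; case: ifP; rewrite ?normr0.
have iabs : mu.-integrable pos (EFin \o (fun x => `|f x|)) by exact: integrable_abse fi.
have [_] := Rdominated_cvg mu pos _ f _ mp mfs cfs iabs dom.
rewrite (_ : (fun n => (\int[mu]_(w in pos) (f \_ (segs n)) w)%R) =
    (fun n => (\int[mu]_(x in segs n) f x)%R)) //.
apply/funext => n; rewrite /Rintegral -[in RHS](setIidr (@segs_pos n)).
rewrite integral_mkcondr; congr fine; apply: eq_integral => x _.
by rewrite /patch /=; case: ifP.
Unshelve. all: by end_near.
Qed.

Lemma continuous_powR (r x : R) : 0 < x -> {for x, continuous (@powR R ^~ r)}.
Proof.
move=> x0; apply: differentiable_continuous.
exact/derivable1_diffP/(@ex_derive _ _ _ _ _ _ _ (is_derive1_powR r x0)).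
Qed.

(** The antiderivative [- exp (- u^r) / r] is bounded. Both signs of [r] are used: [r = 1 - theta]
    yields a majorant of [u^(- theta)] near 0, and [r = - theta] one of [u^(- theta - 1)] at
    infinity. *)
Lemma integrable_powR_expR (r : R) : r != 0 ->
  mu.-integrable pos (EFin \o (fun u : R => u `^ (r - 1) * expR (- (u `^ r)))).
Proof.
move=> r0; apply: (integrable_pos (fun u : R => - (expR (- (u `^ r)) / r)) _ `|r|^-1).
- move=> x x0.
  have d1 : is_derive x (1 : R) (@powR R ^~ r) (r * x `^ (r - 1)) := is_derive1_powR r x0.
  have d2 : is_derive x (1 : R) (fun u : R => expR (- (u `^ r))) (expR (- (x `^ r)) * - (r * x `^ (r - 1))).
    exact: (@is_derive1_comp _ expR (fun u : R => - (u `^ r))).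
  apply: is_derive_eq; rewrite -scalerN /GRing.scale/=.
  by field.
- move=> x x0; apply: cvgM; first exact: continuous_powR.
  apply: continuous_comp; last exact: continuous_expR.
  by apply: cvgN; exact: continuous_powR.
- by move=> x x0; rewrite mulr_ge0 ?powR_ge0 ?expR_ge0.
- move=> x x0; rewrite normrN normrM normfV ler_piMl// ger0_norm ?expR_ge0//.
  by rewrite -expR0 ler_expR oppr_le0 powR_ge0.
Qed.

Lemma integrable_expR (s : R) : 0 < s -> mu.-integrable pos (EFin \o (fun u : R => expR (- (s * u)))).
Proof.
move=> s0; apply: (integrable_pos (fun u : R => - (expR (- (s * u)) / s)) _ s^-1).
- move=> x x0.
  have d2 : is_derive x (1 : R) (fun u : R => expR (- (s * u))) (expR (- (s * x)) * - s).
    apply: (@is_derive1_comp _ expR (fun u : R => - (s * u))).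
    by apply: is_derive_eq; rewrite /GRing.scale/= mulr1.
  apply: is_derive_eq; rewrite /GRing.scale/=.
  by field; rewrite gt_eqF.
- move=> x x0; apply: continuous_comp; last exact: continuous_expR.
  by apply: cvgN; apply: cvgM; [exact: cvg_cst|exact: cvg_id].
- by move=> x x0; rewrite expR_ge0.
- move=> x x0; rewrite normrN normrM normfV (gtr0_norm s0) ler_piMl ?invr_ge0 ?(ltW s0)//.
  by rewrite ger0_norm ?expR_ge0// -expR0 ler_expR oppr_le0 mulr_ge0// ltW.
Qed.

Lemma integrable_dominated (f g : R -> R) : measurable_fun pos f ->
  mu.-integrable pos (EFin \o g) -> (forall u : R, 0 < u -> `|f u| <= g u) ->
  mu.-integrable pos (EFin \o f).
Proof.
move=> mf ig fg; apply: (le_integrable _ _ _ ig) => //; first exact/measurable_EFinP.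
move=> u; rewrite /= in_itv/= andbT => u0; rewrite lee_fin.
by apply: le_trans (fg u u0) _; exact: ler_norm.
Qed.

Lemma powR_le1_pos (r x : R) : 0 <= r -> 0 < x <= 1 -> x `^ r <= 1.
Proof. move=> r0 /andP[x0 x1]; have <- : 1 `^ r = 1 :> R by rewrite powR1.
by apply: ge0_ler_powR => //; rewrite nnegrE ?ler01// ltW. Qed.

(** The majorant of Karamata's argument: the exponential comes from the decay of [f'], the bracket
    from Potter's bound. *)
Definition decay_bound (s a u : R) : R := expR (- (s * u)) * (u `^ (- a) + 1).

Lemma integrable_decay_bound (s a : R) : 0 < s -> 0 <= a < 1 ->
  mu.-integrable pos (EFin \o decay_bound s a).
Proof.
move=> s0 /andP[a0 a1].
(* On []0, 1]] the first term suffices, since [exp (- u^(1 - a)) >= exp (- 1)] there; beyond 1 the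
   bracket is at most 2 and the second term suffices. *)
pose g u := 2 * expR 1 * (u `^ ((1 - a) - 1) * expR (- (u `^ (1 - a)))) + 2 * expR (- (s * u)).
have r0 : 1 - a != 0 by rewrite gt_eqF// subr_gt0.
apply: (integrable_dominated _ g).
- apply: measurable_pos => x x0; apply: cvgM.
    apply: continuous_comp; last exact: continuous_expR.
    by apply: cvgN; apply: cvgM; [exact: cvg_cst|exact: cvg_id].
  by apply: cvgD; [exact: continuous_powR|exact: cvg_cst].
- apply: integrable_add => //; apply: integrable_scale => //; first exact: integrable_powR_expR.
  exact: integrable_expR.
- move=> u u0; rewrite /decay_bound ger0_norm ?mulr_ge0 ?expR_ge0 ?addr_ge0 ?powR_ge0//.
  have e1 : expR (- (s * u)) <= 1 by rewrite -expR0 ler_expR oppr_le0 mulr_ge0// ltW.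
  have e0 := expR_ge0 (- (s * u)).
  rewrite /g [1 - a - 1](_ : _ = - a); last by ring.
  have p0 := powR_ge0 u (- a).
  case: (leP u 1) => u1.
    have pu : 1 <= u `^ (- a).
      rewrite powRN invf_ge1; [by apply: powR_le1_pos; rewrite ?u0|exact: powR_gt0].
    have ee : 1 <= expR 1 * expR (- (u `^ (1 - a))).
      rewrite -expRD -[leLHS]expR0 ler_expR subr_ge0; apply: powR_le1_pos; rewrite ?u0//.
      by rewrite subr_ge0 ltW.
    apply: ler_wpDr; first by rewrite mulr_ge0.
    apply: (@le_trans _ _ (u `^ (- a) + 1)); first by rewrite ler_piMl// addr_ge0.
    rewrite mulrCA -mulrA; nra.
  apply: ler_wpDl; first by rewrite !mulr_ge0 ?expR_ge0.
  rewrite mulrC ler_wpM2r//.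
  have : u `^ (- a) <= 1; last by lra.
  by rewrite -[leRHS](powRr0 u) ler_powR ?oppr_le0// ltW.
Qed.

End HalfLine.

(** * Smooth kernels with exponentially small derivative *)

Section Tame.
Context {R : realType}.
Local Notation mu := (@lebesgue_measure R).
Local Notation pos := (`]0%R, +oo[%classic : set R).

(* The class is closed under sums and products and contains the Poisson weights, hence all
   the probabilities attached to a single urn. *)
Definition tame (f f' : R -> R) : Prop :=
  [/\ forall x : R, is_derive x (1 : R) f (f' x), continuous f' &
      exists s C : R, 0 < s /\ forall u : R, 0 <= u ->
        `|f u| <= C /\ `|f' u| <= C * expR (- (s * u))].

Lemma tame_cst (c : R) : tame (fun _ => c) (fun _ => 0).
Proof.
split=> [x|x|]; [exact: is_derive_cst|exact: cvg_cst|].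
exists 1, `|c|; split=> // u _; split=> //.
by rewrite normr0 mulr_ge0 ?expR_ge0.
Qed.

Lemma tame_continuous f f' : tame f f' -> continuous f.
Proof.
move=> [df _ _] x; apply: differentiable_continuous.
exact/derivable1_diffP/(@ex_derive _ _ _ _ _ _ _ (df x)).
Qed.

Lemma tame_rates f f' g g' : tame f f' -> tame g g' ->
  exists s C : R, [/\ 0 < s, 0 <= C & forall u : R, 0 <= u ->
    [/\ `|f u| <= C, `|g u| <= C, `|f' u| <= C * expR (- (s * u)) &
        `|g' u| <= C * expR (- (s * u))]].
Proof.
move=> [_ _ [s [C [s0 h]]]] [_ _ [s' [C' [s'0 h']]]].
exists (Num.min s s'), (Num.max C C'); split; first by rewrite lt_min s0.
  by rewrite le_max (le_trans _ (h 0 _).1).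
move=> u u0; have [a b] := h u u0; have [a' b'] := h' u u0.
have C0 : 0 <= C by rewrite (le_trans _ a).
have C0' : 0 <= C' by rewrite (le_trans _ a').
split; rewrite ?le_max ?a ?a' ?orbT//.
- apply: (le_trans b); apply: ler_pM; rewrite ?expR_ge0 ?le_max ?lexx//.
  by rewrite ler_expR lerN2 ler_wpM2r// ge_min lexx.
- apply: (le_trans b'); apply: ler_pM; rewrite ?expR_ge0 ?le_max ?lexx ?orbT//.
  by rewrite ler_expR lerN2 ler_wpM2r// ge_min lexx orbT.
Qed.

Lemma tame_add f f' g g' : tame f f' -> tame g g' ->
  tame (fun x => f x + g x) (fun x => f' x + g' x).
Proof.
move=> tf tg; have [s [C [s0 C0 h]]] := tame_rates _ _ _ _ tf tg.
case: tf tg => [df cf _] [dg cg _]; split.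
- by move=> x; exact: is_deriveD.
- by move=> x; apply: cvgD; [exact: cf|exact: cg].
- exists s, (C + C); split=> // u /h[a b a' b']; split.
    by apply: (le_trans (ler_normD _ _)); exact: lerD.
  by rewrite mulrDl; apply: (le_trans (ler_normD _ _)); exact: lerD.
Qed.

Lemma tame_mul f f' g g' : tame f f' -> tame g g' ->
  tame (fun x => f x * g x) (fun x => f x * g' x + g x * f' x).
Proof.
move=> tf tg; have [s [C [s0 C0 h]]] := tame_rates _ _ _ _ tf tg.
have ctf := tame_continuous _ _ tf; have ctg := tame_continuous _ _ tg.
case: tf tg => [df cf _] [dg cg _]; split.
- by move=> x; exact: is_deriveM.
- by move=> x; apply: cvgD; apply: cvgM; [exact: ctf|exact: cg|exact: ctg|exact: cf].
- exists s, (C * C + C * C); split=> // u /h[a b a' b']; split.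
    by rewrite normrM ler_wpDr ?mulr_ge0// ler_pM.
  rewrite mulrDl; apply: (le_trans (ler_normD _ _)).
  by rewrite !normrM -!mulrA lerD// ler_pM.
Qed.

Definition is_tame f := exists f', tame f f'.

Lemma is_tame_sum {I : Type} (s : seq I) (Q : pred I) (F : I -> R -> R) :
  (forall i, is_tame (F i)) -> is_tame (fun x => \sum_(i <- s | Q i) F i x).
Proof.
move=> tF; elim: s => [|i s [G tG]].
  by exists (fun _ => 0); under eq_fun do rewrite big_nil; exact: tame_cst.
under eq_fun do rewrite big_cons; case: (Q i); last by exists G.
by have [F' tF'] := tF i; exists (fun x => F' x + G x); exact: tame_add.
Qed.

Lemma is_tame_prod {I : Type} (s : seq I) (Q : pred I) (F : I -> R -> R) :
  (forall i, is_tame (F i)) -> is_tame (fun x => \prod_(i <- s | Q i) F i x).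
Proof.
move=> tF; elim: s => [|i s [G tG]].
  by exists (fun _ => 0); under eq_fun do rewrite big_nil; exact: tame_cst.
under eq_fun do rewrite big_cons; case: (Q i); last by exists G.
by have [F' tF'] := tF i; eexists; exact: (tame_mul _ _ _ _ tF' tG).
Qed.

Lemma is_tame_mul f g : is_tame f -> is_tame g -> is_tame (fun x => f x * g x).
Proof. by move=> [f' tf] [g' tg]; eexists; exact: tame_mul tf tg. Qed.

Lemma is_tame_sub f g : is_tame f -> is_tame g -> is_tame (fun x => f x - g x).
Proof.
move=> [f' tf] [g' tg].
have := tame_add _ _ _ _ tf (tame_mul _ _ _ _ (tame_cst (-1)) tg).
by under eq_fun do rewrite mulN1r; eexists; eassumption.
Qed.

Lemma poi_ge0 (x : R) k : 0 <= x -> 0 <= poi x k.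
Proof. by move=> x0; rewrite /poi divr_ge0// mulr_ge0 ?expR_ge0 ?exprn_ge0. Qed.

Lemma poi_le1 (x : R) k : 0 <= x -> poi x k <= 1.
Proof.
move=> x0; have h := @poi_sum R x.
have inc : nondecreasing_seq (fun K => \sum_(k < K) poi x k).
  by apply/nondecreasing_seqP => n; rewrite big_ord_recr/= lerDl poi_ge0.
have := nondecreasing_cvgn_le inc (cvgP _ h) k.+1; rewrite (cvg_lim _ h)//.
by apply: le_trans; rewrite big_ord_recr/= lerDr sumr_ge0// => i _; exact: poi_ge0.
Qed.

(** Half of the exponential is set aside; what remains is [2^k] times the Poisson weight at [x / 2],
    which is at most 1. *)
Lemma poi_decay (x : R) k : 0 <= x -> poi x k <= 2 ^+ k * expR (- (x / 2)).
Proof.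
move=> x0; have -> : poi x k = 2 ^+ k * expR (- (x / 2)) * poi (x / 2) k.
  have E : expR (- x) = expR (- (x / 2)) * expR (- (x / 2)) by rewrite -expRD; congr expR; field.
  have F : 2 ^+ k * (x / 2) ^+ k = x ^+ k by rewrite -exprMn mulrC divfK.
  by rewrite /poi E -F; move: ((x / 2) ^+ k) => y; ring.
by rewrite ler_piMr ?poi_le1 ?divr_ge0// mulr_ge0 ?expR_ge0 ?exprn_ge0.
Qed.

Definition poi' (x : R) k : R := (if k is k'.+1 then poi x k' else 0) - poi x k.

Lemma is_derive_poi (x : R) k : is_derive x (1 : R) (fun x => poi x k) (poi' x k).
Proof.
have de : is_derive x (1 : R) (fun x : R => expR (- x)) (- expR (- x)).
  have := @is_derive1_comp _ expR -%R x _ _ (is_derive_expR _) (is_deriveNid _ _).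
  by rewrite mulrN1.
rewrite /poi' /poi; case: k => [|k].
  rewrite (_ : (fun x : R => _) = (fun x => expR (- x))); last first.
    by apply/funext => y; rewrite expr0 fact0 mulr1 divr1.
  by rewrite expr0 fact0 mulr1 divr1 sub0r.
have dX : is_derive x (1 : R) (fun y : R => y ^+ k.+1) (k.+1%:R * x ^+ k).
  have := is_deriveX k.+1 (is_derive_id x (1 : R)).
  rewrite /GRing.scale/= mulr1.
  by rewrite (_ : (id : R -> R) ^+ k.+1 = (fun y : R => y ^+ k.+1)) // exprfctE.
have := is_deriveM (is_deriveM de dX) (is_derive_cst (k.+1`!%:R^-1 : R) x 1).
move=> h; apply: (is_derive_eq h); rewrite /GRing.scale/=.
rewrite factS natrM exprS; field.
by rewrite pnatr_eq0 -lt0n fact_gt0 addrC natr1 pnatr_eq0.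
Qed.

Lemma continuous_poi k : continuous (fun x : R => poi x k).
Proof.
move=> x; apply: differentiable_continuous.
exact/derivable1_diffP/(@ex_derive _ _ _ _ _ _ _ (is_derive_poi x k)).
Qed.

Lemma continuous_poi' k : continuous (fun x : R => poi' x k).
Proof.
by move=> x; apply: cvgB; [case: k => [|k]; [exact: cvg_cst|]|]; exact: continuous_poi.
Qed.

Lemma is_tame_poi (lambda : R) k : 0 <= lambda -> is_tame (fun u => poi (lambda * u) k).
Proof.
move=> l0; exists (fun u => lambda * poi' (lambda * u) k).
have dl (x : R) : is_derive x (1 : R) (fun u => lambda * u) lambda.
  by apply: is_derive_eq; rewrite /GRing.scale/= mulr1.
have cl : continuous (fun u : R => lambda * u).
  by move=> x; apply: cvgM; [exact: cvg_cst|exact: cvg_id].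
split.
- move=> x; rewrite mulrC.
  exact: (@is_derive1_comp _ (fun x => poi x k) (fun u => lambda * u) x _ _ (is_derive_poi _ k) (dl x)).
- move=> x; apply: cvgM; first exact: cvg_cst.
  exact: (@continuous_comp _ _ _ (fun u => lambda * u) (fun x => poi' x k) _ (cl x) (continuous_poi' _ _)).
- have bound (x : R) : 0 <= x -> `|poi' x k| <= (2 ^+ k.-1 + 2 ^+ k) * expR (- (x / 2)).
    move=> x0; rewrite /poi' mulrDl; apply: (le_trans (ler_normB _ _)); apply: lerD.
      case: k => [|k]; first by rewrite normr0 mulr_ge0 ?expR_ge0.
      by rewrite ger0_norm ?poi_ge0 ?poi_decay.
    by rewrite ger0_norm ?poi_ge0 ?poi_decay.
  have k0 : 0 <= 2 ^+ k.-1 + 2 ^+ k :> R by rewrite addr_ge0 ?exprn_ge0.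
  (* For [lambda = 0] the derivative vanishes, so any positive rate will do. *)
  exists (if lambda == 0 then 1 else lambda / 2), (Num.max 1 (lambda * (2 ^+ k.-1 + 2 ^+ k))).
  split; first by case: eqP => // /eqP ln; rewrite divr_gt0// lt_neqAle eq_sym ln.
  move=> u u0; split.
    by rewrite le_max ger0_norm ?poi_ge0 ?poi_le1 ?mulr_ge0.
  case: eqP => [->|ln]; first by rewrite !mul0r normr0 mulr_ge0 ?expR_ge0// le_max ler01.
  rewrite normrM ger0_norm//.
  apply: (le_trans (ler_wpM2l l0 (bound _ (mulr_ge0 l0 u0)))).
  by rewrite mulrA [lambda / 2 * u]mulrAC ler_wpM2r ?expR_ge0// le_max lexx orbT.
Qed.

Lemma cvg_powRN (r : R) : 0 < r -> n.+1%:R `^ (- r) @[n --> \oo] --> (0 : R).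
Proof.
move=> r0; apply/cvgrPdist_le => e e0.
near=> n; rewrite sub0r normrN ger0_norm ?powR_ge0// powRN -[e]invrK.
rewrite lef_pV2 ?posrE ?invr_gt0 ?powR_gt0//.
have -> : e^-1 = (e^-1 `^ r^-1) `^ r by rewrite -powRrM mulVf ?gt_eqF// powRr1// invr_ge0 ltW.
apply: ge0_ler_powR; rewrite ?nnegrE ?powR_ge0//; first exact: ltW.
apply: (@le_trans _ _ n%:R); last by rewrite ler_nat.
by near: n; exact: nbhs_infty_ger.
Unshelve. all: by end_near.
Qed.

(** The difference of the integrands has primitive [f u * u^(- theta)]. Since [f 0 = 0] and [f'] is
    bounded, this is [O (u^(1 - theta))] at 0; since [f] is bounded, it is [O (u^(- theta))] at
    infinity. Both boundary terms vanish. *)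
Lemma integration_by_parts_powR (f f' : R -> R) (theta : R) : 0 < theta < 1 ->
  tame f f' -> f 0 = 0 ->
  [/\ mu.-integrable pos (EFin \o (fun u => f' u * u `^ (- theta))),
      mu.-integrable pos (EFin \o (fun u => f u * (theta * u `^ (- theta - 1)))) &
      \int[mu]_(u in pos) (f' u * u `^ (- theta)) =
      \int[mu]_(u in pos) (f u * (theta * u `^ (- theta - 1)))].
Proof.
move=> /andP[t0 t1] tf f0; have cf := tame_continuous _ _ tf.
case: tf => [df cf' [s [C [s0 hC]]]].
have C0 : 0 <= C by rewrite (le_trans _ (hC 0 _).1).
have fu (u : R) : 0 < u -> `|f u| <= C * u.
  move=> u0; have [c] := MVT u0 (fun x _ => df x) (continuous_subspaceT cf).
  rewrite in_itv/= => /andP[c0 _]; rewrite f0 !subr0 => ->.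
  rewrite normrM (gtr0_norm u0) ler_wpM2r ?(ltW u0)//.
  apply: (le_trans (hC c (ltW c0)).2); rewrite ler_piMr// -expR0 ler_expR oppr_le0.
  by rewrite mulr_ge0 ?ltW.
have cp r (u : R) : 0 < u -> {for u, continuous (fun u : R => u `^ r)} := continuous_powR r u.
have i1 : mu.-integrable pos (EFin \o (fun u => f' u * u `^ (- theta))).
  apply: (integrable_dominated _ (fun u => C * decay_bound s theta u)).
  - by apply: measurable_pos => x x0; apply: cvgM; [exact: cf'|exact: cp].
  - by apply: integrable_scale => //; apply: integrable_decay_bound; rewrite ?(ltW t0).
  - move=> u u0; rewrite normrM (ger0_norm (powR_ge0 _ _)) /decay_bound mulrA ler_pM ?powR_ge0//.
      exact: (hC u (ltW u0)).2.
    by rewrite lerDl.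
have i2 : mu.-integrable pos (EFin \o (fun u => f u * (theta * u `^ (- theta - 1)))).
  pose g (u : R) := C * expR 1 * (u `^ ((1 - theta) - 1) * expR (- (u `^ (1 - theta)))) +
     C * expR 1 * (u `^ (- theta - 1) * expR (- (u `^ (- theta)))).
  apply: (integrable_dominated _ g).
  - apply: measurable_pos => x x0; apply: cvgM; first exact: cf.
    by apply: cvgM; [exact: cvg_cst|exact: cp].
  - apply: integrable_add => //; apply: integrable_scale => //; apply: integrable_powR_expR.
      by rewrite gt_eqF// subr_gt0.
    by rewrite oppr_eq0 gt_eqF.
  - move=> u u0; have p0 := powR_ge0 u (- theta - 1).
    rewrite normrM [X in _ * X]ger0_norm; last by rewrite mulr_ge0// ltW.
    have th1 : theta * u `^ (- theta - 1) <= u `^ (- theta - 1) by rewrite ler_piMl// ltW.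
    rewrite /g; case: (leP u 1) => u1.
      apply: ler_wpDr; first by rewrite !mulr_ge0 ?expR_ge0.
      apply: (@le_trans _ _ (C * u `^ (- theta))).
        apply: (le_trans (ler_pM _ _ (fu u u0) th1)); rewrite ?normr_ge0 ?mulr_ge0 ?(ltW t0)//.
        rewrite -mulrA; apply: ler_wpM2l => //.
        by rewrite -{1}[u]powRr1 ?(ltW u0)// -powRD ?(gt_eqF u0) ?implybT// addrCA subrr addr0.
      rewrite (_ : 1 - theta - 1 = - theta); last by ring.
      rewrite -!mulrA ler_wpM2l// mulrCA ler_peMr ?powR_ge0//.
      rewrite -expRD -[leLHS]expR0 ler_expR subr_ge0; apply: powR_le1_pos; rewrite ?u0//.
      by rewrite subr_ge0 ltW.
    apply: ler_wpDl; first by rewrite !mulr_ge0 ?expR_ge0 ?powR_ge0.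
    apply: (le_trans (ler_pM _ _ (hC u (ltW u0)).1 th1)); rewrite ?mulr_ge0 ?(ltW t0)//.
    rewrite -!mulrA ler_wpM2l// mulrCA ler_peMr//.
    rewrite -expRD -[leLHS]expR0 ler_expR subr_ge0.
    by rewrite -[leRHS](powRr0 u) ler_powR ?oppr_le0// ltW.
split=> //; apply/eqP; rewrite -subr_eq0 -RintegralB//; apply/eqP.
pose g (u : R) := f' u * u `^ (- theta) - f u * (theta * u `^ (- theta - 1)).
pose G (u : R) := f u * u `^ (- theta).
have dG (x : R) : 0 < x -> is_derive x (1 : R) G (g x).
  move=> x0; have d1 := is_derive1_powR (- theta) x0.
  have d2 := df x.
  apply: is_derive_eq; rewrite /g /GRing.scale/=; ring.
have cg (x : R) : 0 < x -> {for x, continuous g}.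
  move=> x0; apply: cvgB; apply: cvgM; [exact: cf'|exact: cp|exact: cf|].
  by apply: cvgM; [exact: cvg_cst|exact: cp].
have ig : mu.-integrable pos (EFin \o g).
  exact: integrable_sub.
apply: (cvg_unique _ (Rintegral_segs g ig)) => //.
rewrite (_ : (fun n => _) = (fun n => G n.+1%:R - G n.+1%:R^-1)); last first.
  by apply/funext => n; exact: (FTC_pos G g _ _ (segs_bounds n) dG cg).2.
apply: (cvg_dist_bound _ (fun n => C * n.+1%:R `^ (- theta) + C * n.+1%:R `^ (- (1 - theta)))).
  near=> n; rewrite subr0; apply: (le_trans (ler_normB _ _)).
  have n0 : (0 : R) < n.+1%:R by rewrite ltr0Sn.
  have n1 : (0 : R) < n.+1%:R^-1 by rewrite invr_gt0.
  apply: lerD; rewrite /G normrM (ger0_norm (powR_ge0 _ _)).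
    by rewrite ler_wpM2r ?powR_ge0//; exact: (hC _ (ltW n0)).1.
  apply: (le_trans (ler_wpM2r (powR_ge0 _ _) (fu _ n1))).
  rewrite -mulrA ler_wpM2l// -{1}[n.+1%:R^-1]powRr1 ?(ltW n1)//.
  rewrite -powRD ?(gt_eqF n1) ?implybT// powRN.
  by rewrite -(powR_inv1 (ltW n0)) -powRrM mulN1r powRN.
rewrite -[0](_ : C * 0 + C * 0 = 0); last by rewrite mulr0 addr0.
apply: cvgD; apply: cvgM; try exact: cvg_cst.
  exact: cvg_powRN.
by apply: cvg_powRN; rewrite subr_gt0.
Unshelve. all: by end_near.
Qed.

End Tame.

(** * Regular variation and Potter's bound *)

Section RegularVariation.
Context {R : realType}.
Local Notation mu := (@lebesgue_measure R).
Local Notation pos := (`]0%R, +oo[%classic : set R).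
Variables (p : nat -> R) (theta : R) (L : R -> R).
Hypothesis ppos : forall i, (0 < i)%N -> 0 < p i.
Hypothesis pdecr : forall i, (0 < i)%N -> p i.+1 <= p i.
Hypothesis psum : forall n, \sum_(i < n) p i.+1 <= 1.
Hypothesis theta01 : 0 < theta < 1.
Hypothesis Lslow : slowly_varying L.
Hypothesis alphaE : forall x, (p 1%N)^-1 <= x -> (alpha p x)%:R = x `^ theta * L x.

Lemma p_anti i j : (0 < i)%N -> (i <= j)%N -> p j <= p i.
Proof.
move=> i0; elim: j => [|j IH]; first by rewrite leqn0 => /eqP E; rewrite E in i0.
rewrite leq_eqVlt => /predU1P[->//|]; rewrite ltnS => ij.
by apply: le_trans (IH ij); apply: pdecr; exact: leq_trans ij.
Qed.

(** As [p] decreases, the indices with [p i >= 1 / x] form an initial segment. It is finite because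
    each of them carries mass at least [1 / x] of a total of at most 1, so there are at most [x] of
    them. *)
Lemma alphaP (x : R) i : 0 < x -> (0 < i)%N -> (x^-1 <= p i) = (i <= alpha p x)%N.
Proof.
move=> x0 i0; pose S := [set i | (0 < i)%N /\ x^-1 <= p i].
have bound j : (0 < j)%N && (x^-1 <= p j) -> (j <= Num.truncn x)%N.
  case/andP => j0 xj; rewrite truncn_ge_nat ?(ltW x0)//.
  rewrite -[leRHS]mul1r -ler_pdivrMr//; apply: le_trans (psum j).
  have -> : j%:R / x = \sum_(k < j) x^-1 by rewrite sumr_const card_ord mulr_natl.
  by apply: ler_sum => k _; apply: (le_trans xj); exact: p_anti.
have [[j Sj]|noS] := pselect (exists j, (0 < j)%N && (x^-1 <= p j)); last first.
  have a0 : alpha p x = 0%N.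
    rewrite /alpha; case: xgetP => [j _ [[j0 xj] _]|//].
    by case: noS; exists j; rewrite j0.
  rewrite a0 leqNgt i0/=; apply/negbTE/negP => xi; apply: noS; exists i; rewrite i0//.
case: (ex_maxnP (ex_intro _ j Sj) bound) => m /andP[m0 xm] mmax.
have am : alpha p x = m.
  rewrite /alpha; case: xgetP => [y -> [[y0 xy] ymax]|/(_ m)]; last first.
    by case; split; [split|move=> k [k0 xk]; apply: mmax; rewrite k0].
  by apply/eqP; rewrite eqn_leq mmax ?y0//=; apply: ymax; split.
rewrite am; apply/idP/idP => [xi|im]; first by apply: mmax; rewrite i0.
by apply: (le_trans xm); exact: p_anti.
Qed.

Lemma alpha_le (x y : R) : 0 < x -> x <= y -> (alpha p x <= alpha p y)%N.
Proof.
move=> x0 xy; have y0 : 0 < y by exact: lt_le_trans xy.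
have [->//|a0] := posnP (alpha p x).
rewrite -alphaP//; apply: (@le_trans _ _ x^-1); first by rewrite lef_pV2.
by rewrite alphaP.
Qed.

Lemma alpha_gt0 x : (p 1%N)^-1 <= x -> (0 < alpha p x)%N.
Proof.
move=> px; have p1 := ppos 1 isT.
have x0 : 0 < x by apply: lt_le_trans px; rewrite invr_gt0.
by rewrite -alphaP// -[p 1%N]invrK lef_pV2 ?posrE ?invr_gt0.
Qed.

(** Once [x] and [c x] both exceed [1 / p 1], the power [x^theta] cancels in the quotient and slow
    variation of [L] handles the rest. *)
Lemma alpha_ratio (c : R) : 0 < c ->
  ((alpha p (c * x))%:R / (alpha p x)%:R : R) @[x --> +oo] --> c `^ theta.
Proof.
move=> c0; case: Lslow => _ /(_ c c0) Lc.
have h : (c `^ theta * (L (c * x) / L x)) @[x --> +oo] --> c `^ theta.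
  by rewrite -[X in _ --> X]mulr1; apply: cvgM => //; exact: cvg_cst.
apply: cvg_trans h; apply: near_eq_cvg; near=> x.
have x1 : (p 1%N)^-1 <= x by near: x; apply: nbhs_pinfty_ge; exact: num_real.
have x2 : (p 1%N)^-1 / c <= x by near: x; apply: nbhs_pinfty_ge; exact: num_real.
have x0 : 0 < x by near: x; apply: nbhs_pinfty_gt; exact: num_real.
rewrite !alphaE//; last by rewrite mulrC -ler_pdivrMr.
rewrite powRM ?ltW// invfM -!mulrA; congr (_ * _).
rewrite mulrCA; congr (_ * _); rewrite mulrA mulfV ?mul1r// gt_eqF// powR_gt0//.
Unshelve. all: by end_near.
Qed.

(** The midpoint of [theta] and 1: above [theta] so that the doubling inequality holds eventually,
    below 1 so that [u^(- potter_exponent)] is integrable at 0. *)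
Definition potter_exponent : R := (1 + theta) / 2.

(* Since [theta < potter_exponent], one has [alpha (2 x) <= 2 ^ potter_exponent * alpha x] for
   all large [x], and this is iterated. *)
Lemma potter_bound : exists C x0 : R, [/\ 0 <= C, 0 < x0, (p 1%N)^-1 <= x0 &
  forall t u : R, x0 <= t -> 0 < u ->
    (alpha p (t / u))%:R <= C * (u `^ (- potter_exponent) + 1) * (alpha p t)%:R].
Proof.
have /andP[t0 t1] := theta01.
set th' := potter_exponent.
have tth : theta < th' by rewrite /th' /potter_exponent; lra.
have lt2 : 2 `^ theta < 2 `^ th' :> R by rewrite /powR !gt_eqF// ltr_expR ltr_pM2r// ln_gt0// ltr1n.
have h2 : \forall x \near +oo, (alpha p (2 * x))%:R / (alpha p x)%:R <= 2 `^ th' :> R.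
  have := alpha_ratio 2 (ltr0Sn R 1); move/cvgr_le => /(_ _ lt2).
  exact.
have [A [_ hA]] := h2.
pose x0 := Num.max (A + 1) (p 1%N)^-1.
have p1 := ppos 1 isT.
have x00 : 0 < x0 by rewrite lt_max invr_gt0 p1 orbT.
have dbl x : x0 <= x -> (alpha p (2 * x))%:R <= 2 `^ th' * (alpha p x)%:R :> R.
  move=> xx; have a0 : 0 < (alpha p x)%:R :> R.
    by rewrite ltr0n alpha_gt0//; apply: le_trans xx; rewrite le_max lexx orbT.
  rewrite -ler_pdivrMr//; apply: hA; apply: lt_le_trans xx.
  by rewrite lt_max ltrDl ltr01.
have dbln n x : x0 <= x -> (alpha p (2 ^+ n * x))%:R <= (2 `^ th') ^+ n * (alpha p x)%:R :> R.
  move=> xx; elim: n => [|n IH]; first by rewrite !expr0 !mul1r.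
  have xn : x0 <= 2 ^+ n * x.
    by apply: (le_trans xx); rewrite ler_peMl ?exprn_ege1 ?ler1n// (le_trans (ltW x00)).
  rewrite exprS -mulrA; apply: (le_trans (dbl _ xn)).
  by rewrite exprS -[leRHS]mulrA ler_wpM2l ?powR_ge0.
exists (2 `^ th'), x0; split; rewrite ?powR_ge0 ?le_max ?lexx ?orbT//.
move=> t u tx u0.
have t0' : 0 < t by exact: lt_le_trans tx.
have two1 : 1 <= 2 `^ th' :> R.
  by rewrite -[leLHS](powRr0 2) ler_powR ?ler1n//; lra.
case: (leP 1 u) => u1.
  have le_a : (alpha p (t / u))%:R <= (alpha p t)%:R :> R.
    by rewrite ler_nat alpha_le ?divr_gt0// ler_pdivrMr// ler_peMr// ltW.
  apply: (le_trans le_a); rewrite ler_peMl//.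
  by apply: mulr_ege1 => //; rewrite lerDr powR_ge0.
(* The least power of 2 not below [1 / u] is at most [2 / u]; the factor 2 lost here is the constant
   [2^th'] of the bound. *)
have [n nu] : exists n, u^-1 <= 2 ^+ n /\ (2 ^+ n <= 2 * u^-1 :> R).
  have ex : exists n, u^-1 <= 2 ^+ n.
    exists (Num.truncn u^-1).+1; apply: (le_trans (ltW (truncnS_gt _))).
    by rewrite -natrX ler_nat ltnW// ltn_expl.
  exists (ex_minn ex); case: ex_minnP => -[|n] hn nmin; split=> //.
    rewrite expr0 (@le_trans _ _ u^-1) ?invf_ge1 ?(ltW u1)// ler_peMl ?invr_ge0 ?(ltW u0)//.
    by rewrite ler1n.
  rewrite exprS ler_wpM2l// ltW// ltNge; apply/negP => /nmin; by rewrite ltnn.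
apply: (@le_trans _ _ (alpha p (2 ^+ n * t))%:R).
  by rewrite ler_nat alpha_le ?divr_gt0// mulrC ler_wpM2r ?(ltW t0')//; case: nu.
apply: (le_trans (dbln n t tx)); rewrite ler_wpM2r//.
rewrite -powR_mulrn ?powR_ge0// -powRrM mulrC powRrM powR_mulrn//.
apply: (@le_trans _ _ ((2 * u^-1) `^ th')).
  apply: ge0_ler_powR; rewrite ?nnegrE ?exprn_ge0 ?mulr_ge0 ?invr_ge0 ?(ltW u0)//; last by case: nu.
  by rewrite addr_ge0 ?ler01 ?(ltW t0).
rewrite powRM ?invr_ge0 ?(ltW u0)// ler_wpM2l ?powR_ge0//.
by rewrite -(powR_inv1 (ltW u0)) -powRrM mulN1r lerDl.
Qed.

Lemma count_alpha n t u : 0 < t -> 0 < u ->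
  \sum_(i < n) (u <= t * p i.+1)%R%:R = (minn n (alpha p (t / u)))%:R :> R.
Proof.
move=> t0 u0.
transitivity ((\sum_(i < n) (i < alpha p (t / u)))%N%:R : R).
  rewrite natr_sum; apply: eq_bigr => i _; rewrite -alphaP ?divr_gt0// invf_div.
  by rewrite ler_pdivrMr// mulrC.
congr (_%:R); elim: n => [|n IH]; first by rewrite big_ord0 min0n.
rewrite big_ord_recr/= IH; case: ltnP => h; rewrite /minn; case: ltnP; lia.
Qed.

Section Kernel.
Variables (f f' : R -> R).
Hypothesis tf : tame f f'.
Hypothesis f0 : f 0 = 0.

Let df : forall x : R, is_derive x (1 : R) f (f' x). Proof. by case: tf. Qed.
Let cf' : continuous f'. Proof. by case: tf. Qed.
Let mf' : measurable_fun pos f'. Proof. by apply: measurable_pos => x _; exact: cf'. Qed.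

Let m_ind (y : R) : measurable_fun pos (fun u : R => (u <= y)%R%:R : R).
Proof.
rewrite (_ : (fun u => _) = \1_(`]-oo, y]%classic)); first exact: measurable_indic.
by apply/funext => u; rewrite indicE mem_setE/= in_itv.
Qed.

Let i_ind (y : R) : mu.-integrable pos (EFin \o (fun u => f' u * (u <= y)%R%:R)).
Proof.
have [s [C [s0 h]]] : exists s C : R, 0 < s /\ forall u : R, 0 <= u ->
    `|f u| <= C /\ `|f' u| <= C * expR (- (s * u)) by case: tf.
apply: (integrable_dominated _ (fun u => C * expR (- (s * u)))).
- exact: measurable_funM.
- by apply: integrable_scale => //; exact: integrable_expR.
- move=> u u0; apply: le_trans (h u (ltW u0)).2.
  by rewrite normrM ler_piMr//; case: (u <= y); rewrite ?normr1 ?normr0.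
Qed.

Lemma antiderivative_indicator (y : R) : 0 < y -> f y = \int[mu]_(u in pos) (f' u * (u <= y)%R%:R).
Proof.
move=> y0; have := Rintegral_FTC f f' 0 y (ltW y0) df cf'; rewrite f0 subr0 => <-.
rewrite -Rintegral_itv_obnd_cbnd; last first.
  apply: (@integrableS _ _ _ mu `[0, y]%classic) => //; first by apply: subset_itvr; rewrite bnd_simp.
  apply: continuous_compact_integrable; first exact: segment_compact.
  exact: continuous_subspaceT.
rewrite /Rintegral (_ : `]0, y]%classic = pos `&` `]-oo, y]%classic); last first.
  apply/seteqP; split=> u /=; rewrite !in_itv/= andbT; first by move/andP.
  by case=> -> ->.
rewrite integral_mkcondr; congr fine; apply: eq_integral => u _.
rewrite /patch mem_setE/= in_itv/=.
by case: (u <= y); rewrite ?mulr1 ?mulr0.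
Qed.

(* [f (t p_i)] is the integral of [f' u] over [u <= t p_i], and the number of [i <= n] with
   [u <= t p_i] is [minn n (alpha (t / u))]. *)
Lemma sum_as_integral n t : 0 < t ->
  mu.-integrable pos (EFin \o (fun u => f' u * (minn n (alpha p (t / u)))%:R)) /\
  \sum_(i < n) f (t * p i.+1) = \int[mu]_(u in pos) (f' u * (minn n (alpha p (t / u)))%:R).
Proof.
move=> t0.
have E (u : R) : 0 < u -> f' u * (minn n (alpha p (t / u)))%:R =
    \sum_(i < n) (f' u * (u <= t * p i.+1)%R%:R).
  by move=> u0; rewrite -count_alpha// mulr_sumr.
have ii := integrable_bigsum mu pos 'I_n (index_enum 'I_n)
  (fun i u => f' u * (u <= t * p i.+1)%R%:R) (measurable_itv _) (fun i => i_ind _).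
split.
  move: ii; apply: eq_integrable; first exact: measurable_itv.
  by move=> u; rewrite inE/= in_itv/= andbT => u0; rewrite /= E.
have -> : \int[mu]_(u in pos) (f' u * (minn n (alpha p (t / u)))%:R) =
    \int[mu]_(u in pos) \sum_(i < n) (f' u * (u <= t * p i.+1)%R%:R).
  by apply: eq_Rintegral => u; rewrite inE/= in_itv/= andbT => u0; rewrite E.
rewrite Rintegral_sum//.
by apply: eq_bigr => i _; apply: antiderivative_indicator; rewrite mulr_gt0 ?ppos.
Qed.

Definition alpha_transform t : R := \int[mu]_(u in pos) (f' u * (alpha p (t / u))%:R).

(** Dominated convergence twice, with multiples of the same [decay_bound]: over [n] at fixed [t],
    then over [t] after division by [alpha p t], where [alpha_ratio] gives the pointwise limit
    [f' u * u^(- theta)]. Integration by parts removes the derivative. *)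
Lemma karamata : exists x0 : R, [/\ 0 < x0, (p 1%N)^-1 <= x0,
  forall t, x0 <= t -> \sum_(i < n) f (t * p i.+1) @[n --> \oo] --> alpha_transform t &
  (alpha_transform t / (alpha p t)%:R) @[t --> +oo] -->
  \int[mu]_(u in pos) (f u * (theta * u `^ (- theta - 1)))].
Proof.
have [C [x0 [C0 x00 px0 hC]]] := potter_bound.
have [s [D [s0 h]]] : exists s C : R, 0 < s /\ forall u : R, 0 <= u ->
    `|f u| <= C /\ `|f' u| <= C * expR (- (s * u)) by case: tf.
have D0 : 0 <= D by rewrite (le_trans _ (h 0 _).1).
have /andP[t0 t1] := theta01.
have th01 : 0 <= potter_exponent < 1 by rewrite /potter_exponent; apply/andP; split; lra.
have mpos : measurable pos by exact: measurable_itv.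
have iG (c : R) : mu.-integrable pos (EFin \o (fun u => c * decay_bound s potter_exponent u)).
  by apply: integrable_scale => //; exact: integrable_decay_bound.
have dom t u (a : R) : x0 <= t -> 0 < u -> 0 <= a <= (alpha p (t / u))%:R ->
    `|f' u * a| <= D * C * (alpha p t)%:R * decay_bound s potter_exponent u.
  move=> tx u0 /andP[a0 aa]; rewrite normrM (ger0_norm a0).
  apply: (le_trans (ler_pM _ _ (h u (ltW u0)).2 (le_trans aa (hC t u tx u0)))) => //.
  by rewrite /decay_bound; rewrite le_eqVlt; apply/orP; left; apply/eqP; ring.
have lim t : x0 <= t -> mu.-integrable pos (EFin \o (fun u => f' u * (alpha p (t / u))%:R)) /\
    \sum_(i < n) f (t * p i.+1) @[n --> \oo] --> alpha_transform t.
  move=> tx; have tt : 0 < t by exact: lt_le_trans tx.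
  have mfn n : measurable_fun pos (fun u => f' u * (minn n (alpha p (t / u)))%:R).
    by have [/integrableP[/measurable_EFinP]] := sum_as_integral n t tt.
  have cfn (u : R) : pos u -> f' u * (minn n (alpha p (t / u)))%:R @[n --> \oo] -->
      f' u * (alpha p (t / u))%:R.
    move=> _; apply: cvg_near_cst; near=> n; congr (_ * _%:R).
    by apply/minn_idPr; near: n; exact: nbhs_infty_ge.
  have dfn n (u : R) : pos u -> `|f' u * (minn n (alpha p (t / u)))%:R| <=
      D * C * (alpha p t)%:R * decay_bound s potter_exponent u.
    rewrite /= in_itv/= andbT => u0; apply: dom => //.
    by rewrite ler0n ler_nat geq_minr.
  have [i1 c1] := Rdominated_cvg mu pos _ _ _ mpos mfn cfn (iG _) dfn.
  split=> //; apply: cvg_trans c1; apply: near_eq_cvg; near=> n.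
  by rewrite (sum_as_integral n t tt).2.
exists x0; split=> //; first by move=> t /lim[].
have [ip _ <-] := integration_by_parts_powR f f' theta theta01 tf f0.
apply/cvg_pinftyP => tn tninf.
(* Potter's bound holds from [x0] on. Raising the sequence to [x0] gives a bound for every index and
   changes only finitely many terms. *)
pose t' n := Num.max (tn n) x0.
have t'x n : x0 <= t' n by rewrite le_max lexx orbT.
have t'inf : t' n @[n --> \oo] --> +oo.
  apply/cvgryPge => A; move/cvgryPge: tninf => /(_ A); apply: filterS => n.
  by rewrite le_max => ->.
have at' n : 0 < (alpha p (t' n))%:R :> R.
  by rewrite ltr0n alpha_gt0//; exact: le_trans (t'x n).
have mfn n : measurable_fun pos (fun u => f' u * ((alpha p (t' n / u))%:R / (alpha p (t' n))%:R)).
  rewrite (_ : (fun u => _) = (fun u => f' u * (alpha p (t' n / u))%:R * (alpha p (t' n))%:R^-1)); last first.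
    by apply/funext => u; rewrite mulrA.
  apply: measurable_funM; last exact: measurable_cst.
  by have [/integrableP[/measurable_EFinP]] := lim _ (t'x n).
have cfn (u : R) : pos u -> f' u * ((alpha p (t' n / u))%:R / (alpha p (t' n))%:R) @[n --> \oo] -->
    f' u * u `^ (- theta).
  rewrite /= in_itv/= andbT => u0; apply: cvgM; first exact: cvg_cst.
  have := alpha_ratio u^-1; rewrite invr_gt0 => /(_ u0)/cvg_pinftyP/(_ _ t'inf).
  have -> : u `^ (- theta) = u^-1 `^ theta by rewrite -(powR_inv1 (ltW u0)) -powRrM mulN1r.
  by under eq_fun do rewrite [_ * t' _]mulrC.
have dfn n (u : R) : pos u -> `|f' u * ((alpha p (t' n / u))%:R / (alpha p (t' n))%:R)| <=
    D * C * decay_bound s potter_exponent u.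
  rewrite /= in_itv/= andbT => u0.
  rewrite mulrA normrM normfV (gtr0_norm (at' n)) ler_pdivrMr//.
  apply: (le_trans (dom (t' n) u (alpha p (t' n / u))%:R (t'x n) u0 _)); first by rewrite ler0n lexx.
  by rewrite le_eqVlt; apply/orP; left; apply/eqP; ring.
have [_ c2] := Rdominated_cvg mu pos _ _ _ mpos mfn cfn (iG _) dfn.
apply: cvg_trans c2; apply: near_eq_cvg; near=> n.
have -> : t' n = tn n.
  by apply/max_idPl; near: n; move/cvgryPge: tninf; exact.
rewrite /alpha_transform mulrC -RintegralZl//; last first.
  apply: (lim _ _).1; near: n; move/cvgryPge: tninf; exact.
by apply: eq_Rintegral => u _; rewrite [LHS]mulrA [LHS]mulrC.
Unshelve. all: by end_near.
Qed.

End Kernel.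
End RegularVariation.

(** * The limit theorem *)

Lemma counting_lt_nat {R : realType} (S : set nat) (n : nat) :
  (counting S < n%:R%:E :> \bar R)%E -> exists2 k, (k < n)%N & counting S = (k%:R%:E : \bar R).
Proof.
rewrite /counting; case: asboolP => // _; rewrite lte_fin ltr_nat => h.
by eexists; first exact: h.
Qed.

Lemma covariance_indic {R : realType} {d} {W : measurableType d} (P : probability W R)
    (E F : set W) : measurable E -> measurable F ->
  covariance P (\1_E : W -> R) (\1_F : W -> R) =
    (\int[P]_w ((\1_E w - pr P E) * (\1_F w - pr P F)))%R%:E /\
  \int[P]_w ((\1_E w - pr P E) * (\1_F w - pr P F)) = pr P (E `&` F) - pr P E * pr P F.
Proof.
move=> mE mF.
have EE (G : set W) : measurable G -> fine ('E_P[\1_G : W -> R])%E = pr P G.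
  by move=> mG; rewrite unlock integral_indic// setIT.
have ii (G : set W) : measurable G -> P.-integrable setT (EFin \o (\1_G : W -> R)).
  exact: integrable_indic_prob.
split.
  rewrite covariance.unlock !EE//.
  rewrite (_ : _ * _ = fun w => (\1_E w - pr P E) * (\1_F w - pr P F))// expectationE//.
  apply: (bounded_integrable P _ ((1 + `|pr P E|) * (1 + `|pr P F|))).
    by apply: measurable_funM; apply: measurable_funB => //; exact: measurable_indic.
  move=> w; rewrite normrM; apply: ler_pM => //; apply: (le_trans (ler_normB _ _)); rewrite lerD2r indicE;
    by case: (_ \in _); rewrite ?normr1 ?normr0.
transitivity (\int[P]_w (\1_(E `&` F) w + (- pr P F * \1_E w + (- pr P E * \1_F w + pr P E * pr P F)))).
  apply: eq_Rintegral => w _; rewrite indicI /=; ring.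
have ic (G : set W) (c : R) : measurable G -> P.-integrable setT (EFin \o (fun w => c * \1_G w)).
  by move=> mG; apply: integrable_scale => //; exact: (ii G mG).
have mEF := measurableI _ _ mE mF.
have h3 := integrable_cst_prob P (pr P E * pr P F).
have h2 := integrable_add P setT _ _ measurableT (ic F (- pr P E) mF) h3.
have h1 := integrable_add P setT _ _ measurableT (ic E (- pr P F) mE) h2.
rewrite (RintegralD _ (ii _ mEF) h1)// (RintegralD _ (ic E (- pr P F) mE) h2)//.
rewrite (RintegralD _ (ic F (- pr P E) mF) h3)//.
rewrite !RintegralZl//; try exact: ii; try exact: integrable_cst_prob.
rewrite Rintegral_cst// -/(pr P setT) prT !Rintegral_indic_prob//; rewrite -/(pr P E) -/(pr P F) -/(pr P _); ring.
Qed.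

(** * Probabilities of few points as functions of the dilation *)

Section FewPoints.
Context {R : realType} {d : measure_display} {W : measurableType d}.
Variables (P : probability W R) (T : nat -> W -> R).
Hypothesis mT : forall j, measurable_fun setT (T j).
Hypothesis Tp : unit_poisson_process P T.

Definition few (A : set R) (k : nat) (u : R) : set W :=
  [set w | (PiB T (dilate u A) w < k%:R%:E)%E].

Lemma measurable_few A k u : 0 < u -> measurable A -> measurable (few A k u).
Proof.
move=> u0 mA; have := measurable_PiB T mT (dilate u A) (measurable_dilate u A u0 mA).
move=> mP; rewrite (_ : few A k u = PiB T (dilate u A) @^-1` `]-oo, k%:R%:E[%classic).
  by apply: preimage_measurable => //; exact: emeasurable_itv.
by apply/seteqP; split=> w; rewrite /few /= in_itv.
Qed.

Section Family.
Variables (J : finType) (A : J -> set R) (k : J -> nat).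
Hypothesis mA : forall j, measurable (A j).
Hypothesis A01 : forall j, A j `<=` `[0, 1].
Hypothesis k0 : forall j, (0 < k j)%N.

(** Few points in every [A j] bound the counts of all atoms, so the probability is an exact finite
    sum of products of Poisson weights with parameters proportional to [u]. At [u = 0] only zero
    counts survive, and they meet the thresholds because [k j > 0]. *)
Lemma tame_few : exists F : R -> R, [/\ is_tame F, F 0 = 1 &
  forall u, 0 < u -> pr P [set w | forall j, few (A j) (k j) u w] = F u].
Proof.
pose lam (a : {set J}) := fine (lebesgue_measure (atom J A a)).
have matom a := measurable_atom J A mA a.
have latom a : lebesgue_measure (atom J A a) = (lam a)%:E.
  rewrite /lam fineK// ge0_fin_numE//.
  apply: (@le_lt_trans _ _ (lebesgue_measure `[(0 : R), 1])).
    by apply: le_measure; rewrite ?inE//; [exact: matom|exact: atom01].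
  by rewrite lebesgue_measure_itv/= lte01 sube0 ltry.
have lam0 a : 0 <= lam a by exact: fine_ge0.
pose K := (\max_j k j).+1.
pose V : set ({set J} -> \bar R) := [set nu |
  forall j, (\sum_(a : {set J} | j \in a) nu a < (k j)%:R%:E)%E].
exists (fun u => cell_sum {set J} (fun a => poi (lam a * u)) K V); split.
- apply: is_tame_sum => x; apply: is_tame_prod => a; exact: is_tame_poi.
- have poi0 n : poi (0 : R) n = (n == 0%N)%:R.
    rewrite /poi oppr0 expR0 mul1r expr0n; case: n => [|n]; rewrite ?divr1//= mul0r//.
  rewrite /cell_sum (bigD1 [ffun => ord0])/=.
    rewrite big1 => [|a _]; last by rewrite mulr0 poi0 ffunE.
    rewrite big1 ?addr0// => x /andP[_ xn].
    have [a xa] : exists a, x a != ord0.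
      apply/existsP; apply: contraNT xn => /existsPn h; apply/eqP/ffunP => a; rewrite ffunE.
      by have := h a; rewrite negbK => /eqP.
    by rewrite (bigD1 a)//= mulr0 poi0 (_ : (x a : nat) == 0%N = false) ?mul0r//; apply/negbTE.
  apply/andP; split; first by apply/forallP => a; rewrite ffunE.
  apply/asboolP => j; rewrite big1 => [|a _]; last by rewrite ffunE.
  by rewrite lte_fin ltr0n.
- move=> u u0; pose B a := dilate u (atom J A a).
  have tB : trivIset setT B.
    move=> a b _ _ [x [/(dilateP _ _ _ u0) ha /(dilateP _ _ _ u0) hb]].
    by apply: (trivIset_atom J A) => //; exists (x / u).
  have sumE j w : PiB T (dilate u (A j)) w = (\sum_(a : {set J} | j \in a) PiB T (B a) w)%E.
    rewrite /PiB -counting_partition; last first.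
      by move=> a b _ _ [i [ha hb]]; apply: tB => //; exists (T i w).
    congr counting; rewrite [in LHS](set_atoms J A j); apply/seteqP; split=> i /=.
      by move=> [x [a ja ax] E]; exists a => //=; exists x.
    by move=> [a ja] /= [x ax E]; exists x => //; exists a.
  have PiB0 a w : (0 <= PiB T (B a) w)%E by exact: measure_ge0.
  rewrite -(PiB_law_truncated P T mT Tp {set J} B (fun a => lam a * u)).
  + congr pr; apply/seteqP; split=> w h j; first by rewrite -sumE; exact: h.
    by rewrite /few /= sumE; exact: h.
  + by move=> a; exact: measurable_dilate.
  + move=> a; apply: dilate_ge0 => // x /(atom01 J A A01); rewrite /= !in_itv/=.
    by case/andP => ->.
  + exact: tB.
  + by move=> a; rewrite lebesgue_measure_dilate// latom mulrC.
  (* The atom indexed by the empty set is empty by definition, so its count is 0; any other atom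
     lies in some [A j] and inherits its threshold. *)
  + move=> w Vw a; have [->|/finset.set0Pn[j ja]] := eqVneq a finset.set0.
      exists 0%N => //; rewrite /PiB (_ : [set i | _] = set0) ?measure0//.
      by apply/seteqP; split=> // i [x [/eqP]].
    have lt : (PiB T (B a) w < (k j)%:R%:E)%E.
      apply: le_lt_trans (Vw j); rewrite (bigD1 a)//= leeDl// sume_ge0//.
    have [n nk nE] := counting_lt_nat _ _ lt; exists n; last exact: nE.
    by apply: (leq_trans nk); rewrite leqW// (leq_bigmax_cond j).
Qed.

End Family.

Variables (m : nat) (A : 'I_m -> set R) (k : 'I_m -> nat).
Hypothesis mA : forall j, measurable (A j).
Hypothesis A01 : forall j, A j `<=` `[0, 1].
Hypothesis k0 : forall j, (0 < k j)%N.

Definition few_cov (j l : 'I_m) (u : R) : R :=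
  fine (covariance P (\1_(few (A j) (k j) u) : W -> R) (\1_(few (A l) (k l) u) : W -> R)).

(** The joint event is a family indexed by [bool], so that [j = l] needs no separate case. The value
    at 0 is [1 - 1 * 1 = 0]. Agreement is stated for [u > 0], where the sums and the integral
    live. *)
Lemma tame_few_cov j l : exists h h', [/\ tame h h', h 0 = 0 &
  forall u, 0 < u -> few_cov j l u = h u].
Proof.
pose pick2 (b : bool) := if b then j else l.
have [F [tF F0 FE]] := tame_few bool (A \o pick2) (k \o pick2) (fun b => mA _)
  (fun b => A01 _) (fun b => k0 _).
have [F1 [tF1 F10 F1E]] := tame_few unit (fun=> A j) (fun=> k j) (fun b => mA _)
  (fun b => A01 _) (fun b => k0 _).
have [F2 [tF2 F20 F2E]] := tame_few unit (fun=> A l) (fun=> k l) (fun b => mA _)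
  (fun b => A01 _) (fun b => k0 _).
have [h' th] := is_tame_sub _ _ tF (is_tame_mul _ _ tF1 tF2).
exists (fun x => F x - F1 x * F2 x), h'; split=> //.
  by rewrite F0 F10 F20 mulr1 subrr.
move=> u u0; rewrite -FE// -F1E// -F2E//.
have [mj ml] := (measurable_few (A j) (k j) u u0 (mA j), measurable_few (A l) (k l) u u0 (mA l)).
rewrite /few_cov; have [-> ->] := covariance_indic P _ _ mj ml.
congr (pr P _ - pr P _ * pr P _); apply/seteqP; split=> w //.
- by move=> [hj hl] [].
- by move=> h; split; [exact: (h true)|exact: (h false)].
- by move=> h _.
- by move=> h; exact: (h tt).
- by move=> h _.
- by move=> h; exact: (h tt).
Qed.

End FewPoints.

(** * The number of hit urns and its mean *)

Section UrnCounts.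
Context {R : realType} {d : measure_display} {W : measurableType d}.
Variables (P : probability W R) (X : nat -> W -> nat) (T : nat -> W -> R) (p : nat -> R).
Hypothesis mX : forall j, measurable_fun setT (X j).
Hypothesis mT : forall j, measurable_fun setT (T j).
Hypothesis Xindep : mutually_independent P X.
Hypothesis Xlaw : forall j i, (0 < i)%N -> P [set w | X j w = i] = (p i)%:E.
Hypothesis ppos : forall i, (0 < i)%N -> 0 < p i.
Hypothesis Tp : unit_poisson_process P T.
Hypothesis TX : independent_families P T X.

Lemma sum_p_le1 n : \sum_(i < n) p i.+1 <= 1.
Proof.
have := label_prob_sum P X mX n; rewrite big_ord_recl => <-.
rewrite -[leLHS]add0r; apply: lerD; first exact: pr_ge0.
by apply: ler_sum => i _; rewrite (label_prob_urn P X p Xlaw)// lift0.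
Qed.

Lemma pr_complement (E : set W) : measurable E -> pr P (~` E) = 1 - pr P E.
Proof.
by move=> mE; rewrite /pr probability_setC// fineB// fin_num_measure.
Qed.

(** A marginal of [urn_bits_independent]: trivial predicates on the preceding urns make their
    factors 1. *)
Lemma urn_bits_law (J : finType) (A : J -> set R) (c : J -> \bar R) (t : R) i
    (Q : pred {ffun J -> bool}) :
  (forall j, measurable (A j)) -> (forall j, A j `<=` `[0, 1]) -> 0 < t ->
  pr P [set w | Q (urn_bits X T J A c t i.+1 w)] =
  pr P [set w | Q (point_bits T J A c (p i.+1 * t) w)].
Proof.
move=> mA A01 t0.
have := urn_bits_independent P X T p mX mT Xindep Xlaw ppos Tp TX i.+1 J A c mA A01 t
  (fun j : 'I_i.+1 => if j == ord_max then Q else predT) t0.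
rewrite big_ord_recr/= eqxx big1 ?mul1r => [<-|j _]; last first.
  rewrite ifF; first by rewrite (_ : [set w | _] = setT) ?prT//; apply/seteqP.
  by apply/eqP => /(congr1 val)/= E; have := ltn_ord j; rewrite E ltnn.
congr pr; apply/seteqP; split=> w /=.
  by move=> h j; case: eqP => // ->.
by move=> /(_ ord_max); rewrite eqxx.
Qed.

Section OneSet.
Variables (A : set R) (k : nat).
Hypothesis mA : measurable A.
Hypothesis A01 : A `<=` `[0, 1].
Hypothesis k0 : (0 < k)%N.

Definition hit t i := [set w | (k%:R%:E <= PiBi X T i (dilate t A) w)%E].

Let hit_bits t i : hit t i =
  [set w | urn_bits X T unit (fun=> A) (fun=> k%:R%:E) t i w tt].
Proof. by apply/seteqP; split=> w; rewrite /= ffunE. Qed.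

Lemma measurable_hit t i : 0 < t -> measurable (hit t i).
Proof.
move=> t0; rewrite hit_bits.
have mP : measurable_fun setT (PiBi X T i (dilate t A) : W -> \bar R).
  apply: measurable_counting => n; apply: measurableI.
    by apply: preimage_measurable => //; exact: measurable_dilate.
  exact: (preimage_measurable (X n) [set i]).
have := measurable_thresholds (fun _ : unit => PiBi X T i (dilate t A) : W -> \bar R)
  (fun=> k%:R%:E) (fun x => x tt) (fun=> mP).
exact.
Qed.

Lemma pr_hit t i : 0 < t -> pr P (hit t i.+1) = 1 - pr P (few T A k (p i.+1 * t)).
Proof.
move=> t0; have pt : 0 < p i.+1 * t by rewrite mulr_gt0 ?ppos.
rewrite hit_bits (urn_bits_law unit (fun=> A) (fun=> k%:R%:E) t i (fun x => x tt))//.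
rewrite -pr_complement; last exact: measurable_few.
congr pr; apply/seteqP; split=> w; rewrite /few /= ffunE ?leNgt ltNge; first by move/negP.
by move/negP; rewrite negbK.
Qed.

(** Since [k > 0], absence of points is enough, and its probability [exp (- u |A|)] is at least
    [1 - u |A|] with [|A| <= 1]. The resulting bound on hits is summable over the urns. *)
Lemma pr_few_ge u : 0 < u -> 1 - u <= pr P (few T A k u).
Proof.
move=> u0; have mD := measurable_dilate u A u0 mA.
have lA1 : (lebesgue_measure A <= 1)%E.
  rewrite (_ : 1%E = lebesgue_measure `[(0 : R), 1]%classic).
    by apply: le_measure; rewrite ?inE.
  by rewrite lebesgue_measure_itv/= lte01 sube0.
have lfin : lebesgue_measure A \is a fin_num.
  by rewrite ge0_fin_numE// (le_lt_trans lA1)// ltry.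
have lD : lebesgue_measure (dilate u A) = (u * fine (lebesgue_measure A))%:E.
  by rewrite lebesgue_measure_dilate// EFinM fineK.
case: Tp => _ law _; have := law (dilate u A) mD.
have D0 : dilate u A `<=` `[0, +oo[.
  by apply: dilate_ge0 => // x /A01; rewrite /= !in_itv/= => /andP[->].
move=> /(_ D0); rewrite lD ltry => /(_ isT 0%N) /=.
rewrite expr0 fact0 mulr1 divr1 => E0.
apply: (@le_trans _ _ (expR (- (u * fine (lebesgue_measure A))))).
  apply: le_trans (expR_ge1Dx _); rewrite lerD2l lerN2 ler_piMr ?(ltW u0)//.
  by rewrite -lee_fin fineK.
rewrite -lee_fin -E0.
rewrite -prE; last exact: measurable_few.
apply: le_measure; rewrite ?inE.
- have mP := measurable_PiB T mT _ mD.
  rewrite (_ : [set w | _] = PiB T (dilate u A) @^-1` [set 0%:R%:E])//.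
  by apply: preimage_measurable => //; exact: emeasurable_set1.
- exact: measurable_few.
- by move=> w h; rewrite /few /= h lte_fin ltr0n.
Qed.

Lemma pr_hit_le t i : 0 < t -> pr P (hit t i.+1) <= t * p i.+1.
Proof.
move=> t0; rewrite pr_hit// lerBlDr -lerBlDl mulrC.
by apply: pr_few_ge; rewrite mulr_gt0 ?ppos.
Qed.

Definition hits (t : R) (n : nat) (w : W) : R := \sum_(i < n) \1_(hit t i.+1) w.

(** Index 0 is not an urn and contributes nothing to the counting measure, hence the shift. *)
Lemma urnsE t w : urns X T (dilate t A) k w = (\sum_(i <oo) (\1_(hit t i.+1) w)%:E)%E.
Proof.
rewrite /urns counting_dirac nneseries_recl//.
rewrite diracE memNset ?add0e => [|[]//].
rewrite -(nneseries_addn 1%N); last by move=> i; rewrite diracE.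
apply: eq_eseriesr => i _; rewrite addn1 diracE indicE; congr ((nat_of_bool _)%:R%:E).
by apply/idP/idP => [/set_mem[_ h]|/set_mem h]; apply: mem_set.
Qed.

Lemma measurable_urns t : 0 < t -> measurable_fun setT (urns X T (dilate t A) k : W -> \bar R).
Proof.
move=> t0; apply: measurable_counting => i; apply: measurableI; last exact: measurable_hit.
suff : measurable [set _ : W | (0 < i)%N] by [].
by case: (0 < i)%N; [rewrite set_true|rewrite set_false].
Qed.

Lemma integral_urns t : 0 < t ->
  (\int[P]_w urns X T (dilate t A) k w = \sum_(i <oo) (pr P (hit t i.+1))%:E)%E /\
  (\int[P]_w urns X T (dilate t A) k w <= t%:E)%E.
Proof.
move=> t0.
have E : (\int[P]_w urns X T (dilate t A) k w = \sum_(i <oo) (pr P (hit t i.+1))%:E)%E.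
  rewrite (eq_integral (fun w => \sum_(i <oo) (\1_(hit t i.+1) w)%:E)%E); last first.
    by move=> w _; exact: urnsE.
  rewrite integral_nneseries//; last first.
    by move=> i; apply/measurable_EFinP; apply: measurable_indic; exact: measurable_hit.
  apply: eq_eseriesr => i _.
  rewrite integral_indic// ?setIT; first by rewrite -prE//; exact: measurable_hit.
  exact: measurable_hit.
split=> //; rewrite E; apply: lime_le; first by apply: is_cvg_nneseries => i _ _; rewrite lee_fin pr_ge0.
near=> n; rewrite big_mkord sumEFin lee_fin.
apply: (@le_trans _ _ (\sum_(i < n) t * p i.+1)); first by apply: ler_sum => i _; exact: pr_hit_le.
by rewrite -mulr_sumr ler_piMr ?(ltW t0)// sum_p_le1.
Unshelve. all: by end_near.
Qed.

Lemma integrable_urns t : 0 < t ->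
  P.-integrable setT (urns X T (dilate t A) k : W -> \bar R).
Proof.
move=> t0; apply/integrableP; split; first exact: measurable_urns.
rewrite (eq_integral (urns X T (dilate t A) k)) => [|w _]; last by rewrite gee0_abs// /urns measure_ge0.
by apply: (le_lt_trans (integral_urns t t0).2); rewrite ltry.
Qed.

Definition urn_number (t : R) (w : W) : R := fine (urns X T (dilate t A) k w).

(** [fine] sends an infinite number of hit urns to 0, so convergence of [hits] to [urn_number] is
    claimed on this event only. It has full probability because the mean number is at most [t]. *)
Definition finitely_many t := [set w | urns X T (dilate t A) k w < +oo]%E.

Lemma measurable_finitely_many t : 0 < t -> measurable (finitely_many t).
Proof.
move=> t0; rewrite (_ : finitely_many t = urns X T (dilate t A) k @^-1` [set y | y < +oo]%E)//.
apply: preimage_measurable; first exact: measurable_urns.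
by rewrite (_ : [set y | _] = `]-oo, +oo%E[%classic);
  [exact: emeasurable_itv|apply/seteqP; split=> y; rewrite /= in_itv].
Qed.

Lemma finitely_many_ae t : 0 < t -> P (~` finitely_many t) = 0%E.
Proof.
move=> t0; have [N [mN PN sub]] := integrable_ae measurableT (integrable_urns t t0).
apply/eqP; rewrite eq_le measure_ge0 andbT -PN.
apply: le_measure; rewrite ?inE//; first by apply: measurableC; exact: measurable_finitely_many.
apply: subset_trans sub => w /= h h'; apply: h; rewrite /finitely_many /= ltey_eq.
by rewrite h'.
Qed.

Lemma measurable_urn_number t : 0 < t -> measurable_fun setT (urn_number t).
Proof.
move=> t0; apply: (@measurableT_comp _ _ _ _ _ _ fine); last exact: measurable_urns.
exact: fine_measurable.
Qed.

Lemma integrable_urn_number t : 0 < t -> P.-integrable setT (EFin \o urn_number t).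
Proof.
move=> t0; apply: (le_integrable measurableT _ _ (integrable_urns t t0)).
  by apply/measurable_EFinP; exact: measurable_urn_number.
move=> w _ /=; rewrite /urn_number; by case: (urns _ _ _ _ _) => [r| |]; rewrite /= ?leey ?lexx.
Qed.

Lemma hits_cvg t w : finitely_many t w ->
  hits t n w @[n --> \oo] --> urn_number t w.
Proof.
move=> fw; have fin : urns X T (dilate t A) k w \is a fin_num.
  by rewrite ge0_fin_numE// /urns measure_ge0.
apply: (@fine_cvg _ _ _ _ (fun n => (hits t n w)%:E)); rewrite fineK// urnsE.
have -> : (fun n => (hits t n w)%:E) = (fun n => \sum_(0 <= i < n) (\1_(hit t i.+1) w)%:E)%E.
  by apply/funext => n; rewrite big_mkord sumEFin.
by apply: is_cvg_nneseries => i _ _; rewrite lee_fin.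
Qed.

Lemma hits_le t n w : finitely_many t w -> hits t n w <= urn_number t w.
Proof.
move=> fw; have fin : urns X T (dilate t A) k w \is a fin_num.
  by rewrite ge0_fin_numE// /urns measure_ge0.
rewrite -lee_fin /urn_number fineK// urnsE.
have := @nneseries_lim_ge R (fun i => (\1_(hit t i.+1) w)%:E) xpredT 0 n.
by rewrite big_mkord sumEFin; apply => i _ _; rewrite lee_fin.
Qed.

Lemma hits_ge0 t n w : 0 <= hits t n w.
Proof. exact: sumr_ge0. Qed.

Lemma measurable_hits t n : 0 < t -> measurable_fun setT (hits t n).
Proof. by move=> t0; apply: measurable_sum => i; apply: measurable_indic; exact: measurable_hit. Qed.

Lemma expectation_hits t n : 0 < t ->
  \int[P]_w hits t n w = \sum_(i < n) pr P (hit t i.+1).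
Proof.
move=> t0; rewrite Rintegral_sum//; last first.
  by move=> i; apply: integrable_indic_prob; exact: measurable_hit.
by apply: eq_bigr => i _; rewrite Rintegral_indic_prob//; exact: measurable_hit.
Qed.

(** On the full event [finitely_many] the partial sums are bounded by their limit [urn_number],
    which is integrable and serves as dominating function. *)
Lemma expectation_urn_number t : 0 < t ->
  \sum_(i < n) pr P (hit t i.+1) @[n --> \oo] --> \int[P]_w urn_number t w.
Proof.
move=> t0; pose F := finitely_many t; have mF := measurable_finitely_many t t0.
have restrict (f : W -> R) : P.-integrable setT (EFin \o f) ->
    \int[P]_w f w = \int[P]_(w in F) f w.
  move=> fi; rewrite /Rintegral (negligible_integral _ _ fi (finitely_many_ae t t0))//; last first.
    exact: measurableC.
  by rewrite setTD setCK.
rewrite restrict; last exact: integrable_urn_number.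
have ih n : P.-integrable setT (EFin \o hits t n).
  apply: (bounded_integrable P _ n%:R); first exact: measurable_hits.
  move=> w; rewrite ger0_norm ?hits_ge0// /hits.
  rewrite -[n in leRHS]card_ord -sumr_const; apply: ler_sum => i _.
  by rewrite indicE; case: (_ \in _).
rewrite (_ : (fun n => _) = (fun n => \int[P]_(w in F) hits t n w)); last first.
  by apply/funext => n; rewrite -expectation_hits// restrict.
apply: (Rdominated_cvg P F _ (urn_number t) (urn_number t) mF _ _ _ _).2.
- by move=> n; apply: measurable_funTS; exact: measurable_hits.
- by move=> w; exact: hits_cvg.
- by apply: integrableS (integrable_urn_number t t0).
- by move=> n w Fw; rewrite ger0_norm ?hits_ge0// hits_le.
Qed.

End OneSet.
End UrnCounts.

(** * Gaussian approximation at a fixed time *)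

Section FixedTime.
Context {R : realType} {d : measure_display} {W : measurableType d}.
Variables (P : probability W R) (X : nat -> W -> nat) (T : nat -> W -> R) (p : nat -> R).
Hypothesis mX : forall j, measurable_fun setT (X j).
Hypothesis mT : forall j, measurable_fun setT (T j).
Hypothesis Xindep : mutually_independent P X.
Hypothesis Xlaw : forall j i, (0 < i)%N -> P [set w | X j w = i] = (p i)%:E.
Hypothesis ppos : forall i, (0 < i)%N -> 0 < p i.
Hypothesis Tp : unit_poisson_process P T.
Hypothesis TX : independent_families P T X.
Variables (m : nat) (A : 'I_m -> set R) (k : 'I_m -> nat).
Hypothesis mA : forall j, measurable (A j).
Hypothesis A01 : forall j, A j `<=` `[0, 1].
Hypothesis k0 : forall j, (0 < k j)%N.
Variables (t s : R) (c : 'I_m -> R).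
Hypothesis t0 : 0 < t.
Hypothesis s0 : 0 < s.
Hypothesis cs : \sum_j `|c j| <= s.

Let cc (j : 'I_m) : \bar R := (k j)%:R%:E.
Let N j : W -> R := urn_number X T (A j) (k j) t.
Let xi i w := urn_bits X T 'I_m A cc t i.+1 w.
Let pb i w := point_bits T 'I_m A cc (p i.+1 * t) w.
Let pi i x := pr P [set w | pb i w = x].
Let fw j i := few T (A j) (k j) (p i.+1 * t).
Let mean j i := pr P (hit X T (A j) (k j) t i.+1).
(** The centred contribution of urn [i.+1], as a function of its bits; the normalisation [s] will be
    the square root of [M t]. *)
Let g i (x : {ffun 'I_m -> bool}) := (\sum_j c j * ((x j)%:R - mean j i)) / s.

Let pt0 i : 0 < p i.+1 * t. Proof. by rewrite mulr_gt0// ppos. Qed.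

Let mfw j i : measurable (fw j i).
Proof. exact: measurable_few. Qed.

Let mhit j i : measurable (hit X T (A j) (k j) t i).
Proof. exact: measurable_hit. Qed.

Let mxi i x : measurable [set w | xi i w = x].
Proof.
have mP j : measurable_fun setT (PiBi X T i.+1 (dilate t (A j)) : W -> \bar R).
  apply: measurable_counting => n; apply: measurableI.
    by apply: preimage_measurable => //; exact: measurable_dilate.
  exact: (preimage_measurable (X n) [set i.+1]).
have := measurable_thresholds (fun j => PiBi X T i.+1 (dilate t (A j)) : W -> \bar R) cc
  (pred1 x) mP.
by congr measurable; apply/seteqP; split=> w /= /eqP.
Qed.

Let mpb i x : measurable [set w | pb i w = x].
Proof.
have mP j : measurable_fun setT (PiB T (dilate (p i.+1 * t) (A j)) : W -> \bar R).
  by apply: measurable_PiB => //; exact: measurable_dilate.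
have := measurable_thresholds (fun j => PiB T (dilate (p i.+1 * t) (A j)) : W -> \bar R) cc
  (pred1 x) mP.
by congr measurable; apply/seteqP; split=> w /= /eqP.
Qed.

Let indep n (x : nat -> {ffun 'I_m -> bool}) :
  pr P [set w | forall i, (i < n)%N -> xi i w = x i] = \prod_(i < n) pi i (x i).
Proof.
have := urn_bits_independent P X T p mX mT Xindep Xlaw ppos Tp TX n 'I_m A cc mA A01 t
  (fun i : 'I_n => pred1 (x i)) t0.
rewrite (_ : [set w | forall i : 'I_n, _] = [set w | forall i, (i < n)%N -> xi i w = x i]).
  move=> ->; apply: eq_bigr => i _; congr pr; apply/seteqP; split=> w /=; first by move/eqP.
  by move=> h; apply/eqP.
apply/seteqP; split=> w /= h i; first by move=> ni; apply/eqP; exact: (h (Ordinal ni)).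
by apply/eqP; exact: h.
Qed.

Let pi_sum i : \sum_x pi i x = 1.
Proof.
rewrite -(pr_partitionT P (pb i) predT); last exact: mpb.
by rewrite (_ : [set w | _] = setT) ?prT//; apply/seteqP.
Qed.

Let meanE j i : mean j i = 1 - pr P (fw j i).
Proof. by rewrite /mean (pr_hit P X T p). Qed.

(** Being hit is the complement of having few points, so centring flips the sign; the variance does
    not see it. This is why [Kstar] can be written with few-point events. *)
Let g_pb i w : g i (pb i w) = - (\sum_j c j * (\1_(fw j i) w - pr P (fw j i))) / s.
Proof.
rewrite /g; congr (_ / _); rewrite -sumrN; apply: eq_bigr => j _; rewrite meanE /pb ffunE.
rewrite indicE /fw -mulrN; congr (_ * _); rewrite leNgt.
have -> : (w \in few T (A j) (k j) (p i.+1 * t)) =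
    (PiB T (dilate (p i.+1 * t) (A j)) w < cc j)%E.
  by apply/idP/idP => [/set_mem|h]; last exact: mem_set.
by case: (_ < _)%E => /=; ring.
Qed.

Let iind (E : set W) : measurable E -> P.-integrable setT (EFin \o (fun w => \1_E w - pr P E)).
Proof.
move=> mE; apply: integrable_sub => //; [exact: integrable_indic_prob|exact: integrable_cst_prob].
Qed.

Let iind2 (E F : set W) : measurable E -> measurable F ->
  P.-integrable setT (EFin \o (fun w => (\1_E w - pr P E) * (\1_F w - pr P F))).
Proof.
move=> mE mF; apply: (bounded_integrable P _ ((1 + `|pr P E|) * (1 + `|pr P F|))).
  by apply: measurable_funM; apply: measurable_funB => //; exact: measurable_indic.
move=> w; rewrite normrM; apply: ler_pM => //; apply: (le_trans (ler_normB _ _)); rewrite lerD2r indicE;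
  by case: (_ \in _); rewrite ?normr1 ?normr0.
Qed.

Let Eind (E : set W) : measurable E -> \int[P]_w (\1_E w - pr P E) = 0.
Proof.
move=> mE; rewrite RintegralB//.
- by rewrite Rintegral_cst// -/(pr P setT) prT mulr1 Rintegral_indic_prob// subrr.
- exact: integrable_indic_prob.
- exact: integrable_cst_prob.
Qed.

Let centered i : \sum_x pi i x * g i x = 0.
Proof.
transitivity (\sum_x g i x * pr P [set w | pb i w = x]).
  by apply: eq_bigr => x _; rewrite mulrC.
rewrite -(Rintegral_finite_valued P (pb i) (g i) (mpb i)).
transitivity (\int[P]_w \sum_j (- c j / s * (\1_(fw j i) w - pr P (fw j i)))).
  apply: eq_Rintegral => w _; rewrite g_pb mulNr mulr_suml -sumrN.
  by apply: eq_bigr => j _; rewrite mulrAC !mulNr.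
rewrite Rintegral_sum//; last by move=> j; apply: integrable_scale => //; exact: iind.
rewrite big1// => j _; rewrite RintegralZl//; last exact: iind.
by rewrite Eind ?mulr0.
Qed.

Let step_varE i : step_var pi g i =
  qform m (fun j l => few_cov P T m A k j l (p i.+1 * t)) c / s ^+ 2.
Proof.
rewrite /step_var.
transitivity (\sum_x g i x ^+ 2 * pr P [set w | pb i w = x]).
  by apply: eq_bigr => x _; rewrite mulrC.
rewrite -(Rintegral_finite_valued P (pb i) (fun x => g i x ^+ 2) (mpb i)).
transitivity (\int[P]_w \sum_j \sum_l (c j * c l / s ^+ 2 *
    ((\1_(fw j i) w - pr P (fw j i)) * (\1_(fw l i) w - pr P (fw l i))))).
  apply: eq_Rintegral => w _; rewrite g_pb mulNr sqrrN expr_div_n expr2 !mulr_suml.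
  apply: eq_bigr => j _; rewrite mulr_sumr mulr_suml; apply: eq_bigr => l _.
  by ring.
have i2 j l : P.-integrable setT (EFin \o (fun w => c j * c l / s ^+ 2 *
    ((\1_(fw j i) w - pr P (fw j i)) * (\1_(fw l i) w - pr P (fw l i))))).
  by apply: integrable_scale => //; exact: iind2.
rewrite Rintegral_sum//; last by move=> j; exact: integrable_bigsum.
rewrite /qform mulr_suml; apply: eq_bigr => j _; rewrite Rintegral_sum// mulr_suml.
apply: eq_bigr => l _; rewrite RintegralZl//; last exact: iind2.
rewrite /few_cov (covariance_indic P _ _ (mfw j i) (mfw l i)).1 /= mulrAC //.
Qed.

Let partial_sumE n w : partial_sum xi g n w =
  \sum_j c j * ((hits X T (A j) (k j) t n w - \sum_(i < n) mean j i) / s).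
Proof.
rewrite /partial_sum /g -mulr_suml exchange_big/= mulr_suml; apply: eq_bigr => j _.
rewrite -mulr_sumr -mulrA; congr (_ * (_ / _)); rewrite sumrB; congr (_ - _).
apply: eq_bigr => i _; rewrite /xi ffunE indicE; congr ((nat_of_bool _)%:R).
by apply/idP/idP => [h|/set_mem//]; apply: mem_set.
Qed.

Let mean01 j i : 0 <= mean j i <= 1.
Proof. by rewrite pr_ge0 pr_le1. Qed.

Let g_le i x : `|g i x| <= (\sum_j `|c j|) / s.
Proof.
rewrite /g normrM normfV (gtr0_norm s0) ler_pM2r ?invr_gt0//.
apply: (le_trans (ler_norm_sum _ _ _)); apply: ler_sum => j _; rewrite normrM ler_piMr//.
by have /andP[a b] := mean01 j i; case: (x j); rewrite /= ler_norml; apply/andP; split; lra.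
Qed.

Let Z w := \sum_j c j * ((N j w - \int[P]_w' N j w') / s).
Let F := \bigcap_(j in [set: 'I_m]) finitely_many X T (A j) (k j) t.

Let mF : measurable F.
Proof. by apply: fin_bigcap_measurable => // j _; exact: measurable_finitely_many. Qed.

Let F_ae : P (~` F) = 0%E.
Proof.
pose G n := if insub n is Some j then ~` finitely_many X T (A j) (k j) t else set0.
have mG n : measurable (G n).
  rewrite /G; case: insub => [j|]; last exact: measurable0.
  by apply: measurableC; exact: measurable_finitely_many.
have G0 n : P (G n) = 0%E.
  rewrite /G; case: insub => [j|]; last exact: measure0.
  exact: (finitely_many_ae P X T p).
have -> : ~` F = \bigcup_n G n.
  rewrite /F setC_bigcap; apply/seteqP; split=> w [j _ h].
    by exists j => //; rewrite /G valK.
  by move: h; rewrite /G; case: insub => [i h|//]; exists i.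
apply/negligibleP; first exact: bigcup_measurable.
by apply: negligible_bigcup => n; apply/negligibleP; [exact: mG|exact: G0].
Qed.

Let over_F (f : W -> R) : P.-integrable setT (EFin \o f) ->
  \int[P]_w f w = \int[P]_(w in F) f w.
Proof.
move=> fi; rewrite /Rintegral (negligible_integral _ _ fi F_ae)//; last exact: measurableC.
by rewrite setTD setCK.
Qed.

Let Z_cvg w : F w -> partial_sum xi g n w @[n --> \oo] --> Z w.
Proof.
move=> Fw; rewrite (_ : (fun n => _) = fun n =>
  \sum_j c j * ((hits X T (A j) (k j) t n w - \sum_(i < n) mean j i) / s)).
  rewrite /Z; apply: cvg_bigsum => j.
  apply: cvgM; first exact: cvg_cst.
  apply: cvgM; last exact: cvg_cst.
  apply: cvgB; first by apply: hits_cvg; exact: Fw.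
  exact: (expectation_urn_number P X T p).
by apply/funext => n; exact: partial_sumE.
Qed.

Let mean_sum_le j n : \sum_(i < n) mean j i <= t.
Proof.
apply: (@le_trans _ _ (\sum_(i < n) t * p i.+1)).
  by apply: ler_sum => i _; exact: (pr_hit_le P X T p).
by rewrite -mulr_sumr ler_piMr ?(ltW t0)// (sum_p_le1 P X p).
Qed.

(** A majorant uniform in [n]: the hits are at most [N j], and the partial sums of the means at most
    [t]. *)
Let dom w := \sum_j `|c j| * ((N j w + t) / s).

Let integrable_dom : P.-integrable setT (EFin \o dom).
Proof.
apply: integrable_bigsum => // j; apply: integrable_scale => //.
under eq_fun do rewrite mulrC; apply: integrable_scale => //.
apply: integrable_add => //; first exact: (integrable_urn_number P X T p).
exact: integrable_cst_prob.
Qed.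

Let partial_sum_dom n w : F w -> `|partial_sum xi g n w| <= dom w.
Proof.
move=> Fw; rewrite partial_sumE; apply: (le_trans (ler_norm_sum _ _ _)); apply: ler_sum => j _.
rewrite !normrM ler_wpM2l// normfV (gtr0_norm s0) ler_pM2r ?invr_gt0//.
apply: (le_trans (ler_normB _ _)); apply: lerD.
  by rewrite ger0_norm ?hits_ge0// hits_le//; exact: Fw.
rewrite ger0_norm//; by apply: sumr_ge0 => i _; case/andP: (mean01 j i).
Qed.

Let mZ : measurable_fun setT Z.
Proof.
apply: measurable_sum => j; apply: measurable_funM => //; apply: measurable_funM => //.
by apply: measurable_funB => //; exact: measurable_urn_number.
Qed.

Variable V : R.
Hypothesis V_cvg :
  (\sum_(i < n) qform m (fun j l => few_cov P T m A k j l (p i.+1 * t)) c) / s ^+ 2 @[n --> \oo] --> V.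

Let step_var_cvg : \sum_(i < n) step_var pi g i @[n --> \oo] --> V.
Proof.
rewrite (_ : (fun n => _) = (fun n => (\sum_(i < n) qform m
  (fun j l => few_cov P T m A k j l (p i.+1 * t)) c) / s ^+ 2))//.
by apply/funext => n; rewrite mulr_suml; apply: eq_bigr => i _; exact: step_varE.
Qed.

Let mcos phi (f : W -> R) : measurable_fun setT f -> measurable_fun setT (fun w => cos (phi + f w)).
Proof.
move=> mf; apply: measurableT_comp; first exact: (continuous_measurable_fun (@continuous_cos R)).
exact: measurable_funD.
Qed.

Let icos phi (f : W -> R) : measurable_fun setT f ->
  P.-integrable setT (EFin \o (fun w => cos (phi + f w))).
Proof.
by move=> mf; apply: (bounded_integrable P _ 1); [exact: mcos|move=> w; exact: cos_max].
Qed.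

(** Lindeberg's bound for [n] urns with [delta = (sum_j |c j|) / s]: each indicator lies within 1 of
    its mean, and [cs] gives [delta <= 1]. Both sides then pass to the limit in [n]. *)
Theorem urn_numbers_near_gaussian phi :
  `|\int[P]_w cos (phi + \sum_j c j * ((N j w - \int[P]_w' N j w') / s)) -
    cos phi * expR (- (V / 2))| <= (\sum_j `|c j|) / s * V.
Proof.
rewrite -/Z.
have c1 : \int[P]_w cos (phi + partial_sum xi g n w) @[n --> \oo] --> \int[P]_w cos (phi + Z w).
  rewrite over_F; last exact: icos.
  rewrite (_ : (fun n => _) = fun n => \int[P]_(w in F) cos (phi + partial_sum xi g n w)).
    have dF n w : F w -> `|cos (phi + partial_sum xi g n w)| <= 1 by move=> _; exact: cos_max.
    have mFn n : measurable_fun F (fun w => cos (phi + partial_sum xi g n w)).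
      by apply: measurable_funTS; apply: mcos; exact: measurable_partial_sum.
    have cF w : F w -> cos (phi + partial_sum xi g n w) @[n --> \oo] --> cos (phi + Z w).
      move=> Fw; apply: (cvg_comp (fun n => phi + partial_sum xi g n w) cos); last exact: continuous_cos.
      by apply: cvgD; [exact: cvg_cst|exact: Z_cvg].
    have i1 : P.-integrable F (EFin \o (fun _ : W => 1 : R)).
      by apply: (integrableS measurableT) => //; exact: integrable_cst_prob.
    exact: (Rdominated_cvg P F _ _ _ mF mFn cF i1 dF).2.
  by apply/funext => n; rewrite over_F//; apply: icos; exact: measurable_partial_sum.
have d01 : 0 <= (\sum_j `|c j|) / s <= 1.
  by rewrite divr_ge0 ?sumr_ge0 ?(ltW s0)//= ler_pdivrMr// mul1r.
have bound n := expectation_partial_sum_cos P xi pi mxi indep g (fun i x => pr_ge0 P _)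
  pi_sum centered _ n phi d01 g_le.
have c2 : `|\int[P]_w cos (phi + partial_sum xi g n w) -
    cos phi * expR (- ((\sum_(i < n) step_var pi g i) / 2))| @[n --> \oo] -->
    `|\int[P]_w cos (phi + Z w) - cos phi * expR (- (V / 2))|.
  apply: cvg_norm; apply: cvgB => //; apply: cvgM; first exact: cvg_cst.
  apply: (cvg_comp (fun n => - ((\sum_(i < n) step_var pi g i) / 2)) expR);
    last exact: continuous_expR.
  by apply: cvgN; apply: cvgM => //; exact: cvg_cst.
have c3 : (\sum_j `|c j|) / s * \sum_(i < n) step_var pi g i @[n --> \oo] -->
    (\sum_j `|c j|) / s * V by apply: cvgM => //; exact: cvg_cst.
apply: (ler_cvg_to c2 c3); near=> n; exact: bound.
Unshelve. all: by end_near.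
Qed.

(** [|z| <= 1 + z^2] is applied to the partial sums, whose second moments are sums of step
    variances, and then [n --> oo]. *)
Theorem urn_numbers_tight :
  \int[P]_w `|\sum_j c j * ((N j w - \int[P]_w' N j w') / s)| <= 1 + V.
Proof.
rewrite -/Z.
have mps n := measurable_partial_sum xi mxi g n.
have ips n : P.-integrable setT (EFin \o (fun w => `|partial_sum xi g n w|)).
  have [C hC] := bounded_partial_sum xi g n; apply: (bounded_integrable P _ C).
    exact: measurableT_comp.
  by move=> w; rewrite normr_id.
have iZ : P.-integrable setT (EFin \o (fun w => `|Z w|)).
  apply: (integrable_abse (f := EFin \o Z)).
  apply: integrable_bigsum => // j; apply: integrable_scale => //.
  under eq_fun do rewrite mulrC; apply: integrable_scale => //.
  apply: integrable_sub => //; first exact: (integrable_urn_number P X T p).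
  exact: integrable_cst_prob.
have c1 : \int[P]_w `|partial_sum xi g n w| @[n --> \oo] --> \int[P]_w `|Z w|.
  rewrite over_F//.
  rewrite (_ : (fun n => _) = fun n => \int[P]_(w in F) `|partial_sum xi g n w|).
    have mFn n : measurable_fun F (fun w => `|partial_sum xi g n w|).
      by apply: measurable_funTS; exact: measurableT_comp.
    have cF w : F w -> `|partial_sum xi g n w| @[n --> \oo] --> `|Z w|.
      by move=> Fw; apply: cvg_norm; exact: Z_cvg.
    have dF n w : F w -> `| `|partial_sum xi g n w| | <= dom w.
      by move=> Fw; rewrite normr_id; exact: partial_sum_dom.
    have i1 := integrableS measurableT mF (@subsetT _ F) integrable_dom.
    exact: (Rdominated_cvg P F _ _ _ mF mFn cF i1 dF).2.
  by apply/funext => n; rewrite over_F.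
have c2 : 1 + \sum_(i < n) step_var pi g i @[n --> \oo] --> 1 + V.
  by apply: cvgD => //; exact: cvg_cst.
apply: (ler_cvg_to c1 c2); near=> n.
have -> : \sum_(i < n) step_var pi g i = \int[P]_w (0 + partial_sum xi g n w) ^+ 2.
  by rewrite (expectation_partial_sum_sqr P xi pi mxi indep g pi_sum centered) expr0n add0r.
have isq : P.-integrable setT (EFin \o (fun w => (0 + partial_sum xi g n w) ^+ 2)).
  have [C hC] := bounded_partial_sum xi g n; apply: (bounded_integrable P _ (C ^+ 2)).
    by apply: measurable_funX; exact: measurable_funD.
  move=> w; rewrite add0r normrX; apply: lerXn2r; rewrite ?nnegrE//.
  by apply: le_trans (hC w).
have i1 := integrable_cst_prob P 1.
have -> : 1 + \int[P]_w (0 + partial_sum xi g n w) ^+ 2 =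
    \int[P]_w (1 + (0 + partial_sum xi g n w) ^+ 2).
  by rewrite RintegralD// Rintegral_cst// -/(pr P setT) prT mulr1.
apply: le_Rintegral => //.
  exact: integrable_add.
move=> w _; rewrite add0r -real_normK ?num_real//.
have := normr_ge0 (partial_sum xi g n w); nra.
Unshelve. all: by end_near.
Qed.

End FixedTime.

(** * Asymptotics as time tends to infinity *)

Section Limit.
Context {R : realType} {d : measure_display} {W : measurableType d}.
Variables (P : probability W R) (X : nat -> W -> nat) (T : nat -> W -> R) (p : nat -> R).
Variables (theta : R) (L : R -> R).
Hypothesis mX : forall j, measurable_fun setT (X j).
Hypothesis mT : forall j, measurable_fun setT (T j).
Hypothesis Xindep : mutually_independent P X.
Hypothesis Xlaw : forall j i, (0 < i)%N -> P [set w | X j w = i] = (p i)%:E.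
Hypothesis ppos : forall i, (0 < i)%N -> 0 < p i.
Hypothesis pdecr : forall i, (0 < i)%N -> p i.+1 <= p i.
Hypothesis Tp : unit_poisson_process P T.
Hypothesis TX : independent_families P T X.
Hypothesis theta01 : 0 < theta < 1.
Hypothesis Lslow : slowly_varying L.
Hypothesis alphaE : forall x, (p 1%N)^-1 <= x -> (alpha p x)%:R = x `^ theta * L x.

Let psum : forall n, \sum_(i < n) p i.+1 <= 1 := sum_p_le1 P X p mX Xlaw.
Let unit_set : set R := `[0, 1]%classic.
Let munit : measurable unit_set. Proof. exact: measurable_itv. Qed.

Let M := meanM P X T.

Lemma dilate_unit (t : R) : 0 < t -> dilate t unit_set = `[0, t]%classic.
Proof.
move=> t0; rewrite dilate_preimage//; apply/seteqP; split=> x;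
  by rewrite /unit_set /= !in_itv/= ler_pdivrMr// mul1r pmulr_lge0 ?invr_gt0.
Qed.

Lemma pr_few_unit (u : R) : 0 < u -> pr P (few T unit_set 1 u) = expR (- u).
Proof.
move=> u0; case: Tp => _ law _; have mD := measurable_dilate u _ u0 munit.
have := law (dilate u unit_set) mD; rewrite {1}dilate_unit//.
have -> : lebesgue_measure (dilate u unit_set) = u%:E.
  by rewrite dilate_unit// lebesgue_measure_itv/= lte_fin u0 sube0.
move=> /(_ _ (ltry _) 0%N) /=; rewrite expr0 fact0 mulr1 divr1 => E.
rewrite /pr (_ : few T unit_set 1 u = [set w | PiB T (dilate u unit_set) w = 0%E]).
  by rewrite E//; apply: subset_itvl; rewrite bnd_simp.
apply/seteqP; split=> w; rewrite /few /=; last by move=> ->; rewrite lte_fin ltr01.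
by move=> /counting_lt_nat[n]; rewrite ltnS leqn0 => /eqP ->.
Qed.

Lemma meanM_cvg (t : R) : 0 < t -> \sum_(i < n) (1 - expR (- (t * p i.+1))) @[n --> \oo] --> M t.
Proof.
move=> t0.
have sub1 : unit_set `<=` `[0, 1] by [].
have := expectation_urn_number P X T p mX mT Xindep Xlaw ppos Tp TX unit_set 1 munit sub1 isT t t0.
have -> : \int[P]_w urn_number X T unit_set 1 t w = M t.
  rewrite /M /meanM expectationE/=; last first.
    have := integrable_urn_number P X T p mX mT Xindep Xlaw ppos Tp TX unit_set 1 munit sub1 isT t t0.
    by rewrite /urn_number dilate_unit.
  by rewrite /urn_number dilate_unit.
rewrite (_ : (fun n => _) = (fun n => \sum_(i < n) (1 - expR (- (t * p i.+1)))))//.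
apply/funext => n; apply: eq_bigr => i _.
rewrite (pr_hit P X T p)//.
by rewrite pr_few_unit ?mulr_gt0 ?ppos// mulrC.
Qed.

Lemma tame_exp : tame (fun u : R => 1 - expR (- u)) (fun u => expR (- u)).
Proof.
have de (x : R) : is_derive x (1 : R) (fun x : R => expR (- x)) (- expR (- x)).
  have := @is_derive1_comp _ expR -%R x _ _ (is_derive_expR _) (is_deriveNid _ _).
  by rewrite mulrN1.
split.
- move=> x; have := is_deriveB (is_derive_cst (1 : R) x (1 : R)) (de x).
  by rewrite sub0r opprK.
- by move=> x; apply: continuous_comp; [exact: opp_continuous|exact: continuous_expR].
- exists (1 : R), (1 : R); split=> [//|u u0]; have e0 := expR_ge0 (- u).
  have e1 : expR (- u) <= 1 by rewrite -[leRHS]expR0 ler_expR oppr_le0.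
  by rewrite !mul1r; split; rewrite ger0_norm//; lra.
Qed.

(** The kernel [1 - exp (- u)] has derivative [exp (- u)], so integration by parts turns the limit
    of [karamata] into the Gamma integral at [1 - theta]. *)
Lemma meanM_ratio : M t / (alpha p t)%:R @[t --> +oo] --> Gamma (1 - theta).
Proof.
have f0 : 1 - expR (- (0 : R)) = 0 by rewrite oppr0 expR0 subrr.
have [x0 [x00 _ lim ratio]] := karamata p theta L ppos pdecr psum theta01 Lslow alphaE _ _ tame_exp f0.
have [_ _ ibp] := integration_by_parts_powR _ _ _ theta01 tame_exp f0.
have -> : Gamma (1 - theta) = \int[lebesgue_measure]_(u in (`]0, +oo[%classic : set R))
    ((1 - expR (- u)) * (theta * u `^ (- theta - 1))).
  rewrite -ibp /Gamma; apply: eq_Rintegral => u _.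
  by rewrite mulrC (_ : 1 - theta - 1 = - theta)//; ring.
apply: cvg_trans ratio; apply: near_eq_cvg; near=> t; congr (_ / _).
have tx : x0 <= t by near: t; apply: nbhs_pinfty_ge; exact: num_real.
by apply: (cvg_unique _ (lim t tx)) => //; apply: meanM_cvg; exact: lt_le_trans tx.
Unshelve. all: by end_near.
Qed.

(* The urns with [t * p i >= 1] are [alpha p t] in number, each contributing at least
   [1 - exp (-1)] to the mean. *)
Lemma meanM_ge (t : R) : 0 < t -> (1 - expR (- 1)) * (alpha p t)%:R <= M t.
Proof.
move=> t0; have c := meanM_cvg t t0.
have inc : nondecreasing_seq (fun n => \sum_(i < n) (1 - expR (- (t * p i.+1)))).
  apply/nondecreasing_seqP => n; rewrite big_ord_recr/= lerDl subr_ge0.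
  by rewrite -[leRHS]expR0 ler_expR oppr_le0 mulr_ge0 ?(ltW t0)// ltW// ppos.
have := nondecreasing_cvgn_le inc (cvgP _ c) (alpha p t); rewrite (cvg_lim _ c)//.
apply: le_trans; rewrite mulr_natr -[X in _ *+ X]card_ord -sumr_const; apply: ler_sum => i _.
rewrite lerD2l lerN2 ler_expR lerN2 mulrC -ler_pdivrMr// mul1r.
by rewrite (alphaP p pdecr psum)//.
Qed.

Lemma one_minus_exp_gt0 : 0 < 1 - expR (- 1) :> R.
Proof. by rewrite subr_gt0 -[ltRHS]expR0 ltr_expR oppr_lt0 ltr01. Qed.

Lemma alpha_cvgy : (alpha p t)%:R @[t --> +oo] --> (+oo : set_system R).
Proof.
apply/cvgryPge => B; have [i Bi] : exists i, B <= i.+1%:R.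
  exists (Num.truncn B); exact: ltW (truncnS_gt _).
have pi0 := ppos i.+1 isT; near=> t.
have tp : (p i.+1)^-1 <= t by near: t; apply: nbhs_pinfty_ge; exact: num_real.
have t0 : 0 < t by apply: lt_le_trans tp; rewrite invr_gt0.
apply: (le_trans Bi); rewrite ler_nat -(alphaP p pdecr psum)//.
by rewrite -[leRHS]invrK lef_pV2 ?posrE ?invr_gt0.
Unshelve. all: by end_near.
Qed.

Lemma meanM_cvgy : M t @[t --> +oo] --> (+oo : set_system R).
Proof.
apply/cvgryPge => B; near=> t.
have t0 : 0 < t by near: t; apply: nbhs_pinfty_gt; exact: num_real.
apply: le_trans (meanM_ge t t0); rewrite mulrC -ler_pdivrMr ?one_minus_exp_gt0//.
by near: t; move/cvgryPge: alpha_cvgy; exact.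
Unshelve. all: by end_near.
Qed.

(** Positivity is read off the limit: [M t / alpha p t] stays above [1 - exp (- 1)]. *)
Lemma Gamma_gt0 : 0 < Gamma (1 - theta).
Proof.
apply: (lt_le_trans one_minus_exp_gt0).
apply: (ler_cvg_to (cvg_cst (1 - expR (-1))) meanM_ratio); near=> t.
have t0 : 0 < t by near: t; apply: nbhs_pinfty_gt; exact: num_real.
rewrite ler_pdivlMr ?meanM_ge//.
by near: t; move/cvgryPge: alpha_cvgy => /(_ 1); apply: filterS => t; exact: lt_le_trans.
Unshelve. all: by end_near.
Qed.

Variables (m : nat) (A : 'I_m -> set R) (k : 'I_m -> nat).
Hypothesis mA : forall j, measurable (A j).
Hypothesis A01 : forall j, A j `<=` `[0, 1].
Hypothesis k0 : forall j, (0 < k j)%N.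

Let K j l := Kstar P T theta (A j) (k j) (A l) (k l).
Let fc j l u := few_cov P T m A k j l u.

Lemma covariance_sums : exists v : R -> 'I_m -> 'I_m -> R,
  (\forall t \near +oo, forall j l, \sum_(i < n) fc j l (p i.+1 * t) @[n --> \oo] --> v t j l) /\
  forall j l, v t j l / M t @[t --> +oo] --> K j l.
Proof.
have H (jl : 'I_m * 'I_m) : exists v : R -> R,
    (\forall t \near +oo, \sum_(i < n) fc jl.1 jl.2 (p i.+1 * t) @[n --> \oo] --> v t) /\
    v t / M t @[t --> +oo] --> K jl.1 jl.2.
  case: jl => j l /=; have [h [h' [th h0 hE]]] := tame_few_cov P T mT Tp m A k mA A01 k0 j l.
  have [x0 [x00 px0 lim ratio]] := karamata p theta L ppos pdecr psum theta01 Lslow alphaE _ _ th h0.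
  exists (alpha_transform p h'); split.
    near=> t; have tx : x0 <= t by near: t; apply: nbhs_pinfty_ge; exact: num_real.
    rewrite (_ : (fun n => _) = (fun n => \sum_(i < n) h (t * p i.+1))); first exact: lim.
    apply/funext => n; apply: eq_bigr => i _.
    by rewrite /fc hE ?mulr_gt0 ?ppos 1?mulrC// (lt_le_trans x00).
  have -> : K j l = (\int[lebesgue_measure]_(u in (`]0, +oo[%classic : set R))
      (h u * (theta * u `^ (- theta - 1)))) / Gamma (1 - theta).
    rewrite /K /Kstar mulrC; congr (_ / _); apply: eq_Rintegral => u.
    by rewrite inE/= in_itv/= andbT => u0; rewrite -hE.
  have G0 : Gamma (1 - theta) != 0 by rewrite gt_eqF// Gamma_gt0.
  have lim2 : (alpha_transform p h' t / (alpha p t)%:R) * (M t / (alpha p t)%:R)^-1 @[t --> +oo] -->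
      (\int[lebesgue_measure]_(u in (`]0, +oo[%classic : set R))
        (h u * (theta * u `^ (- theta - 1)))) / Gamma (1 - theta).
    by apply: cvgM => //; apply: cvgV => //; exact: meanM_ratio.
  apply: cvg_trans lim2; apply: near_eq_cvg; near=> t.
  have px : (p 1%N)^-1 <= t by near: t; apply: nbhs_pinfty_ge; exact: num_real.
  have a0 : (alpha p t)%:R != 0 :> R.
    by rewrite pnatr_eq0 -lt0n; exact: (alpha_gt0 p ppos pdecr psum).
  by rewrite invf_div mulrA divfK.
have [v hv] := choice H.
exists (fun t j l => v (j, l) t); split; last by move=> j l; exact: (hv (j, l)).2.
apply: filter_forall => j; apply: filter_forall => l; exact: (hv (j, l)).1.
Unshelve. all: by end_near.
Qed.

Let Zst t i w := Ystar P X T t (A i) (k i) w.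

Lemma YstarE (t : R) i w : 0 < t -> Zst t i w =
  (urn_number X T (A i) (k i) t w - \int[P]_w' urn_number X T (A i) (k i) t w') / Num.sqrt (M t).
Proof.
move=> t0; rewrite /Zst /Ystar expectationE//.
exact: (integrable_urn_number P X T p mX mT Xindep Xlaw ppos Tp TX).
Qed.

Lemma sqrt_meanM (B : R) : \forall t \near +oo, [/\ 0 < t, 0 < M t & B <= Num.sqrt (M t)].
Proof.
near=> t; have Mb : B ^+ 2 + 1 <= M t by near: t; move/cvgryPge: meanM_cvgy; exact.
have B2 := sqr_ge0 B.
split; first by near: t; apply: nbhs_pinfty_gt; exact: num_real.
  by apply: lt_le_trans Mb; rewrite ltr_wpDl.
apply: le_trans (ler_norm _) _; rewrite -sqrtr_sqr ler_wsqrtr//.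
by apply: le_trans Mb; rewrite lerDl.
Unshelve. all: by end_near.
Qed.

(** [V t] is the form of the covariance sums at time [t] divided by [M t]. The fixed-time bounds
    apply with [s = Num.sqrt (M t)], which eventually exceeds [sum_j |c j|]. *)
Lemma variance_limit (c : 'I_m -> R) : exists V : R -> R,
  [/\ V t @[t --> +oo] --> qform m K c,
      \forall t \near +oo, forall phi, `|\int[P]_w cos (phi + \sum_j c j * Zst t j w) -
        cos phi * expR (- (V t / 2))| <= (\sum_j `|c j|) / Num.sqrt (M t) * V t &
      \forall t \near +oo, \int[P]_w `|\sum_j c j * Zst t j w| <= 1 + V t].
Proof.
have [v [vs vK]] := covariance_sums.
pose V t := qform m (v t) c / M t; exists V.
have VK : V t @[t --> +oo] --> qform m K c.
  rewrite (_ : (fun t => _) = (fun t => \sum_j \sum_l c j * c l * (v t j l / M t))); last first.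
    apply/funext => t; rewrite /V /qform mulr_suml; apply: eq_bigr => j _.
    by rewrite mulr_suml; apply: eq_bigr => l _; rewrite mulrA.
  apply: cvg_bigsum => j; apply: cvg_bigsum => l.
  by apply: cvgM; [exact: cvg_cst|exact: vK].
have Vs : \forall t \near +oo,
    (\sum_(i < n) qform m (fun j l => fc j l (p i.+1 * t)) c) / Num.sqrt (M t) ^+ 2 @[n --> \oo] --> V t.
  near=> t; have [t0 M0 _] : [/\ 0 < t, 0 < M t & 0 <= Num.sqrt (M t)].
    by near: t; exact: sqrt_meanM.
  rewrite /V sqr_sqrtr ?(ltW M0)//; apply: cvgM; last exact: cvg_cst.
  rewrite (_ : (fun n => _) = (fun n => \sum_j \sum_l c j * c l * \sum_(i < n) fc j l (p i.+1 * t))).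
    have ht : forall j l, \sum_(i < n) fc j l (p i.+1 * t) @[n --> \oo] --> v t j l by near: t.
    apply: cvg_bigsum => j; apply: cvg_bigsum => l.
    by apply: cvgM; [exact: cvg_cst|exact: ht].
  apply/funext => n; rewrite /qform exchange_big/=; apply: eq_bigr => j _.
  by rewrite exchange_big/=; apply: eq_bigr => l _; rewrite mulr_sumr.
split=> //; near=> t.
  have [t0 M0 Bs] : [/\ 0 < t, 0 < M t & \sum_j `|c j| <= Num.sqrt (M t)].
    by near: t; exact: sqrt_meanM.
  have s0 : 0 < Num.sqrt (M t) by rewrite sqrtr_gt0.
  have hV : (\sum_(i < n) qform m (fun j l => fc j l (p i.+1 * t)) c) / Num.sqrt (M t) ^+ 2
    @[n --> \oo] --> V t by near: t.
  move=> phi; under eq_Rintegral do under eq_bigr do rewrite YstarE//.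
  exact: (urn_numbers_near_gaussian P X T p mX mT Xindep Xlaw ppos Tp TX m A k mA A01 k0
    t (Num.sqrt (M t)) c t0 s0 Bs (V t) hV phi).
have [t0 M0 _] : [/\ 0 < t, 0 < M t & 0 <= Num.sqrt (M t)].
  by near: t; exact: sqrt_meanM.
have s0 : 0 < Num.sqrt (M t) by rewrite sqrtr_gt0.
have hV : (\sum_(i < n) qform m (fun j l => fc j l (p i.+1 * t)) c) / Num.sqrt (M t) ^+ 2
  @[n --> \oo] --> V t by near: t.
under eq_Rintegral do under eq_bigr do rewrite YstarE//.
exact: (urn_numbers_tight P X T p mX mT Xindep Xlaw ppos Tp TX m A k mA A01 k0
  t (Num.sqrt (M t)) c t0 s0 (V t) hV).
Unshelve. all: by end_near.
Qed.

Lemma Kstar_sym i j : K i j = K j i.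
Proof.
rewrite /K /Kstar; congr (_ * _); apply: eq_Rintegral => u _.
by rewrite covarianceC.
Qed.

Lemma inv_sqrt_meanM (B : R) : B / Num.sqrt (M t) @[t --> +oo] --> (0 : R).
Proof.
apply/cvgrPdist_le => e e0; near=> t.
have [t0 M0 h] : [/\ 0 < t, 0 < M t & `|B| / e <= Num.sqrt (M t)].
  by near: t; exact: sqrt_meanM.
have s0 : 0 < Num.sqrt (M t) by rewrite sqrtr_gt0.
rewrite sub0r normrN normrM normfV (gtr0_norm s0) ler_pdivrMr// mulrC.
by rewrite -ler_pdivrMr.
Unshelve. all: by end_near.
Qed.

(** The error bound of [variance_limit] dominates an absolute value, so it is nonnegative. For
    nonzero [c] its factor in front of [V t] is positive, hence [V t >= 0] for large [t], and the
    limit inherits the sign. *)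
Lemma Kstar_psd c : 0 <= qform m K c.
Proof.
have [V [VK Vcos _]] := variance_limit c.
have [B0|B0] := eqVneq (\sum_j `|c j|) 0.
  have c0 j : c j = 0.
    have /eqP := B0; rewrite psumr_eq0// => /allP/(_ j (mem_index_enum _))/=.
    by rewrite normr_eq0 => /eqP.
  by rewrite /qform big1// => i _; rewrite big1// => j _; rewrite c0 !mul0r.
apply: (ler_cvg_to (cvg_cst 0) VK); near=> t.
have [t0 M0 _] : [/\ 0 < t, 0 < M t & 0 <= Num.sqrt (M t)] by near: t; exact: sqrt_meanM.
have hV : forall phi, `|\int[P]_w cos (phi + \sum_j c j * Zst t j w) -
        cos phi * expR (- (V t / 2))| <= (\sum_j `|c j|) / Num.sqrt (M t) * V t by near: t.
have := le_trans (normr_ge0 _) (hV 0); rewrite pmulr_rge0// divr_gt0 ?sqrtr_gt0//.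
by rewrite lt_neqAle eq_sym B0 sumr_ge0.
Unshelve. all: by end_near.
Qed.

Lemma cos_limit c phi :
  \int[P]_w cos (phi + \sum_j c j * Zst t j w) @[t --> +oo] -->
  cos phi * expR (- qform m K c / 2).
Proof.
have [V [VK Vcos _]] := variance_limit c.
have e1 : cos phi * expR (- (V t / 2)) @[t --> +oo] --> cos phi * expR (- qform m K c / 2).
  apply: cvgM; first exact: cvg_cst.
  apply: (cvg_comp (fun t => - (V t / 2)) expR); last exact: continuous_expR.
  rewrite mulNr; apply: cvgN; apply: cvgM => //; exact: cvg_cst.
have e2 : \int[P]_w cos (phi + \sum_j c j * Zst t j w) - cos phi * expR (- (V t / 2))
    @[t --> +oo] --> (0 : R).
  apply: (cvg_dist_bound _ (fun t => (\sum_j `|c j|) / Num.sqrt (M t) * V t)).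
    by apply: filterS Vcos => t /(_ phi); rewrite subr0.
  by rewrite -(mul0r (qform m K c)); apply: cvgM => //; exact: inv_sqrt_meanM.
rewrite -[X in _ --> X]add0r.
rewrite (_ : (fun t => _) = (fun t => (\int[P]_w cos (phi + \sum_j c j * Zst t j w) -
  cos phi * expR (- (V t / 2))) + cos phi * expR (- (V t / 2)))); first exact: cvgD.
by apply/funext => t; rewrite subrK.
Qed.

Lemma measurable_Ystar (t : R) i : 0 < t -> measurable_fun setT (Zst t i).
Proof.
move=> t0; rewrite (_ : Zst t i = fun w => (urn_number X T (A i) (k i) t w -
  \int[P]_w' urn_number X T (A i) (k i) t w') / Num.sqrt (M t)).
  apply: measurable_funM => //; apply: measurable_funB => //.
  exact: (measurable_urn_number X T mX mT).
by apply/funext => w; exact: YstarE.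
Qed.

(** With [c] the indicator of [i], the first moment is at most [1 + V t], and eventually
    [V t <= K i i + 1]. *)
Lemma Ystar_tight : \forall t \near +oo, forall i,
  P.-integrable setT (EFin \o Zst t i) /\ \int[P]_w `|Zst t i w| <= 2 + \sum_j `|K j j|.
Proof.
apply: filter_forall => i; pose c j : R := (j == i)%:R.
have [V [VK _ Vt]] := variance_limit c.
have Kc : qform m K c = K i i by exact: qform_delta.
near=> t.
have t0 : 0 < t by near: t; apply: nbhs_pinfty_gt; exact: num_real.
split.
  rewrite (_ : EFin \o Zst t i = EFin \o (fun w => (Num.sqrt (M t))^-1 *
    (urn_number X T (A i) (k i) t w - \int[P]_w' urn_number X T (A i) (k i) t w'))).
    apply: integrable_scale => //; apply: integrable_sub => //.
      exact: (integrable_urn_number P X T p mX mT Xindep Xlaw ppos Tp TX).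
    exact: integrable_cst_prob.
  by apply/funext => w /=; rewrite YstarE// mulrC.
have Vb : V t <= K i i + 1.
  near: t; move: VK; rewrite Kc => /cvgr_le; apply; by rewrite ltrDl.
have hV : \int[P]_w `|\sum_j c j * Zst t j w| <= 1 + V t by near: t.
have -> : \int[P]_w `|Zst t i w| = \int[P]_w `|\sum_j c j * Zst t j w|.
  by apply: eq_Rintegral => w _; rewrite sum_delta.
apply: (le_trans hV); have : K i i <= \sum_j `|K j j|; last by lra.
rewrite (bigD1 i)//=; apply: (le_trans (ler_norm _)); by rewrite lerDl sumr_ge0.
Unshelve. all: by end_near.
Qed.

Lemma urn_clt : exists (d' : measure_display) (W' : measurableType d')
    (P' : probability W' R) (Y : 'I_m -> {RV P' >-> R}),
  [/\ gaussian_vector P' (fun i => Y i : W' -> R),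
      (forall i, 'E_P'[Y i] = 0)%E,
      (forall i j, covariance P' (Y i) (Y j) = (K i j)%:E) &
      weakly_converges P P' Zst (fun i => Y i : W' -> R)].
Proof.
have [d' [W' [P' [Y [Ycos Yg Yi Y0 Ycov]]]]] := gaussian_vector_exists m K Kstar_sym Kstar_psd.
exists d', W', P', Y; split=> //.
(* Measurability is established for [t > 0] only, while the criterion asks for it at every [t]; the
   change elsewhere does not affect the limit at infinity. *)
pose Z' (t : R) i w := if 0 < t then Zst t i w else 0.
have Z'E t : 0 < t -> Z' t = Zst t by rewrite /Z' => ->.
have conv : weakly_converges P P' Z' (fun i => Y i : W' -> R).
  apply: (weak_convergence_of_trig P P' Z' (fun i => Y i : W' -> R) (2 + \sum_j `|K j j|)) => //.
  - move=> t i; have [t0|t0] := boolP (0 < t); first by rewrite Z'E//; exact: measurable_Ystar.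
    by rewrite (_ : Z' t i = cst 0)//; apply/funext => w; rewrite /Z' (negbTE t0).
  - near=> t; have t0 : 0 < t by near: t; apply: nbhs_pinfty_gt; exact: num_real.
    by rewrite Z'E//; near: t; exact: Ystar_tight.
  - move=> c phi; rewrite Ycos; apply: cvg_trans (cos_limit c phi).
    apply: near_eq_cvg; near=> t.
    have t0 : 0 < t by near: t; apply: nbhs_pinfty_gt; exact: num_real.
    by rewrite Z'E.
move=> f cf bf; apply: cvg_trans (conv f cf bf); apply: near_eq_cvg; near=> t.
have t0 : 0 < t by near: t; apply: nbhs_pinfty_gt; exact: num_real.
by rewrite Z'E.
Unshelve. all: by end_near.
Qed.

End Limit.

Theorem theorem1 (R : realType) (d : measure_display) (W : measurableType d)
    (P : probability W R) (X : nat -> {RV P >-> nat}) (T : nat -> {RV P >-> R})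
    (p : nat -> R)
    (Xpos : forall j w, (0 < X j w)%N)
    (Xindep : mutually_independent P (fun j => X j : W -> nat))
    (Xlaw : forall j i, (0 < i)%N -> P [set w | X j w = i] = (p i)%:E)
    (ppos : forall i, (0 < i)%N -> 0 < p i)
    (pdecr : forall i, (0 < i)%N -> p i.+1 <= p i)
    (Tpoisson : unit_poisson_process P (fun j => T j : W -> R))
    (TXindep : independent_families P
       (fun j => T j : W -> R) (fun j => X j : W -> nat))
    (theta : R) (theta01 : 0 < theta < 1)
    (L : R -> R) (Lslow : slowly_varying L)
    (alphaE : forall x, (p 1%N)^-1 <= x -> (alpha p x)%:R = x `^ theta * L x)
    (m : nat) (m_gt0 : (0 < m)%N)
    (k : 'I_m -> nat) (k_gt0 : forall i, (0 < k i)%N)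
    (A : 'I_m -> set R) (Ameas : forall i, measurable (A i))
    (A01 : forall i, A i `<=` `[0, 1]) :
  exists (d' : measure_display) (W' : measurableType d')
    (P' : probability W' R) (Y : 'I_m -> {RV P' >-> R}),
  [/\ gaussian_vector P' (fun i => Y i : W' -> R),
      (forall i, 'E_P'[Y i] = 0)%E,
      (forall i j, covariance P' (Y i) (Y j) =
        (Kstar P (fun n => T n : W -> R) theta (A i) (k i) (A j) (k j))%:E) &
      weakly_converges P P'
        (fun t i => Ystar P (fun j => X j : W -> nat) (fun j => T j : W -> R)
                      t (A i) (k i))
        (fun i => Y i : W' -> R)].
Proof.
exact: (urn_clt P (fun j => X j : W -> nat) (fun j => T j : W -> R) p theta L
  (fun j => measurable_funPT (X j)) (fun j => measurable_funPT (T j)) Xindep Xlaw ppos pdecr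
  Tpoisson TXindep theta01 Lslow alphaE m A k Ameas A01 k_gt0).
Qed.
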